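(* Let $(M^{n}, g, f)$ be a compact gradient Ricci soliton with a conical singularity, i.e. $(M^{n}, g)$ is a compact Riemannian manifold with an isolated conical singularity and $f$ is a smooth function on the regular part $\mathring M$ with $$\mathrm{Ric}_g + \mathrm{Hess}_g f = \Lambda g\quad\text{on }\mathring M$$ for some constant $\Lambda$. If the cross section $(F,\hat g)$ of the model cone at the singular point has scalar curvature $R_{\hat{g}}=(n-1)(n-2)$, then, after adding a suitable constant to $f$, the potential function $f$ satisfies $$|\nabla^{i}f| = o(r^{\delta_0 -i})\qquad\text{as } r\rightarrow 0,$$ for some $\delta_0 > 0$ and all integers $i\ge 0$. In particular, $f \rightarrow 0$ at the conical singularity, and hence the potential function $f$ is bounded on $M$.
   Context: A compact Riemannian manifold $(M^n,g)$ with an isolated conical singularity with cross section $(F,\hat g)$: $M$ is a compact $n$-manifold with boundary $\partial M=F$, where $(F^{n-1},\hat g)$ is a closed Riemannian manifold; $g$ is a smooth Riemannian metric on the interior $\mathring M$ (the regular part); and on a collar neighborhood $(0,1)\times F$ of $\partial M$, with radial coordinate $r$ ($r=0$ corresponds to $\partial M$, which is metrically collapsed to the singular point), $g=g_0+h$ with $g_0=dr^2+r^2\hat g$ (the model cone) and $|r^k\nabla^k_{g_0}h|_{g_0}=O(r^\alpha)$ as $r\to0$ for some $\alpha>0$ and all integers $k\ge0$.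
   Formalization: The cross section F is assumed connected; for disconnected F the claim fails (collapse two points of a smooth compact nontrivial 4-dimensional soliton, where f takes different values, to one singular point), since no single constant makes f tend to 0. *)

(* Defs.v *)
From HB Require Import structures.
From mathcomp Require Export all_boot all_order all_algebra.
From mathcomp Require Export all_classical all_reals all_analysis.
Export Order.TTheory GRing.Theory Num.Theory.
Export numFieldNormedType.Exports.

Set Implicit Arguments.
Unset Strict Implicit.
Unset Printing Implicit Defensive.

#[export] Set Implicit Arguments.
#[export] Unset Strict Implicit.
#[export] Unset Printing Implicit Defensive.

Local Open Scope classical_set_scope.
Local Open Scope ring_scope.

Section Smoothness.
Context {R : realType} {n : nat}.
Implicit Types (U A : set 'rV[R]_n) (f : 'rV[R]_n -> R).

Definition partial (i : 'I_n) f : 'rV[R]_n -> R :=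
  fun x => 'D_(delta_mx 0 i) f x.

(* Meant for open [U]. *)
Fixpoint Ck (k : nat) U f : Prop :=
  (forall x, U x -> {for x, continuous f}) /\
  if k is k'.+1 then
    forall i, (forall x, U x -> derivable f x (delta_mx 0 i)) /\
              Ck k' U (partial i f)
  else True.

Definition Cinfty U f : Prop := forall k, Ck k U f.

(* Smoothness on an arbitrary subset: local extendability to a smooth function
   on an open set.  This is needed at the boundary points of a half-space. *)
Definition smooth_on A f : Prop :=
  forall x, A x -> exists U h,
    [/\ open U, U x, Cinfty U h & forall y, U y -> A y -> h y = f y].

Definition smooth_map_on (p : nat) A (F : 'rV[R]_n -> 'rV[R]_p) : Prop :=
  forall j, smooth_on A (fun x => F x ord0 j).

Definition jacobian (p : nat) (F : 'rV[R]_n -> 'rV[R]_p) (x : 'rV[R]_n)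
  : 'M[R]_(n, p) := \matrix_(i, j) partial i (fun y => F y ord0 j) x.

End Smoothness.

(* A chart is a pair of inverse maps between [cdom] and its image; their values
   outside of these sets are irrelevant. *)
Record chart (R : realType) (n : nat) (T : Type) := Chart {
  cdom : set T;
  coord : T -> 'rV[R]_n;
  param : 'rV[R]_n -> T }.

Section Manifold.
Context {R : realType} {n : nat} {T : topologicalType}.
Implicit Types (c d : chart R n T) (A : set (chart R n T)).

(* The model space [H] is [setT] for manifolds without boundary and [halfspace]
   below for manifolds with boundary. *)
Variable H : set 'rV[R]_n.

Definition cimage c : set 'rV[R]_n := coord c @` cdom c.

Definition is_chart c : Prop :=
  [/\ open (cdom c),
      exists2 U : set 'rV[R]_n, open U & cimage c = U `&` H,
      forall p, cdom c p -> param c (coord c p) = p,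
      {within cdom c, continuous (coord c)} &
      {within cimage c, continuous (param c)}].

Definition transition c d : 'rV[R]_n -> 'rV[R]_n := coord d \o param c.

Definition compatible c d : Prop :=
  smooth_map_on (coord c @` (cdom c `&` cdom d)) (transition c d) /\
  smooth_map_on (coord d @` (cdom c `&` cdom d)) (transition d c).

(* [A] is a maximal smooth atlas. *)
Definition smooth_structure A : Prop :=
  [/\ forall c, A c -> is_chart c,
      forall p, exists2 c, A c & cdom c p,
      forall c d, A c -> A d -> compatible c d &
      forall c, is_chart c -> (forall d, A d -> compatible c d) -> A c].

Definition smooth_manifold A : Prop :=
  [/\ hausdorff_space T, @second_countable T & smooth_structure A].

Definition mboundary A : set T :=
  [set p | exists c, [/\ A c, cdom c p & ~ H° (coord c p)]].

Definition minterior A : set T := ~` mboundary A.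

Definition int_image c : set 'rV[R]_n := cimage c `&` H°.

Definition smooth_on_interior A (f : T -> R) : Prop :=
  forall c, A c -> smooth_on (int_image c) (f \o param c).

(* A Riemannian metric on the interior, given by its matrix [g c x] at the
   point of coordinates [x] in each chart [c]. *)
Definition riemannian_metric A (g : chart R n T -> 'rV[R]_n -> 'M[R]_n)
  : Prop :=
  [/\ forall c i j, A c -> smooth_on (int_image c) (fun x => g c x i j),
      forall c x, A c -> int_image c x -> (g c x)^T = g c x,
      forall c x (v : 'rV[R]_n), A c -> int_image c x -> v != 0 ->
        0 < (v *m g c x *m v^T) ord0 ord0 &
      forall c d x, A c -> A d ->
        (coord c @` (cdom c `&` cdom d) `&` H°) x ->
        let J := jacobian (transition c d) x in
        g c x = J *m g d (transition c d x) *m J^T].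

End Manifold.

Section LocalRiemannianGeometry.
Context {R : realType} {n : nat}.

(* Components [t x I] at [x] of a covariant [k]-tensor field. *)
Definition tensor (k : nat) : Type := 'rV[R]_n -> k.-tuple 'I_n -> R.

Definition tensor0 (f : 'rV[R]_n -> R) : tensor 0 := fun x _ => f x.

Definition tensor2 (h : 'rV[R]_n -> 'M[R]_n) : tensor 2 :=
  fun x I => h x (tnth I ord0) (tnth I ord_max).

Variable G : 'rV[R]_n -> 'M[R]_n.

Definition christoffel (l i j : 'I_n) (x : 'rV[R]_n) : R :=
  2^-1 * \sum_(a < n) invmx (G x) l a *
    (partial i (fun y => G y j a) x + partial j (fun y => G y i a) x
     - partial a (fun y => G y i j) x).

(* The new differentiation index comes first. *)
Definition nabla (k : nat) (t : tensor k) : tensor k.+1 := fun x I =>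
  let i := thead I in
  let J : k.-tuple 'I_n := behead_tuple I in
  partial i (fun y => t y J) x
  - \sum_(a < k) \sum_(l < n) christoffel l i (tnth J a) x *
      t x [tuple (if b == a then l else tnth J b) | b < k].

Fixpoint nabla_iter {p : nat} (k : nat) (t : tensor p) : tensor (k + p) :=
  match k return tensor (k + p) with
  | 0 => t
  | k'.+1 => nabla (@nabla_iter p k' t)
  end.

Definition tensor_norm (k : nat) (t : tensor k) (x : 'rV[R]_n) : R :=
  Num.sqrt (\sum_(I : k.-tuple 'I_n) \sum_(J : k.-tuple 'I_n)
    (\prod_(a < k) invmx (G x) (tnth I a) (tnth J a)) * t x I * t x J).

(* [riemann l k i j] is the component R^l_{kij} of
   R(d_i, d_j) d_k = nabla_i nabla_j d_k - nabla_j nabla_i d_k. *)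
Definition riemann (l k i j : 'I_n) (x : 'rV[R]_n) : R :=
  partial i (christoffel l j k) x - partial j (christoffel l i k) x
  + \sum_(a < n) (christoffel l i a x * christoffel a j k x
                  - christoffel l j a x * christoffel a i k x).

Definition ricci (j k : 'I_n) (x : 'rV[R]_n) : R :=
  \sum_(l < n) riemann l k l j x.

Definition scalar_curvature (x : 'rV[R]_n) : R :=
  \sum_(j < n) \sum_(k < n) invmx (G x) j k * ricci j k x.

Definition hessian (f : 'rV[R]_n -> R) (i j : 'I_n) (x : 'rV[R]_n) : R :=
  @nabla_iter 0 2 (tensor0 f) x [tuple i; j].

End LocalRiemannianGeometry.

Arguments nabla_iter {R n} G {p} k t x I.

Definition halfspace (R : realType) (m : nat) : set 'rV[R]_m.+1 :=
  [set x | 0 <= x ord0 ord0].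

(* A closed manifold is understood to be connected, as is the link of an
   isolated singular point. *)
Definition closed_riemannian_manifold (R : realType) (m : nat)
    (F : topologicalType) (AF : set (chart R m F))
    (ghat : chart R m F -> 'rV[R]_m -> 'M[R]_m) : Prop :=
  [/\ smooth_manifold setT AF, compact [set: F], connected [set: F] &
      riemannian_metric setT AF ghat].

(* Coordinates [row_mx r y] on the cone over [F], in terms of the radius [r]
   and coordinates [y] on [F]. *)
Definition cone_metric (R : realType) (m : nat)
    (ghat : 'rV[R]_m -> 'M[R]_m) (x : 'rV[R]_m.+1) : 'M[R]_m.+1 :=
  block_mx (1%:M : 'M[R]_1) 0 0
    (x ord0 ord0 ^+ 2 *: ghat (rsubmx (x : 'rV[R]_(1 + m)))).

(* A collar [0,1) x F -> M of the boundary, with domain [cset] in [M]: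
   [cmap] is the identification, with inverse the pair ([crad], [cprj]). *)
Record collar (R : realType) (M F : Type) := Collar {
  cset : set M;
  crad : M -> R;
  cprj : M -> F;
  cmap : R -> F -> M }.

Section ConicalSingularity.
Context {R : realType} {m : nat} {M F : topologicalType}.
Implicit Types (AM : set (chart R m.+1 M)) (AF : set (chart R m F)).
Implicit Types (K : collar R M F) (a : chart R m F).

Definition collar_chart K a : chart R m.+1 M :=
  {| cdom := [set p | cset K p /\ cdom a (cprj K p)];
     coord := fun p => row_mx (crad K p)%:M (coord a (cprj K p));
     param := fun x => cmap K (x ord0 ord0)
                         (param a (rsubmx (x : 'rV[R]_(1 + m)))) |}.

(* Membership of the [collar_chart]s in the smooth structure of [M] expresses
   that [cmap] is a diffeomorphism of [0,1) x F onto [cset]. *)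
Definition is_collar AM AF K : Prop :=
  [/\ open (cset K),
      forall p, cset K p ->
        0 <= crad K p < 1 /\ cmap K (crad K p) (cprj K p) = p,
      forall s q, 0 <= s < 1 ->
        [/\ cset K (cmap K s q), crad K (cmap K s q) = s
          & cprj K (cmap K s q) = q],
      forall p, mboundary (@halfspace R m) AM p <->
                cset K p /\ crad K p = 0 &
      forall a, AF a -> AM (collar_chart K a)].

(* [P] holds for all small [r > 0], uniformly on [F]. *)
Definition near_tip K (P : M -> Prop) : Prop :=
  exists2 eta : R, 0 < eta &
    forall p, cset K p -> 0 < crad K p < eta -> P p.

(* |r^k nabla_{g0}^k (g - g0)|_{g0} = O(r^alpha) for all k. *)
Definition asymptotically_conical AF K
    (g : chart R m.+1 M -> 'rV[R]_m.+1 -> 'M[R]_m.+1)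
    (ghat : chart R m F -> 'rV[R]_m -> 'M[R]_m) (alpha : R) : Prop :=
  forall k : nat, exists C : R, near_tip K (fun p =>
    forall a, AF a -> cdom a (cprj K p) ->
      let c := collar_chart K a in
      let g0 := cone_metric (ghat a) in
      let h := fun x => g c x - g0 x in
      crad K p ^+ k *
        tensor_norm g0 (nabla_iter g0 k (tensor2 h)) (coord c p)
      <= C * crad K p `^ alpha).

(* A compact (m+1)-dimensional Riemannian manifold with an isolated conical
   singularity with cross section [(F, ghat)]. *)
Definition conical_manifold AM
    (g : chart R m.+1 M -> 'rV[R]_m.+1 -> 'M[R]_m.+1) AF
    (ghat : chart R m F -> 'rV[R]_m -> 'M[R]_m) K : Prop :=
  [/\ smooth_manifold (@halfspace R m) AM /\ compact [set: M],
      riemannian_metric (@halfspace R m) AM g,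
      closed_riemannian_manifold AF ghat,
      is_collar AM AF K &
      exists2 alpha : R, 0 < alpha & asymptotically_conical AF K g ghat alpha].

Definition gradient_ricci_soliton AM
    (g : chart R m.+1 M -> 'rV[R]_m.+1 -> 'M[R]_m.+1)
    (f : M -> R) (Lambda : R) : Prop :=
  smooth_on_interior (@halfspace R m) AM f /\
  forall c x i j, AM c -> int_image (@halfspace R m) c x ->
    ricci (g c) i j x + hessian (g c) (f \o param c) i j x
    = Lambda * g c x i j.

(* |nabla^i f| = o(r^beta) as r -> 0. *)
Definition nabla_littleo AM
    (g : chart R m.+1 M -> 'rV[R]_m.+1 -> 'M[R]_m.+1) K
    (f : M -> R) (i : nat) (beta : R) : Prop :=
  forall eps : R, 0 < eps -> near_tip K (fun p =>
    forall c, AM c -> cdom c p ->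
      tensor_norm (g c) (nabla_iter (g c) i (tensor0 (f \o param c)))
        (coord c p)
      <= eps * crad K p `^ beta).

End ConicalSingularity.

(* Main.v *)
(* In conical coordinates (r, y), let w(I) be the number of link indices among
   the indices I.  The decay of h = g - g0 and of its covariant derivatives means
   that h_ij = O(r^(al + w(ij))) in the sense of symbols, hence Gamma_g - Gamma_g0
   and Ric_g - Ric_g0 gain a factor r^al over the model; one may take al < 1.  As
   Ric_g0 has no radial component, the radial components of the soliton equation
   are a linear ODE along the rays for the components d_a f of the gradient.
   Once d_a f is divided by r^(al - 1 + w(a)), its square norm increases with r
   wherever it is large, so d_a f = O(r^(al - 1 + w(a))).  Therefore f = L + O(r^al),
   where L is locally constant on F, thus constant.  In the link directions,
   d_i d_j f = - Ric_g0(i, j) + O(r^al), whereas d_j f = O(r^al), so Ric_g0 = 0.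
   It follows that Hess f = Lambda g - Ric_g is O(r^(al - 2)) with all its
   derivatives and nabla^k f = O(r^(al - k)); this gives delta0 = al / 2 for f - L.
   Norms do not depend on charts, so these estimates extend from the collar charts
   to all charts, uniformly by compactness of F; compactness of M bounds f. *)
From HB Require Import structures.
Require Import Defs.
From mathcomp Require Import perm lra ring.

Set SsrOldRewriteGoalsOrder.
Local Open Scope classical_set_scope.
Local Open Scope ring_scope.

(** No growth of [f] near the tip is assumed, so the gradient estimate has to propagate inwards from
    a fixed radius [r0], where compactness of a link patch provides a bound. For
    [v a = r^(1 - al - w a) d_a f] the weight [w a] in the exponent cancels the one that the cone
    connection puts into the radial equation, and [r v' = (1 - al) v + E] has the same rate in every
    component. The rate is positive because [al < 1]: a norm too large at a small radius would still
    be too large at [r0]. Only first derivatives need this argument, since the soliton equation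
    expresses the Hessian through the metric and its curvature.

    The decay of [g] is given for norms of covariant derivatives, whereas the radial equation needs
    components and their partial derivatives. [symbol] mediates between the two, being closed under
    the operations that build Christoffel symbols and curvature. With the trivial growth relation,
    the same closure lemmas serve as the calculus of smooth functions. Uniform constants come from
    patches [V] of the link contained in a compact [B], itself contained in a chart image [U]. *)

Section Calculus.
Context {R : realType}.

(** * Multivariate calculus from partial derivatives *)

Lemma coord_le_norm n (v : 'rV[R]_n) i : `|v ord0 i| <= `|v|.
Proof.
have /mapP[j Hj E] : `|v ord0 i| \in [seq `|v x.1 x.2| | x : 'I_1 * 'I_n].
  by apply/mapP; exists (ord0, i) => //=; rewrite mem_enum.
rewrite [leRHS]/Num.norm /= mx_normrE E; apply/bigmax_geP; right => /=.
by exists j.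
Qed.

Lemma norm_le_coord n (v : 'rV[R]_n) (e : R) : 0 <= e ->
  (forall i, `|v ord0 i| <= e) -> `|v| <= e.
Proof.
move=> e0 ve; rewrite [leLHS]/Num.norm /= mx_normrE; apply/bigmax_leP; split=> //.
by move=> [i j] _ /=; rewrite ord1.
Qed.

Lemma is_derive_line n (f : 'rV[R]_n -> R) (x v : 'rV[R]_n) (s : R) :
  derivable f (s *: v + x) v ->
  is_derive s (1 : R) (fun t : R => f (t *: v + x)) ('D_v f (s *: v + x)).
Proof.
have E : (fun h : R => h^-1 *: (((fun t : R => f (t *: v + x)) \o shift s)
    (h *: (1 : R)) - f (s *: v + x))) =
   (fun h : R => h^-1 *: ((f \o shift (s *: v + x)) (h *: v) - f (s *: v + x))).
  apply/funext => h /=; congr (_ *: (f _ - _)).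
  by rewrite [h *: 1]mulr1 scalerDl addrA.
move=> fd; apply: DeriveDef; first by rewrite /derivable E.
by rewrite /derive E.
Qed.

(** Since [h] may have either sign, [key] treats ordered endpoints and is applied to [0, h] or to
    [h, 0]. *)
Lemma mvt_line n (f : 'rV[R]_n -> R) (x v : 'rV[R]_n) (h : R) :
  (forall c : R, `|c| <= `|h| -> derivable f (c *: v + x) v) ->
  exists2 c : R, `|c| <= `|h| & f (h *: v + x) - f x = 'D_v f (c *: v + x) * h.
Proof.
move=> fd.
have key a b : a <= b -> `|a| <= `|h| -> `|b| <= `|h| ->
    exists2 c : R, `|c| <= `|h| &
      f (b *: v + x) - f (a *: v + x) = 'D_v f (c *: v + x) * (b - a).
  rewrite !ler_norml => ab /andP[ha ha'] /andP[hb hb'].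
  have inh c : c \in `[a, b] -> `|c| <= `|h|.
    rewrite in_itv/= => /andP[ac cb]; rewrite ler_norml.
    by rewrite (le_trans ha ac) (le_trans cb hb').
  have isd c : c \in `[a, b] ->
      is_derive c 1 (fun t : R => f (t *: v + x)) ('D_v f (c *: v + x)).
    by move=> cab; apply/is_derive_line/fd/inh.
  pose F t : R := f (t *: v + x); pose dF t : R := 'D_v f (t *: v + x).
  have F1 (c : R) : c \in `]a, b[ -> is_derive c 1 F (dF c).
    by move=> cab; apply: isd; apply: subset_itv_oo_cc cab.
  have F2 : {within `[a, b], continuous F}.
    by apply: derivable_within_continuous => c cab; have [] := isd c cab.
  have [c cab E] := @MVT_segment R F dF a b ab F1 F2.
  by exists c => //; apply: inh.
have [h0|/ltW h0] := leP 0 h.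
  have [||c ch E] := key 0 h h0; rewrite ?normr0 //.
  by exists c => //; rewrite scale0r add0r subr0 in E.
have [||c ch E] := key h 0 h0; rewrite ?normr0 //.
exists c => //; move/eqP: E; rewrite scale0r add0r sub0r mulrN.
by rewrite -eqr_oppLR opprB => /eqP.
Qed.

(** The points [trunc_row h k + x] for [k] from 0 to [n] are the corners of a path from [x] to
    [h + x] with edges parallel to the axes. *)
Definition trunc_row n (h : 'rV[R]_n) (k : nat) : 'rV[R]_n :=
  \row_i (if (i < k)%N then h ord0 i else 0).

Lemma trunc_row0 n (h : 'rV[R]_n) : trunc_row h 0 = 0.
Proof. by apply/rowP => i; rewrite !mxE. Qed.

Lemma trunc_row_full n (h : 'rV[R]_n) : trunc_row h n = h.
Proof. by apply/rowP => i; rewrite !mxE ltn_ord. Qed.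

Lemma trunc_rowS n (h : 'rV[R]_n) (k : 'I_n) :
  trunc_row h k.+1 = h ord0 k *: delta_mx 0 k + trunc_row h k.
Proof.
apply/rowP => i; rewrite !mxE eqxx /= ltnS leq_eqVlt -(inj_eq val_inj) /=.
by case: ltngtP => [||/val_inj ->]; rewrite ?(mulr0, mulr1, add0r, addr0).
Qed.

(** The increment of [f] telescopes along the path of truncations, and the mean value theorem on
    each edge compares it with one term of the linear form. *)
Lemma taylor1_bound n (f : 'rV[R]_n -> R) (x : 'rV[R]_n) (c : 'I_n -> R)
    (e d : R) :
  (forall y i, `|y - x| < d ->
     derivable f y (delta_mx 0 i) /\ `|partial i f y - c i| <= e) ->
  forall h : 'rV[R]_n, `|h| < d ->
    `|f (h + x) - f x - \sum_i h ord0 i * c i| <= n%:R * e * `|h|.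
Proof.
move=> H h hd.
rewrite -[in f (h + x)](trunc_row_full h).
have -> : f x = f (trunc_row h 0 + x) by rewrite trunc_row0 add0r.
have tel := @telescope_sumr R 0 n (fun k => f (trunc_row h k + x)) (leq0n n).
rewrite -tel big_mkord -sumrB.
rewrite (le_trans (ler_norm_sum _ _ _)) // -mulrA mulr_natl.
have -> : (e * `|h|) *+ n = \sum_(i < n) (e * `|h|).
  by rewrite sumr_const card_ord.
apply: ler_sum => k _; rewrite trunc_rowS -(addrA _ (trunc_row h k) x).
have hk := coord_le_norm h k.
(* The whole edge stays in the ball: in the sup norm, truncating [h] or shrinking one of its
   coordinates does not increase the norm. *)
have near_ c' : `|c'| <= `|h ord0 k| ->
    `|c' *: delta_mx 0 k + (trunc_row h k + x) - x| < d.
  move=> ch; rewrite addrA addrK; apply: le_lt_trans hd.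
  apply: norm_le_coord => // i; rewrite !mxE eqxx /=.
  have [->|ik] := eqVneq i k; first by rewrite ltnn addr0 mulr1 (le_trans ch).
  rewrite mulr0 add0r; case: ifP => _; first exact: coord_le_norm.
  by rewrite normr0.
have [|c' ch ->] := @mvt_line n f (trunc_row h k + x) (delta_mx 0 k) (h ord0 k).
  by move=> c' ch; have [] := H _ k (near_ c' ch).
have [_ Hc] := H _ k (near_ c' ch).
rewrite mulrC -mulrBr normrM mulrC; apply: ler_pM => //.
Qed.

Definition rowdot n (c : 'I_n -> R) (h : 'rV[R]_n) : R^o := \sum_i h ord0 i * c i.

Lemma rowdot_is_linear n (c : 'I_n -> R) : linear (rowdot c).
Proof.
move=> a u v; rewrite /rowdot scaler_sumr -big_split /=.
by apply: eq_bigr => i _; rewrite !mxE mulrDl scalerAl.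
Qed.
HB.instance Definition _ n (c : 'I_n -> R) :=
  GRing.isLinear.Build R 'rV[R]_n R^o _ (rowdot c) (rowdot_is_linear c).

Lemma rowdot_continuous n (c : 'I_n -> R) : continuous (rowdot c).
Proof.
have : continuous (fun h : 'rV[R]_n => \sum_i (h ord0 i * c i)).
  apply: continuous_big => [|i _ x]; first exact: add_continuous.
  apply: continuousM; first exact: coord_continuous.
  exact: cst_continuous.
exact.
Qed.

Lemma continuous_partials_differentiable n (f : 'rV[R]_n -> R) (x : 'rV[R]_n) :
  (\forall y \near x, forall i, derivable f y (delta_mx 0 i)) ->
  (forall i, {for x, continuous (partial i f)}) ->
  differentiable f x.
Proof.
move=> fd fc; pose c i := partial i f x.
pose fo : 'rV[R]_n -> R^o := f.
suff H : fo \o shift x = cst (fo x) + (rowdot c : 'rV[R]_n -> R^o) +o_ (0 : 'rV[R]_n) id.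
  have E := diff_unique (@rowdot_continuous n c) H.
  by apply/diff_locallyP; rewrite E; split=> //; apply: rowdot_continuous.
apply/eqaddoP => _ /posnumP[e].
(* Dividing by [n + 1] rather than [n] makes [n * e' <= e] hold for [n = 0] too. *)
pose e' := e%:num / n.+1%:R.
have e'0 : 0 < e' by rewrite divr_gt0.
have : \forall y \near x, forall i : 'I_n,
    derivable f y (delta_mx 0 i) /\ `|partial i f y - c i| <= e'.
  have : \forall y \near x, forall i : 'I_n, `|partial i f y - c i| <= e'.
    apply: (@filter_forall _ _ (fun i y => `|partial i f y - c i| <= e') (nbhs x)) => i.
    have /cvgrPdist_le := fc i.
    by move=> /(_ _ e'0); apply: filterS => y; rewrite distrC.
  by apply: filter_app; apply: filterS fd => y h1 h2 i; split.
move=> /nbhs_ballP[d /= d0 Hd].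
have T := @taylor1_bound n f x c e' d.
apply/nbhs_ballP; exists d => // h; rewrite -ball_normE /= sub0r normrN => hd.
have Tb : `|f (h + x) - f x - rowdot c h| <= n%:R * e' * `|h|.
  by apply: T => // y i yx; apply: Hd; rewrite -ball_normE /= distrC.
have -> : (fo \o shift x - (cst (fo x) + (rowdot c : 'rV[R]_n -> R^o))) h =
    f (h + x) - f x - rowdot c h.
  by rewrite -addrA -opprD.
apply: le_trans Tb _.
rewrite ler_wpM2r // /e' mulrCA ger_pMr //.
by rewrite ler_pdivrMr ?ltr0n // mul1r ler_nat.
Unshelve. all: by end_near. Qed.


Lemma derive_line (V W : normedModType R) (f : V -> W) x v :
  'D_v f x = 'D_1 (fun h : R => f (h *: v + x)) 0.
Proof.
rewrite /derive; set g1 := (fun h : R => h^-1 *: ((f \o shift x) _ - _)).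
set g2 := (fun h : R => h^-1 *: _); suff -> : g1 = g2 by [].
rewrite funeqE /g1 /g2 => h /=.
by rewrite addr0 scale0r add0r [h%:A]mulr1.
Qed.

(** Only a directional derivative of [phi] is available, so the chain rule is applied to [u] after
    the curve [h |-> phi (h v + x)], for which derivability and differentiability agree. *)
Lemma derive_comp_line n p (u : 'rV[R]_p -> R) (phi : 'rV[R]_n -> 'rV[R]_p)
    (x v : 'rV[R]_n) :
  (forall j, derivable (fun y => phi y ord0 j) x v) ->
  differentiable u (phi x) ->
  derivable (u \o phi) x v /\
  'D_v (u \o phi) x =
    \sum_j 'D_v (fun y => phi y ord0 j) x * partial j u (phi x).
Proof.
move=> phid ud.
have phd : derivable phi x v.
  apply/derivable_mxP => i j; rewrite ord1; exact: phid.
pose g (h : R) := phi (h *: v + x).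
have phd1 := iffLR (derivable1P phi x v) phd.
have gd : differentiable g 0 := iffLR (derivable1_diffP _ _) phd1.
have g0 : g 0 = phi x by rewrite /g scale0r add0r.
have ugd : differentiable (u \o g) 0.
  by apply: differentiable_comp => //; rewrite g0.
split.
  exact: iffRL (derivable1P (u \o phi) x v) (iffRL (derivable1_diffP _ _) ugd).
have E1 : 'D_v (u \o phi) x = 'D_1 (u \o g) 0 by rewrite derive_line.
have E2 : 'D_v phi x = 'D_1 g 0 by rewrite derive_line.
rewrite E1 deriveE // diff_comp ?g0 //=.
have -> : 'd g 0 1 = 'D_v phi x by rewrite E2 deriveE.
rewrite (derive_mx phd).
set w := (X in 'd u _ X).
rewrite [w]row_sum_delta linear_sum; apply: eq_bigr => j _.
by rewrite linearZ /= mxE /partial (deriveE _ ud).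
Qed.


Lemma derive_translate (V W : normedModType R) (f : V -> W) w x v :
  'D_v (fun y => f (w + y)) x = 'D_v f (w + x).
Proof.
rewrite /derive; set g1 := (fun h : R => _ *: ((f \o _) _ - _)).
set g2 := (fun h : R => h^-1 *: _); suff -> : g1 = g2 by [].
by rewrite funeqE /g1 /g2 => h /=; rewrite [w + (_ + _)]addrCA.
Qed.

Lemma derivable_translate (V W : normedModType R) (f : V -> W) w x v :
  derivable f (w + x) v -> derivable (fun y => f (w + y)) x v.
Proof.
rewrite /derivable; set g1 := (fun h : R => _ *: ((f \o _) _ - _)).
set g2 := (fun h : R => h^-1 *: _); suff -> : g1 = g2 by [].
by rewrite funeqE /g1 /g2 => h /=; rewrite [w + (_ + _)]addrCA.
Qed.

(** The mean value theorem is used twice: in direction [i] for the difference [F] of [f] over a step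
    in direction [j], then in direction [j] for [partial i f]. *)
Lemma second_difference n (f : 'rV[R]_n -> R) (x : 'rV[R]_n) (d s : R) i j :
  (forall y k, `|y - x| < d -> derivable f y (delta_mx 0 k)) ->
  (forall y k l, `|y - x| < d -> derivable (partial k f) y (delta_mx 0 l)) ->
  `|s| + `|s| < d ->
  exists2 p, `|p - x| <= `|s| + `|s| &
    f (s *: delta_mx 0 j + (s *: delta_mx 0 i + x)) - f (s *: delta_mx 0 i + x)
    - (f (s *: delta_mx 0 j + x) - f x) = partial j (partial i f) p * s * s.
Proof.
move=> fd fdd sd.
have nd k : `|delta_mx 0 k : 'rV[R]_n| <= 1.
  apply: norm_le_coord => // l; rewrite mxE eqxx /=.
  by case: eqP; rewrite ?normr1 ?normr0.
have ne k (c : R) : `|c *: (delta_mx 0 k : 'rV[R]_n)| <= `|c|.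
  by rewrite normrZ ler_piMr.
have ns c c' : `|c| <= `|s| -> `|c'| <= `|s| ->
    `|c' *: delta_mx 0 j + (c *: delta_mx 0 i + x) - x| <= `|s| + `|s|.
  move=> cs cs'; rewrite addrA addrK (le_trans (ler_normD _ _)) // lerD //.
    by rewrite (le_trans (ne _ _)).
  by rewrite (le_trans (ne _ _)).
pose F y := f (s *: delta_mx 0 j + y) - f y.
have d1 c : `|c| <= `|s| ->
    derivable f (s *: delta_mx 0 j + (c *: delta_mx 0 i + x)) (delta_mx 0 i).
  by move=> cs; apply: fd; rewrite (le_lt_trans (ns c s cs _)).
have d0 c : `|c| <= `|s| -> derivable f (c *: delta_mx 0 i + x) (delta_mx 0 i).
  move=> cs; apply: fd; have := ns c 0 cs; rewrite scale0r add0r normr0.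
  by move=> /(_ (normr_ge0 _)) /le_lt_trans; apply.
have Fd c : `|c| <= `|s| -> derivable F (c *: delta_mx 0 i + x) (delta_mx 0 i).
  by move=> cs; apply: derivableB; [exact/derivable_translate/d1|exact: d0].
have [c cs E] := mvt_line Fd.
have dd c' : `|c'| <= `|s| -> derivable (partial i f)
    (c' *: delta_mx 0 j + (c *: delta_mx 0 i + x)) (delta_mx 0 j).
  by move=> cs'; apply: fdd; rewrite (le_lt_trans (ns _ _ cs cs')).
have [c' cs' E'] := mvt_line dd.
exists (c' *: delta_mx 0 j + (c *: delta_mx 0 i + x)); first exact: ns.
rewrite -[LHS]/(F (s *: delta_mx 0 i + x) - F x) E; congr (_ * _).
rewrite -E' deriveB; [|exact/derivable_translate/d1|exact: d0].
by rewrite derive_translate.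
Qed.

Lemma second_difference_sym (a a' b c d p q : R) :
  a - b - (c - d) = p -> a' - c - (b - d) = q -> a' = a -> p = q.
Proof. by move=> <- <- ->; ring. Qed.

Lemma dist_common (a b c d : R) : d = c -> `|a - b| <= `|a - c| + `|b - d|.
Proof.
move=> ->; have -> : a - b = (a - c) - (b - c) by ring.
exact: ler_normB.
Qed.

(** The second difference does not depend on the order of the two directions, so the two mixed
    derivatives take a common value at points [p] and [q] close to [x]; continuity transfers this to
    [x]. *)
Lemma partialC n (f : 'rV[R]_n -> R) (x : 'rV[R]_n) i j :
  (\forall y \near x, forall k, derivable f y (delta_mx 0 k)) ->
  (\forall y \near x, forall k l, derivable (partial k f) y (delta_mx 0 l)) ->
  (forall k l, {for x, continuous (partial k (partial l f))}) ->
  partial i (partial j f) x = partial j (partial i f) x.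
Proof.
move=> fd fdd fc; apply/eqP; rewrite -subr_eq0 -normr_le0.
apply/ler_addgt0Pl => e e0; rewrite addr0.
have e20 : 0 < e / 2 by rewrite divr_gt0.
have nearc k l : \forall y \near x,
    `|partial k (partial l f) x - partial k (partial l f) y| <= e / 2.
  by have /cvgrPdist_le/(_ _ e20) := fc k l.
have FI : setI_closed (nbhs x) by apply: filterI.
have /nbhs_ballP[d /= d0 Hd] :=
  FI _ _ (FI _ _ fd fdd) (FI _ _ (nearc i j) (nearc j i)).
have B y : `|y - x| < d -> ball x d y by rewrite -ball_normE /= distrC.
pose s := d / 4%:R.
have s0 : 0 < s by rewrite divr_gt0.
have sd : `|s| + `|s| < d.
  by rewrite gtr0_norm // /s; lra.
have f1 y k : `|y - x| < d -> derivable f y (delta_mx 0 k).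
  by move=> yx; have [[H _] _] := Hd _ (B _ yx); apply: H.
have f2 y k l : `|y - x| < d -> derivable (partial k f) y (delta_mx 0 l).
  by move=> yx; have [[_ H] _] := Hd _ (B _ yx); apply: H.
have [p px Ep] := second_difference i j f1 f2 sd.
have [q qx Eq] := second_difference j i f1 f2 sd.
have [_ [_ Hp]] := Hd _ (B _ (le_lt_trans px sd)).
have [_ [Hq _]] := Hd _ (B _ (le_lt_trans qx sd)).
have pq : partial j (partial i f) p = partial i (partial j f) q.
  have : partial j (partial i f) p * s * s = partial i (partial j f) q * s * s.
    exact: second_difference_sym Ep Eq (congr1 f (addrCA _ _ _)).
  by move=> /mulIf/mulIf; apply; rewrite gt_eqF.
rewrite [e]splitr; apply: le_trans (lerD Hq Hp).
exact: dist_common pq.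
Qed.

End Calculus.

(** * Symbol classes *)

Section NearEq.
Context {R : realType} {n : nat}.
Implicit Types (D : set 'rV[R]_n) (u v : 'rV[R]_n -> R).

Lemma open_near_eq D u v x : open D -> (forall y, D y -> u y = v y) -> D x ->
  \near x, u x = v x.
Proof.
move=> Do uv Dx; have : nbhs x D by apply: open_nbhs_nbhs.
by apply: filterS => y; apply: uv.
Qed.

Lemma continuous_on_ext D u v x : open D -> (forall y, D y -> u y = v y) ->
  D x -> {for x, continuous u} -> {for x, continuous v}.
Proof.
move=> Do uv Dx uc; suff : v @ x --> v x by []; rewrite -(uv x Dx).
have Nx := open_near_eq Do uv Dx.
exact: cvg_trans (near_eq_cvg Nx) uc.
Qed.

Lemma derivable_on_ext D u v x w : open D -> (forall y, D y -> u y = v y) ->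
  D x -> derivable u x w -> derivable v x w.
Proof.
move=> Do uv Dx; apply: near_eq_derivable.
exact: open_near_eq Dx.
Qed.

Lemma partial_on_ext D u v x i : open D -> (forall y, D y -> u y = v y) ->
  D x -> partial i u x = partial i v x.
Proof.
move=> Do uv Dx; apply: near_eq_derive.
exact: open_near_eq Dx.
Qed.

End NearEq.

(* An abstract order of growth: read [bd b u] as u = O(r^b). *)
Record growth (R : realType) (n : nat) (D : set 'rV[R]_n)
    (bd : R -> ('rV[R]_n -> R) -> Prop) : Prop := Growth {
  growth_open : open D;
  growth_ext : forall b u v, (forall x, D x -> u x = v x) -> bd b u -> bd b v;
  growth0 : forall b, bd b (cst 0);
  growth_cst : forall c, bd 0 (cst c);
  growthD : forall b u v, bd b u -> bd b v -> bd b (fun x => u x + v x);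
  growthM : forall b c u v, bd b u -> bd c v ->
    bd (b + c) (fun x => u x * v x) }.

Section Symbols.
Context {R : realType} {n : nat}.
Implicit Types (D : set 'rV[R]_n) (u v : 'rV[R]_n -> R).
Implicit Types (bd : R -> ('rV[R]_n -> R) -> Prop) (w : 'I_n -> R).

(* u and its derivatives of order at most k have the order of growth of a
   homogeneous function of degree b, the derivative in direction i lowering the
   degree by 1 - w i.  With the weights w(0) = 0 and w(i) = 1 on the cone, where
   the coordinates on the link have degree 0, a covariant tensor has degree b
   when its components of indices I have exponent b + w(I). *)
Fixpoint symbol D bd w (k : nat) (b : R) u : Prop :=
  (forall x, D x -> {for x, continuous u}) /\ bd b u /\
  if k is k'.+1 then
    forall i, (forall x, D x -> derivable u x (delta_mx 0 i)) /\
              symbol D bd w k' (b + w i - 1) (partial i u)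
  else True.

(** For the trivial growth relation the weights and the exponent carry no information, so each
    closure property of symbols is also one of smooth functions. *)
Lemma Ck_symbolP D w k b u :
  Ck k D u <-> symbol D (fun _ _ => True) w k b u.
Proof.
elim: k b u => [|k IH] b u /=; first by split=> [[]|[? []]].
split=> [[uc ud]|[uc [_ ud]]].
  by do 2?split=> //; move=> i; have [] := ud i; split=> //; apply/IH.
by split=> // i; have [? us] := ud i; split=> //; apply: (iffRL (IH _ _)) us.
Qed.

Lemma trivial_growth D : open D -> growth D (fun _ _ => True).
Proof. by move=> Do; split. Qed.

Context {D : set 'rV[R]_n} {bd : R -> ('rV[R]_n -> R) -> Prop}.
Context {w : 'I_n -> R}.
Hypothesis gr : growth D bd.
Local Notation sym := (symbol D bd w).
Let Do := growth_open gr.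

Lemma symbol_bd k b u : sym k b u -> bd b u.
Proof. by case: k => [|k] [_ []]. Qed.

Lemma symbol_continuous k b u x : sym k b u -> D x -> {for x, continuous u}.
Proof. by case: k => [|k] [uc _]; apply: uc. Qed.

Lemma symbol_derivable k b u x i : sym k.+1 b u -> D x ->
  derivable u x (delta_mx 0 i).
Proof. by move=> [_ [_ /(_ i)[ud _]]]; apply: ud. Qed.

Lemma symbol_partial k b u i : sym k.+1 b u ->
  sym k (b + w i - 1) (partial i u).
Proof. by move=> [_ [_ /(_ i)[]]]. Qed.

Lemma symbolS k b u : sym k.+1 b u -> sym k b u.
Proof.
elim: k b u => [|k IH] b u; first by move=> [uc [ub _]].
move=> [uc [ub ud]]; do 2?split=> //; move=> i; have [uid us] := ud i.
by split=> //; apply: IH.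
Qed.

Lemma symbol_ext k b u v : (forall x, D x -> u x = v x) -> sym k b u -> sym k b v.
Proof.
elim: k b u v => [|k IH] b u v uv [uc [ub ud]].
  split; first by move=> x Dx; apply: continuous_on_ext uv Dx (uc x Dx).
  by split=> //; apply: (growth_ext gr uv ub).
split; first by move=> x Dx; apply: continuous_on_ext uv Dx (uc x Dx).
split; first exact: (growth_ext gr uv ub).
move=> i; have [uid us] := ud i; split.
  by move=> x Dx; apply: derivable_on_ext uv Dx (uid x Dx).
by apply: IH us => x Dx; apply: partial_on_ext Dx.
Qed.

Lemma symbol_exponent k b c u : b = c -> sym k b u -> sym k c u.
Proof. by move=> ->. Qed.

Lemma symbol_weaken k b c u :
  (forall b c u, c <= b -> bd b u -> bd c u) -> c <= b -> sym k b u -> sym k c u.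
Proof.
move=> bm; elim: k b c u => [|k IH] b c u cb [uc [ub ud]].
  by split=> //; split=> //; apply: bm ub.
split=> //; split; first exact: bm ub.
by move=> i; have [uid us] := ud i; split=> //; apply: IH us; lra.
Qed.

Lemma symbol0 k b : sym k b (fun=> 0).
Proof.
elim: k b => [|k IH] b.
  split; first by move=> x _; apply: cst_continuous.
  by split=> //; apply: (growth0 gr).
split; first by move=> x _; apply: cst_continuous.
split; first exact: (growth0 gr).
move=> i; split=> [x _|]; first exact: derivable_cst.
by apply: symbol_ext (IH _) => x _; rewrite /partial derive_cst.
Qed.

Lemma symbol_cst k c : sym k 0 (fun=> c).
Proof.
case: k => [|k].
  split; first by move=> x _; apply: cst_continuous.
  by split=> //; apply: (growth_cst gr).
split; first by move=> x _; apply: cst_continuous.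
split; first exact: (growth_cst gr).
move=> i; split=> [x _|]; first exact: derivable_cst.
by apply: symbol_ext (symbol0 _ _) => x _; rewrite /partial derive_cst.
Qed.

Lemma symbolD k b u v : sym k b u -> sym k b v -> sym k b (fun x => u x + v x).
Proof.
elim: k b u v => [|k IH] b u v [uc [ub ud]] [vc [vb vd]].
  split=> [x Dx|]; first exact: continuousD (uc x Dx) (vc x Dx).
  by split=> //; apply: (growthD gr).
split=> [x Dx|]; first exact: continuousD (uc x Dx) (vc x Dx).
split; first exact: (growthD gr).
move=> i; have [uid us] := ud i; have [vid vs] := vd i; split=> [x Dx|].
  exact: derivableD (uid x Dx) (vid x Dx).
apply: symbol_ext (IH _ _ _ us vs) => x Dx.
by rewrite /partial -(deriveD (uid x Dx) (vid x Dx)).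
Qed.

Lemma symbolM k b c u v : sym k b u -> sym k c v ->
  sym k (b + c) (fun x => u x * v x).
Proof.
elim: k b c u v => [|k IH] b c u v us vs.
  have [uc [ub _]] := us; have [vc [vb _]] := vs.
  split=> [x Dx|]; first exact: continuousM (uc x Dx) (vc x Dx).
  by split=> //; apply: (growthM gr).
have := us => -[uc [ub ud]]; have := vs => -[vc [vb vd]].
split=> [x Dx|]; first exact: continuousM (uc x Dx) (vc x Dx).
split; first exact: (growthM gr).
move=> i; have [uid us'] := ud i; have [vid vs'] := vd i; split=> [x Dx|].
  exact: derivableM (uid x Dx) (vid x Dx).
have s1 : sym k (b + c + w i - 1) (fun x => u x * partial i v x).
  by apply: symbol_exponent (IH _ _ _ _ (symbolS us) vs'); ring.
have s2 : sym k (b + c + w i - 1) (fun x => v x * partial i u x).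
  by apply: symbol_exponent (IH _ _ _ _ (symbolS vs) us'); ring.
apply: symbol_ext (symbolD s1 s2) => x Dx.
by rewrite [RHS](deriveM (uid x Dx) (vid x Dx)).
Qed.

Lemma symbolZ k b c u : sym k b u -> sym k b (fun x => c * u x).
Proof.
by move=> us; apply: symbol_exponent (symbolM (symbol_cst k c) us); rewrite add0r.
Qed.

Lemma symbolN k b u : sym k b u -> sym k b (fun x => - u x).
Proof.
by move=> us; apply: symbol_ext (symbolZ (-1) us) => x _; rewrite mulN1r.
Qed.

Lemma symbolB k b u v : sym k b u -> sym k b v -> sym k b (fun x => u x - v x).
Proof. by move=> us vs; apply: symbolD us (symbolN vs). Qed.

Lemma symbol_sum k b (I : Type) (r : seq I) (P : pred I)
    (F : I -> 'rV[R]_n -> R) :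
  (forall i, P i -> sym k b (F i)) ->
  sym k b (fun x => \sum_(i <- r | P i) F i x).
Proof.
move=> Fs; elim: r => [|i r IH].
  by apply: symbol_ext (symbol0 k b) => x _; rewrite big_nil.
have [Pi|nPi] := boolP (P i).
  by apply: symbol_ext (symbolD (Fs _ Pi) IH) => x _; rewrite big_cons Pi.
by apply: symbol_ext IH => x _; rewrite big_cons (negbTE nPi).
Qed.

Lemma symbol_prod k (I : Type) (r : seq I) (P : pred I) (b : I -> R)
    (F : I -> 'rV[R]_n -> R) :
  (forall i, P i -> sym k (b i) (F i)) ->
  sym k (\sum_(i <- r | P i) b i) (fun x => \prod_(i <- r | P i) F i x).
Proof.
move=> Fs; elim: r => [|i r IH].
  by rewrite big_nil; apply: symbol_ext (symbol_cst k 1) => x _; rewrite big_nil.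
rewrite big_cons; have [Pi|nPi] := boolP (P i).
  by apply: symbol_ext (symbolM (Fs _ Pi) IH) => x _; rewrite big_cons Pi.
by apply: symbol_ext IH => x _; rewrite big_cons (negbTE nPi).
Qed.

(** Since the derivative of [1 / u] is [- u' / u^2], a bound on [1 / u] itself suffices for all
    derivatives. *)
Lemma symbolV k b u : (forall x, D x -> u x != 0) ->
  bd (- b) (fun x => (u x)^-1) -> sym k b u -> sym k (- b) (fun x => (u x)^-1).
Proof.
move=> u0 vb; elim: k => [|k IH] us.
  split=> // x Dx.
  exact: continuousV (u0 x Dx) (symbol_continuous us Dx).
split=> [x Dx|]; first exact: continuousV (u0 x Dx) (symbol_continuous us Dx).
split=> // i; have [_ [_ /(_ i)[uid us']]] := us; split=> [x Dx|].
  exact: derivableV (u0 x Dx) (uid x Dx).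
have vs := IH (symbolS us).
apply: symbol_exponent (symbol_ext _ (symbolN (symbolM (symbolM vs vs) us'))).
  by ring.
move=> x Dx /=; rewrite [RHS](deriveV (u0 x Dx) (uid x Dx)).
by rewrite -mulNr -exprVn expr2.
Qed.

End Symbols.

Lemma sumr_sub_sub (R : comNzRingType) (I : finType) (a a0 b b0 : R)
    (A A0 B B0 : I -> R) :
  a - a0 - (b - b0) + \sum_i (A i - A0 i - (B i - B0 i)) =
  a - b + \sum_i (A i - B i) - (a0 - b0 + \sum_i (A0 i - B0 i)).
Proof. by rewrite !sumrB; ring. Qed.

Section SymbolCalculus.
Context {R : realType} {n : nat}.
Context {D : set 'rV[R]_n} {bd : R -> ('rV[R]_n -> R) -> Prop}.
Context {w : 'I_n -> R}.
Hypothesis gr : growth D bd.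
Local Notation sym := (symbol D bd w).
Local Notation syms b u := (forall k, symbol D bd w k b u).

Lemma symbol_prod0 k (I : Type) (r : seq I) (F : I -> 'rV[R]_n -> R) :
  (forall i, sym k 0 (F i)) -> sym k 0 (fun x => \prod_(i <- r) F i x).
Proof.
move=> Fs.
apply: symbol_exponent (symbol_prod gr (b := fun=> 0) r (fun i _ => Fs i)).
by rewrite big1.
Qed.

Lemma symbol_det k p (A : 'rV[R]_n -> 'M[R]_p) :
  (forall i j, sym k 0 (fun x => A x i j)) -> sym k 0 (fun x => \det (A x)).
Proof.
move=> As; apply: (symbol_sum gr) => s _.
by apply: (symbolZ gr); apply: symbol_prod0.
Qed.

(** By Cramer's rule the entries of the inverse are cofactors over the determinant, so the only
    analytic input is a bound on the inverse determinant. *)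
Lemma symbol_invmx k p (A : 'rV[R]_n -> 'M[R]_p) :
  (forall i j, sym k 0 (fun x => A x i j)) ->
  (forall x, D x -> \det (A x) != 0) -> bd 0 (fun x => (\det (A x))^-1) ->
  forall i j, sym k 0 (fun x => invmx (A x) i j).
Proof.
move=> As d0 db i j.
have dVs : sym k 0 (fun x => (\det (A x))^-1).
  rewrite -[0]oppr0; apply: (symbolV gr) => //; first by rewrite oppr0.
  exact: symbol_det.
have cs : sym k 0 (fun x => cofactor (A x) j i).
  apply: (symbolZ gr); apply: symbol_det => a b.
  by apply: (symbol_ext gr) (As (lift j a) (lift i b)) => x _; rewrite !mxE.
apply: (symbol_ext gr) (symbol_exponent _ (symbolM gr dVs cs)); last by rewrite addr0.
move=> x Dx; rewrite /invmx unitmxE unitfE d0 //.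
by rewrite !mxE.
Qed.

Definition tweight k (I : k.-tuple 'I_n) : R := \sum_(a < k) w (tnth I a).

Lemma tweight0 (I : 0.-tuple 'I_n) : tweight I = 0.
Proof. by rewrite /tweight big_ord0. Qed.

Lemma tweight_cons k (I : k.+1.-tuple 'I_n) :
  tweight I = w (thead I) + tweight (behead_tuple I).
Proof.
rewrite /tweight big_ord_recl; congr (_ + _); apply: eq_bigr => a _.
rewrite tnth_behead; congr (w (tnth _ _)); apply: val_inj.
by rewrite /= inordK // ltnS.
Qed.

Lemma tweight_set k (I : k.-tuple 'I_n) (a : 'I_k) l :
  tweight [tuple (if b == a then l else tnth I b) | b < k] =
  tweight I - w (tnth I a) + w l.
Proof.
rewrite /tweight (bigD1 a) //= tnth_mktuple eqxx (bigD1 a (P := xpredT)) //=.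
rewrite [w (tnth I a) + _]addrC addrK addrC; congr (_ + _).
by apply: eq_bigr => b ba; rewrite tnth_mktuple (negbTE ba).
Qed.

(** In the frame of the [r^(- w i) d_i], the metric and its inverse both have degree 0. *)
Definition metric_symbol (G : 'rV[R]_n -> 'M[R]_n) : Prop :=
  (forall i j, syms (w i + w j) (fun x => G x i j)) /\
  (forall i j, syms (- w i - w j) (fun x => invmx (G x) i j)).

Lemma christoffel_symbol G l i j : metric_symbol G ->
  syms (w i + w j - w l - 1) (christoffel G l i j).
Proof.
move=> [Gs Gi] k; apply: (symbolZ gr); apply: (symbol_sum gr) => a _.
have dG p q r : sym k (w p + w q + w r - 1) (partial r (fun y => G y p q)).
  exact: symbol_partial (Gs p q k.+1).
apply: symbol_exponent (symbolM gr (Gi l a k) (symbolB gr (symbolD gr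
  (dG j a i) (symbol_exponent _ (dG i a j))) (symbol_exponent _ (dG i j a)))); ring.
Qed.

Lemma nabla_symbol k b G p (t : tensor p) :
  (forall l i j, sym k (w i + w j - w l - 1) (christoffel G l i j)) ->
  (forall J, sym k.+1 (b + tweight J) (fun x => t x J)) ->
  forall I, sym k (b - 1 + tweight I) (fun x => nabla G t x I).
Proof.
move=> Gs ts I; rewrite tweight_cons; set J := behead_tuple I.
have s1 := symbol_partial (thead I) (ts J).
apply: (symbolB gr); first by apply: symbol_exponent s1; ring.
apply: (symbol_sum gr) => a _; apply: (symbol_sum gr) => l _.
apply: symbol_exponent (symbolM gr (Gs l (thead I) (tnth J a)) (symbolS (ts _))).
rewrite tweight_set; ring.
Qed.

Lemma nabla_iter_symbol b G p (t : tensor p) : metric_symbol G ->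
  (forall J, syms (b + tweight J) (fun x => t x J)) ->
  forall k I, syms (b - k%:R + tweight I) (fun x => nabla_iter G k t x I).
Proof.
move=> Gs ts; elim=> [|k IH] I N; first by rewrite subr0; apply: ts.
have Cs l i j := @christoffel_symbol G l i j Gs N.
apply: symbol_exponent (nabla_symbol (b := b - k%:R) Cs _ I) => [|J].
  by rewrite -natr1; ring.
exact: IH.
Qed.

Lemma riemann_symbol G l k i j : metric_symbol G ->
  syms (w k + w i + w j - w l - 2) (riemann G l k i j).
Proof.
move=> Gs N.
have Cs l' i' j' M := @christoffel_symbol G l' i' j' Gs M.
apply: (symbolD gr).
  by apply: (symbolB gr); apply: symbol_exponent (symbol_partial _ (Cs _ _ _ N.+1)); ring.
apply: (symbol_sum gr) => a _; apply: (symbolB gr);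
  by apply: symbol_exponent (symbolM gr (Cs _ _ _ N) (Cs _ _ _ N)); ring.
Qed.

Lemma ricci_symbol G j k : metric_symbol G ->
  syms (w j + w k - 2) (ricci G j k).
Proof.
move=> Gs N; apply: (symbol_sum gr) => l _.
by apply: symbol_exponent (riemann_symbol l k l j Gs N); ring.
Qed.

(** * Curvature of two metrics whose difference gains a factor [r^al] *)

Section Perturbation.
Variables (G G0 : 'rV[R]_n -> 'M[R]_n) (al : R).
Hypotheses (Gs : metric_symbol G) (G0s : metric_symbol G0).
Hypothesis hs : forall i j, syms (al + w i + w j) (fun x => G x i j - G0 x i j).
Hypothesis Gu : forall x, D x -> G x \in unitmx.
Hypothesis G0u : forall x, D x -> G0 x \in unitmx.

(** [u v - u0 v0 = (u - u0) v + u0 (v - v0)]: the gain [al] of each difference passes to the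
    product. *)
Lemma symbolMB k b c (u v u0 v0 : 'rV[R]_n -> R) :
  sym k b u0 -> sym k c v ->
  sym k (al + b) (fun x => u x - u0 x) -> sym k (al + c) (fun x => v x - v0 x) ->
  sym k (al + b + c) (fun x => u x * v x - u0 x * v0 x).
Proof.
move=> us vs du dv.
apply: (symbol_ext gr) (symbolD gr (symbolM gr du vs)
  (symbol_exponent _ (symbolM gr us dv))) => [x _|]; ring.
Qed.

(** [G^-1 - G0^-1 = - G^-1 (G - G0) G0^-1], and the weights of the contracted indices cancel. *)
Lemma invmx_perturbation i j :
  syms (al - w i - w j) (fun x => invmx (G x) i j - invmx (G0 x) i j).
Proof.
move=> k; have [[_ Gi] [_ G0i]] := (Gs, G0s).
have E x : D x -> invmx (G x) i j - invmx (G0 x) i j =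
    - \sum_a \sum_b invmx (G x) i a * (G x a b - G0 x a b) * invmx (G0 x) b j.
  move=> Dx.
  have -> : invmx (G x) i j - invmx (G0 x) i j =
      (- (invmx (G x) *m (G x - G0 x) *m invmx (G0 x))) i j.
    rewrite mulmxBr mulmxBl mulVmx ?Gu // mul1mx -mulmxA mulmxV ?G0u //.
    by rewrite mulmx1 opprB !mxE.
  rewrite mxE mxE; congr (- _).
  rewrite exchange_big; apply: eq_bigr => b _; rewrite mxE mulr_suml.
  by apply: eq_bigr => a _; rewrite !mxE.
apply: (symbol_ext gr) (fun x Dx => esym (E x Dx)) _; apply: (symbolN gr).
apply: (symbol_sum gr) => a _; apply: (symbol_sum gr) => b _.
apply: symbol_exponent (symbolM gr (symbolM gr (Gi i a k) (hs a b k)) (G0i b j k)).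
ring.
Qed.

Lemma christoffel_perturbation l i j :
  syms (al + w i + w j - w l - 1)
    (fun x => christoffel G l i j x - christoffel G0 l i j x).
Proof.
move=> k; have [[GS Gi] [G0S G0i]] := (Gs, G0s).
pose dd (H : 'rV[R]_n -> 'M[R]_n) a x := partial i (fun y => H y j a) x
  + partial j (fun y => H y i a) x - partial a (fun y => H y i j) x.
have dG p q r : sym k (w p + w q + w r - 1) (partial r (fun y => G y p q)).
  exact: symbol_partial (GS p q k.+1).
have ds a : sym k (w i + w j + w a - 1) (dd G a).
  by apply: (symbolB gr); [apply: (symbolD gr)|]; apply: symbol_exponent (dG _ _ _); ring.
have dh p q r : sym k (al + w p + w q + w r - 1)
    (fun x => partial r (fun y => G y p q) x - partial r (fun y => G0 y p q) x).
  apply: (symbol_ext gr) (symbol_partial r (hs p q k.+1)) => x Dx.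
  by apply: deriveB; [apply: symbol_derivable (GS p q 1%N) Dx|apply: symbol_derivable (G0S p q 1%N) Dx].
have dds a : sym k (al + (w i + w j + w a - 1)) (fun x => dd G a x - dd G0 a x).
  apply: (symbol_ext gr) (symbolB gr (symbolD gr (symbol_exponent _ (dh j a i))
    (symbol_exponent _ (dh i a j))) (symbol_exponent _ (dh i j a))) => [x _|||]; rewrite /dd; ring.
have T a : sym k (al + w i + w j - w l - 1)
    (fun x => invmx (G x) l a * dd G a x - invmx (G0 x) l a * dd G0 a x).
  apply: symbol_exponent (symbolMB (G0i l a k) (ds a) _ (dds a)).
    ring.
  by apply: symbol_exponent (invmx_perturbation l a k); ring.
apply: (symbol_ext gr) (symbolZ gr 2^-1 (symbol_sum gr (index_enum 'I_n) (fun a (_ : xpredT a) => T a))) => x _.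
by rewrite sumrB mulrBr.
Qed.

Lemma ricci_perturbation j k :
  syms (al + w j + w k - 2) (fun x => ricci G j k x - ricci G0 j k x).
Proof.
move=> N.
have Cs l' i' j' M := @christoffel_symbol G l' i' j' Gs M.
have C0s l' i' j' M := @christoffel_symbol G0 l' i' j' G0s M.
have dC p l i' j' : sym N (al + w p + w i' + w j' - w l - 2) (fun x =>
    partial p (christoffel G l i' j') x - partial p (christoffel G0 l i' j') x).
  apply: symbol_exponent (symbol_ext gr _ (symbol_partial p (christoffel_perturbation l i' j' N.+1))).
    ring.
  by move=> x Dx; apply: deriveB; [apply: symbol_derivable (Cs _ _ _ 1%N) Dx|apply: symbol_derivable (C0s _ _ _ 1%N) Dx].
have dCC l i' j' p q r : sym N (al + (w i' + w j' - w l - 1) + (w q + w r - w p - 1)) (fun x =>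
    christoffel G l i' j' x * christoffel G p q r x - christoffel G0 l i' j' x * christoffel G0 p q r x).
  by apply: symbolMB => //; apply: symbol_exponent (christoffel_perturbation _ _ _ N); ring.
have S l : sym N (al + w j + w k - 2) (fun x => riemann G l k l j x - riemann G0 l k l j x).
  have s1 : sym N (al + w j + w k - 2) (fun x =>
    partial l (christoffel G l j k) x - partial l (christoffel G0 l j k) x).
    by apply: symbol_exponent (dC l l j k); ring.
  have s2 : sym N (al + w j + w k - 2) (fun x =>
    partial j (christoffel G l l k) x - partial j (christoffel G0 l l k) x).
    by apply: symbol_exponent (dC j l l k); ring.
  have s3 a : sym N (al + w j + w k - 2) (fun x =>
    (christoffel G l l a x * christoffel G a j k x - christoffel G0 l l a x * christoffel G0 a j k x)
    - (christoffel G l j a x * christoffel G a l k x - christoffel G0 l j a x * christoffel G0 a l k x)).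
    apply: (symbolB gr); first by apply: symbol_exponent (dCC l l a a j k); ring.
    by apply: symbol_exponent (dCC l j a a l k); ring.
  apply: (symbol_ext gr) (symbolD gr (symbolB gr s1 s2)
    (symbol_sum gr (index_enum 'I_n) (fun a (_ : xpredT a) => s3 a))) => x _.
  exact: sumr_sub_sub.
apply: (symbol_ext gr) (symbol_sum gr (index_enum 'I_n) (fun l (_ : xpredT l) => S l)) => x _.
by rewrite sumrB.
Qed.

End Perturbation.

End SymbolCalculus.

(** * Norms of tensors *)

Section TensorAlgebra.
Context {R : realType}.

Definition tuple_ffun k (T : Type) (t : k.-tuple T) : {ffun 'I_k -> T} :=
  [ffun a => tnth t a].

Lemma tuple_ffun_bij k (T : Type) : bijective (@tuple_ffun k T).
Proof.
exists (fun f : {ffun 'I_k -> T} => [tuple f a | a < k]) => [t|f].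
  by apply: eq_from_tnth => a; rewrite tnth_mktuple ffunE.
by apply/ffunP => a; rewrite ffunE tnth_mktuple.
Qed.

Lemma prod_sum_tuple n k (F : 'I_k -> 'I_n -> R) :
  \prod_(a < k) \sum_(j < n) F a j =
  \sum_(t : k.-tuple 'I_n) \prod_(a < k) F a (tnth t a).
Proof.
rewrite bigA_distr_bigA /= (reindex (@tuple_ffun k _)) /=; last first.
  exact: onW_bij (tuple_ffun_bij _ _).
by apply: eq_bigr => t _; apply: eq_bigr => a _; rewrite ffunE.
Qed.

(** The [k]-th tensor power of [B^T], applied to [T]. For [B = J^T] with [J] a Jacobian, this is the
    pullback of covariant tensors. *)
Definition tmap n k (B : 'M[R]_n) (T : k.-tuple 'I_n -> R) (K : k.-tuple 'I_n)
  : R := \sum_(I : k.-tuple 'I_n) (\prod_(a < k) B (tnth I a) (tnth K a)) * T I.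

Lemma tmap_mul n k (B C : 'M[R]_n) (T : k.-tuple 'I_n -> R) K :
  tmap C (tmap B T) K = tmap (B *m C) T K.
Proof.
rewrite /tmap; under eq_bigr => L _ do rewrite mulr_sumr.
rewrite exchange_big; apply: eq_bigr => I _ /=.
under eq_bigr => L _ do rewrite mulrA.
rewrite -mulr_suml; congr (_ * _).
transitivity (\prod_(a < k) \sum_j B (tnth I a) j * C j (tnth K a)).
  rewrite prod_sum_tuple; apply: eq_bigr => L _.
  by rewrite -big_split; apply: eq_bigr => a _; rewrite mulrC.
by apply: eq_bigr => a _; rewrite mxE.
Qed.

Lemma tmap1 n k (T : k.-tuple 'I_n -> R) K : tmap 1%:M T K = T K.
Proof.
rewrite /tmap (bigD1 K) //= big1 ?mul1r => [|a _]; last by rewrite mxE eqxx.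
rewrite big1 ?addr0 // => I IK; apply/eqP; rewrite mulf_eq0; apply/orP; left.
apply: contraNT IK => P0; apply/eqP/eq_from_tnth => a; apply/eqP.
apply: contraNT P0 => IKa; apply/prodf_eq0; exists a => //.
by rewrite mxE (negbTE IKa).
Qed.

(** The quadratic form of the [k]-th tensor power of [P]; for [P] the inverse metric it is the
    squared norm of a tensor. *)
Definition tform n k (P : 'M[R]_n) (T : k.-tuple 'I_n -> R) : R :=
  \sum_(I : k.-tuple 'I_n) \sum_(J : k.-tuple 'I_n)
    (\prod_(a < k) P (tnth I a) (tnth J a)) * T I * T J.

Lemma tformE n k (P : 'M[R]_n) (T : k.-tuple 'I_n -> R) :
  tform P T = \sum_J tmap P T J * T J.
Proof.
by rewrite /tform exchange_big; apply: eq_bigr => J _; rewrite mulr_suml.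
Qed.

Lemma tmap_adjoint n k (B : 'M[R]_n) (S T : k.-tuple 'I_n -> R) :
  \sum_J tmap B^T S J * T J = \sum_K S K * tmap B T K.
Proof.
rewrite /tmap; under eq_bigr => J _ do rewrite mulr_suml.
rewrite exchange_big; apply: eq_bigr => K _; rewrite mulr_sumr.
apply: eq_bigr => J _; rewrite -mulrA [LHS]mulrCA; congr (_ * (_ * _)).
by apply: eq_bigr => a _; rewrite mxE.
Qed.

Lemma tform_congr n k (B P : 'M[R]_n) (T : k.-tuple 'I_n -> R) :
  tform (B *m P *m B^T) T = tform P (tmap B T).
Proof.
rewrite !tformE -tmap_adjoint.
transitivity (\sum_J tmap B^T (tmap P (tmap B T)) J * T J); last by [].
apply: eq_bigr => J _; congr (_ * _); rewrite -tmap_mul.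
by apply: eq_bigr => I _; rewrite -tmap_mul.
Qed.

Lemma tform1 n k (T : k.-tuple 'I_n -> R) : tform 1%:M T = \sum_K T K ^+ 2.
Proof. by rewrite tformE; apply: eq_bigr => K _; rewrite tmap1 expr2. Qed.

Lemma invmx_mul n (A B : 'M[R]_n) : A \in unitmx -> B \in unitmx ->
  invmx (A *m B) = invmx B *m invmx A.
Proof.
move=> Au Bu; have ABu : A *m B \in unitmx by rewrite unitmx_mul Au.
apply: (can_inj (mulKmx ABu)); rewrite mulmxV // mulmxA -(mulmxA A).
by rewrite mulmxV // mulmx1 mulmxV.
Qed.

Lemma tensor_normE n k (G : 'rV[R]_n -> 'M[R]_n) (t : tensor k) x :
  tensor_norm G t x = Num.sqrt (tform (invmx (G x)) (t x)).
Proof. by []. Qed.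

(** The inverse metric is the congruence of the inverse of [G'] by [(J^T)^-1]; moved onto the
    tensor, this factor undoes the pullback by [J^T]. *)
Lemma tensor_norm_pullback n k (G G' : 'rV[R]_n -> 'M[R]_n)
    (t t' : tensor k) (x x' : 'rV[R]_n) (J : 'M[R]_n) :
  J \in unitmx -> G' x' \in unitmx -> G x = J *m G' x' *m J^T ->
  (forall I, t x I = tmap J^T (t' x') I) ->
  tensor_norm G t x = tensor_norm G' t' x'.
Proof.
move=> Ju Gu GE tE; rewrite !tensor_normE; congr Num.sqrt.
have JTu : J^T \in unitmx by rewrite unitmx_tr.
have -> : invmx (G x) = invmx J^T *m invmx (G' x') *m (invmx J^T)^T.
  rewrite trmx_inv trmxK GE.
  have Xu : J *m G' x' \in unitmx by rewrite unitmx_mul Ju.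
  by rewrite !invmx_mul // mulmxA.
rewrite tform_congr; congr (tform _ _); apply/funext => K.
transitivity (tmap (invmx J^T) (tmap J^T (t' x')) K).
  by apply: eq_bigr => I _; rewrite tE.
by rewrite tmap_mul mulmxV // tmap1.
Qed.

Definition pos_def n (G : 'M[R]_n) : Prop :=
  forall v : 'rV[R]_n, v != 0 -> 0 < (v *m G *m v^T) ord0 ord0.

(** A nonzero row [v] with [v G = 0] would satisfy [v G v^T = 0]. *)
Lemma pos_def_unit n (G : 'M[R]_n) : pos_def G -> G \in unitmx.
Proof.
move=> Gp; rewrite -row_free_unit; apply/row_freeP.
have : kermx G == 0.
  apply/eqP/row_matrixP => i; rewrite row0; apply/eqP; apply: contraT => v0.
  have := Gp _ v0; rewrite -row_mul mulmx_ker row0 mul0mx mxE ltxx //.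
rewrite kermx_eq0 => /row_freeP //.
Qed.

(** Induction on the size: after splitting off the first coordinate, what remains is the Schur
    complement [S = C - a^-1 b^T b], which is again symmetric and positive definite. *)
Lemma cholesky n (G : 'M[R]_n) : G^T = G -> pos_def G ->
  exists W : 'M[R]_n, G = W^T *m W.
Proof.
elim: n G => [|n IH] G GT Gp; first by exists 0; apply/matrixP => -[].
pose G1 : 'M[R]_(1 + n) := G; rewrite -[G]/G1 in GT Gp *.
pose a := G1 ord0 ord0; pose b : 'M[R]_(1, n) := ursubmx G1.
pose C : 'M[R]_n := drsubmx G1.
have GE : G1 = block_mx a%:M b b^T C.
  rewrite -[LHS]submxK; congr block_mx => //.
    rewrite [LHS]mx11_scalar; congr (_%:M); rewrite !mxE; congr (G1 _ _); exact: val_inj.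
  by rewrite /b trmx_ursub GT.
have CT : C^T = C by rewrite /C trmx_drsub GT.
have Gp1 (u : 'M[R]_1) (v : 'rV[R]_n) : row_mx u v != 0 ->
    0 < (u *m (a *: u^T + b *m v^T) + v *m (b^T *m u^T + C *m v^T)) ord0 ord0.
  move=> /(Gp (row_mx u v : 'rV[R]_(1 + n))); rewrite GE.
  rewrite (@mul_row_block R 1 1 n 1 n) (@tr_row_mx _ 1 1 n) (@mul_row_col R 1 1 n).
  rewrite !mulmxDl !mulmxDr -scalemxAr mul_mx_scalar -scalemxAl !mulmxA.
  by rewrite addrACA.
have a0 : 0 < a.
  have : row_mx 1%:M 0 != 0 :> 'rV[R]_(1 + n).
    apply/eqP => /rowP /(_ (lshift n ord0)) /eqP.
    by rewrite row_mxEl !mxE eqxx oner_eq0.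
  move=> /Gp1; rewrite trmx1 trmx0 !mulmx0 mul0mx !addr0 mul1mx !mxE.
  by rewrite eqxx mulr1.
pose S := C - a^-1 *: (b^T *m b).
have [|v v0|W' WE] := IH S.
- by rewrite /S linearB /= linearZ /= trmx_mul trmxK CT.
(* This vector completes the square: its product with the first column of [G] vanishes, so the form
   of [G] at it is the form of [S] at [v]. *)
- have : row_mx (- a^-1 *: (v *m b^T)) v != 0 :> 'rV[R]_(1 + n).
    apply: contra_neq v0 => E; apply/rowP => i.
    by have := congr1 (fun A : 'rV_(1 + n) => A ord0 (rshift 1 i)) E; rewrite row_mxEr !mxE.
  move=> /Gp1; set X := (X in _ *m X + _); have -> : X = 0.
    rewrite /X linearZ /= trmx_mul trmxK scalerA mulrN mulfV ?gt_eqF //.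
    by rewrite scaleN1r addNr.
  rewrite mulmx0 add0r; set Y := (Y in (v *m Y) _ _); have -> : Y = S *m v^T.
    rewrite /Y /S mulmxBl linearZ /= trmx_mul trmxK -scalemxAr -scalemxAl.
    by rewrite scaleNr mulmxA addrC.
  by rewrite mulmxA.
have sa : Num.sqrt a != 0 by rewrite gt_eqF // sqrtr_gt0.
pose W1 : 'M[R]_(1 + n) :=
  block_mx (Num.sqrt a)%:M ((Num.sqrt a)^-1 *: b) 0 W'.
suff E : G1 = W1^T *m W1 by exists W1.
rewrite GE /W1 tr_block_mx mulmx_block.
rewrite tr_scalar_mx trmx0 !(mul0mx, mulmx0, addr0) -scalar_mxM -expr2.
rewrite sqr_sqrtr ?ltW // mul_scalar_mx scalerA mulfV // scale1r.
rewrite linearZ /= -scalemxAl mul_mx_scalar scalerA mulVf // scale1r.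
rewrite -scalemxAl -scalemxAr scalerA -WE /S.
have -> : (Num.sqrt a)^-1 * (Num.sqrt a)^-1 = a^-1.
  by rewrite -invfM -expr2 sqr_sqrtr // ltW.
by rewrite addrC subrK.
Qed.

(* If G = W^T W then tensor_norm G is the Euclidean norm in an orthonormal frame. *)
Lemma component_le_tensor_norm n k (G : 'rV[R]_n -> 'M[R]_n) (t : tensor k) x I :
  (G x)^T = G x -> pos_def (G x) ->
  `|t x I| <= #|{: k.-tuple 'I_n}|%:R *
    (\prod_(a < k) Num.sqrt (G x (tnth I a) (tnth I a))) * tensor_norm G t x.
Proof.
move=> GT Gp; have [W GE] := cholesky GT Gp.
have Gu := pos_def_unit Gp.
have Wu : W \in unitmx by move: Gu; rewrite GE unitmx_mul => /andP[].
pose U := tmap (invmx W) (t x).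
have tE : t x I = tmap W U I.
  by rewrite /U tmap_mul mulVmx // tmap1.
have nE : tensor_norm G t x = Num.sqrt (\sum_K U K ^+ 2).
  rewrite tensor_normE; congr Num.sqrt.
  have -> : invmx (G x) = invmx W *m 1%:M *m (invmx W)^T.
    apply: (can_inj (mulKmx Gu)); rewrite mulmxV // mulmx1 GE trmx_inv.
    by rewrite mulmxA mulmxK // mulmxV // unitmx_tr.
  by rewrite tform_congr tform1.
have UK K : `|U K| <= tensor_norm G t x.
  rewrite nE -sqrtr_sqr ler_wsqrtr // (bigD1 K) //= lerDl.
  by apply: sumr_ge0 => L _; rewrite sqr_ge0.
rewrite tE /tmap (le_trans (ler_norm_sum _ _ _)) //.
rewrite -mulrA mulr_natl -sumr_const; apply: ler_sum => K _.
rewrite normrM ler_pM // normr_prod; apply: ler_prod => a _.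
(* A diagonal entry of [G = W^T W] is the squared length of a column of [W], hence dominates the
   square of each entry of that column. *)
rewrite normr_ge0 /= -sqrtr_sqr ler_wsqrtr // GE mxE.
rewrite (bigD1 (tnth K a)) //= mxE -expr2 lerDl.
by apply: sumr_ge0 => j _; rewrite mxE -expr2 sqr_ge0.
Qed.

End TensorAlgebra.

(** * Smooth functions *)

Section SmoothCalculus.
Context {R : realType} {n : nat}.
Implicit Types (U : set 'rV[R]_n) (u v : 'rV[R]_n -> R).

Local Notation triv := (fun (_ : R) (_ : 'rV[R]_n -> R) => True).

Lemma Cinfty_symbolP U w b u :
  Cinfty U u <-> forall k, symbol U triv w k b u.
Proof. by split=> H k; [apply/Ck_symbolP|apply/(Ck_symbolP U w k b)]. Qed.

Lemma Cinfty_ext U u v : open U -> (forall x, U x -> u x = v x) ->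
  Cinfty U u -> Cinfty U v.
Proof.
move=> Uo uv /(Cinfty_symbolP _ (fun=> 0) 0) us.
apply/(Cinfty_symbolP _ (fun=> 0) 0) => k.
exact (symbol_ext (trivial_growth Uo) uv (us k)).
Qed.

Lemma Ck_sub k U V u : V `<=` U -> Ck k U u -> Ck k V u.
Proof.
elim: k u => [|k IH] u VU [uc ud].
  by split=> // x Vx; apply: uc; apply: VU.
split=> [x Vx|i]; first by apply: uc; apply: VU.
have [uid us] := ud i; split=> [x Vx|]; first by apply: uid; apply: VU.
exact: IH.
Qed.

Lemma Cinfty_sub U V u : V `<=` U -> Cinfty U u -> Cinfty V u.
Proof. by move=> VU us k; apply: Ck_sub VU (us k). Qed.

Lemma Cinfty_continuous U u x : Cinfty U u -> U x -> {for x, continuous u}.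
Proof. by move=> /(_ 0%N) [uc _]; apply: uc. Qed.

Lemma Cinfty_derivable U u x i : Cinfty U u -> U x -> derivable u x (delta_mx 0 i).
Proof. by move=> /(_ 1%N) [_ /(_ i)[ud _]]; apply: ud. Qed.

Lemma Cinfty_partial U u i : Cinfty U u -> Cinfty U (partial i u).
Proof. by move=> us k; have [_ /(_ i)[]] := us k.+1. Qed.

(** The neighbourhoods are chosen before the induction on [k], which replaces [u] by its partial
    derivatives: these inherit the same neighbourhoods. *)
Lemma Cinfty_local U u : open U ->
  (forall x, U x -> exists V h, [/\ open V, V x, Cinfty V h &
     forall y, V y -> U y -> h y = u y]) -> Cinfty U u.
Proof.
move=> Uo ul.
have /choice[V H] : forall x, exists V : set 'rV[R]_n,
    U x -> [/\ open V, V x, Cinfty V u & V `<=` U].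
  move=> x; have [Ux|] := pselect (U x); last by exists set0.
  have [V [h [Vo Vx Vh hu]]] := ul x Ux.
  have VUo : open (V `&` U) by apply: openI.
  exists (V `&` U) => _; split=> //.
  apply: (Cinfty_ext VUo _ (Cinfty_sub _ Vh)) => [y [Vy Uy]|y []//].
  exact: hu.
move=> k.
have {H} : forall x, U x -> [/\ open (V x), V x x, Ck k (V x) u & V x `<=` U].
  by move=> x /H[? ? /(_ k)].
elim: k u {ul} => [|k IH] u H.
  by split=> // x Ux; have [_ Vx [uc _] _] := H x Ux; apply: uc.
split=> [x Ux|i]; first by have [_ Vx [uc _] _] := H x Ux; apply: uc.
split=> [x Ux|].
  by have [_ Vx [_ /(_ i)[ud _]] _] := H x Ux; apply: ud.
by apply: IH => x Ux; have [Vo Vx [_ /(_ i)[_ ud]] VU] := H x Ux; split.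
Qed.

Lemma Cinfty_differentiable U u x : open U -> Cinfty U u -> U x ->
  differentiable u x.
Proof.
move=> Uo us Ux; apply: continuous_partials_differentiable => [|i].
  have : nbhs x U by apply: open_nbhs_nbhs.
  by apply: filterS => y Uy i; apply: Cinfty_derivable us Uy.
exact: Cinfty_continuous (Cinfty_partial i us) Ux.
Qed.

Lemma Cinfty_partialC U u x i j : open U -> Cinfty U u -> U x ->
  partial i (partial j u) x = partial j (partial i u) x.
Proof.
move=> Uo us Ux; have nU : nbhs x U by apply: open_nbhs_nbhs.
apply: partialC => [||k l].
- by apply: filterS nU => y Uy k; apply: Cinfty_derivable us Uy.
- by apply: filterS nU => y Uy k l; apply: Cinfty_derivable (Cinfty_partial k us) Uy.
- exact: Cinfty_continuous (Cinfty_partial k (Cinfty_partial l us)) Ux.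
Qed.

Lemma Cinfty_metric U (G : 'rV[R]_n -> 'M[R]_n) w : open U ->
  (forall i j, Cinfty U (fun x => G x i j)) ->
  (forall x, U x -> G x \in unitmx) ->
  metric_symbol (D := U) (bd := triv) (w := w) G.
Proof.
move=> Uo Gs Gu; split=> i j; apply/Cinfty_symbolP; first exact: Gs.
apply/(Cinfty_symbolP U w 0) => k.
apply: (symbol_invmx (trivial_growth Uo)) => // [a b|x Ux].
  by apply/Ck_symbolP; apply: Gs.
by rewrite -unitfE; have := Gu x Ux; rewrite unitmxE.
Qed.

Lemma Cinfty_nabla_iter U (G : 'rV[R]_n -> 'M[R]_n) p (t : tensor p) : open U ->
  (forall i j, Cinfty U (fun x => G x i j)) ->
  (forall x, U x -> G x \in unitmx) ->
  (forall J, Cinfty U (fun x => t x J)) ->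
  forall k I, Cinfty U (fun x => nabla_iter G k t x I).
Proof.
move=> Uo Gs Gu ts k I; apply/(Cinfty_symbolP U (fun=> 0)).
apply: (nabla_iter_symbol (trivial_growth Uo) (b := 0)); first exact: Cinfty_metric.
by move=> J; apply/Cinfty_symbolP.
Qed.

End SmoothCalculus.

(** * Invariance under changes of coordinates *)

Section BigTuple.
Context {R : realType} {n : nat}.

Lemma sum_tuple_cons k (F : k.+1.-tuple 'I_n -> R) :
  \sum_(I : k.+1.-tuple 'I_n) F I =
  \sum_(p < n) \sum_(K : k.-tuple 'I_n) F [tuple of p :: K].
Proof.
rewrite pair_bigA /=.
rewrite (reindex (fun pK : 'I_n * k.-tuple 'I_n => [tuple of pK.1 :: pK.2])) //=.
exists (fun I : k.+1.-tuple 'I_n => (thead I, [tuple of behead I])) => [[p K] _|I _] /=.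
  by rewrite theadE; congr (_, _); apply: val_inj.
by rewrite -tuple_eta.
Qed.

Definition tset k (J : k.-tuple 'I_n) (a : 'I_k) (l : 'I_n) : k.-tuple 'I_n :=
  [tuple (if b == a then l else tnth J b) | b < k].

Lemma tnth_tset k (J : k.-tuple 'I_n) a l b :
  tnth (tset J a l) b = if b == a then l else tnth J b.
Proof. by rewrite tnth_mktuple. Qed.

(** Exchanging [q] with the entry of [K] in slot [a] is an involution on pairs. It turns a
    Christoffel term of a pulled-back tensor into the pullback of a Christoffel term. *)
Lemma tset_swap k (a : 'I_k) (F : k.-tuple 'I_n -> 'I_n -> R) :
  \sum_(K : k.-tuple 'I_n) \sum_(q < n) F K q =
  \sum_(K : k.-tuple 'I_n) \sum_(q < n) F (tset K a q) (tnth K a).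
Proof.
rewrite !pair_bigA /=.
rewrite (reindex_inj (h := fun Kq : k.-tuple 'I_n * 'I_n =>
  (tset Kq.1 a Kq.2, tnth Kq.1 a))) //=.
apply: (@can_inj _ _ _ (fun Kq : k.-tuple 'I_n * 'I_n =>
  (tset Kq.1 a Kq.2, tnth Kq.1 a))) => -[K q] /=.
rewrite tnth_tset eqxx; congr (_, _); apply: eq_from_tnth => b.
by rewrite !tnth_tset; case: eqP => // ->.
Qed.

End BigTuple.

Section PartialRules.
Context {R : realType} {n : nat}.
Implicit Types (x : 'rV[R]_n) (i : 'I_n).

Lemma derivable_mulf i (u v : 'rV[R]_n -> R) x :
  derivable u x (delta_mx 0 i) -> derivable v x (delta_mx 0 i) ->
  derivable (fun y => u y * v y) x (delta_mx 0 i).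
Proof. by move=> du dv; exact: (derivableM du dv). Qed.

Lemma partialM i (u v : 'rV[R]_n -> R) x :
  derivable u x (delta_mx 0 i) -> derivable v x (delta_mx 0 i) ->
  partial i (fun y => u y * v y) x = u x * partial i v x + v x * partial i u x.
Proof. by move=> du dv; exact: (deriveM du dv). Qed.

Lemma partial_sum (I : Type) (r : seq I) i (F : I -> 'rV[R]_n -> R) x :
  (forall a, derivable (F a) x (delta_mx 0 i)) ->
  derivable (fun y => \sum_(a <- r) F a y) x (delta_mx 0 i) /\
  partial i (fun y => \sum_(a <- r) F a y) x = \sum_(a <- r) partial i (F a) x.
Proof.
move=> dF; elim: r => [|a r [IHd IHe]].
  have -> : (fun y => \sum_(a <- [::]) F a y) = cst 0.
    by apply/funext => y; rewrite big_nil.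
  by split; [exact: derivable_cst|rewrite big_nil /partial derive_cst].
have -> : (fun y => \sum_(b <- a :: r) F b y) =
    F a + (fun y => \sum_(b <- r) F b y).
  by apply/funext => y; rewrite big_cons.
split; first exact: (derivableD (dF a) IHd).
by rewrite big_cons -IHe; exact: (deriveD (dF a) IHd).
Qed.

Lemma partial_prod (I : eqType) (r : seq I) i (F : I -> 'rV[R]_n -> R) x :
  uniq r -> (forall a, derivable (F a) x (delta_mx 0 i)) ->
  derivable (fun y => \prod_(a <- r) F a y) x (delta_mx 0 i) /\
  partial i (fun y => \prod_(a <- r) F a y) x =
    \sum_(a <- r) partial i (F a) x * \prod_(b <- r | b != a) F b x.
Proof.
move=> + dF; elim: r => [_|a r IH /= /andP[ar /IH[IHd IHe]]].
  have -> : (fun y => \prod_(a <- [::]) F a y) = cst 1.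
    by apply/funext => y; rewrite big_nil.
  by split; [exact: derivable_cst|rewrite big_nil /partial derive_cst].
have -> : (fun y => \prod_(b <- a :: r) F b y) =
    (fun y => F a y * (fun y => \prod_(b <- r) F b y) y).
  by apply/funext => y; rewrite big_cons.
split; first exact: (derivableM (dF a) IHd).
rewrite (partialM (dF a) IHd) IHe big_cons big_cons eqxx /= addrC; congr (_ + _).
  rewrite mulrC; congr (_ * _); rewrite big_seq_cond [RHS]big_seq_cond.
  apply: eq_bigl => b; rewrite andbT; case br: (b \in r) => //=.
  by apply/esym; apply: contraNneq ar => <-.
rewrite mulr_sumr; apply: eq_big_seq => b br.
rewrite big_cons; have -> : a != b by apply: contraNneq ar => ->.
by rewrite mulrCA.
Qed.

End PartialRules.

(** * Transformation laws of the connection and of covariant derivatives *)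

Section CoordinateChange.
Context {R : realType} {n : nat}.
Variables (O O' : set 'rV[R]_n) (phi : 'rV[R]_n -> 'rV[R]_n).
Variables (G G' : 'rV[R]_n -> 'M[R]_n).
Hypotheses (Oo : open O) (Oo' : open O').
Hypothesis phis : forall j, Cinfty O (fun x => phi x ord0 j).
Hypothesis phiO : forall x, O x -> O' (phi x).
Hypothesis Gs' : forall i j, Cinfty O' (fun x => G' x i j).
Hypothesis Gu : forall x, O x -> G x \in unitmx.
Hypothesis Gsym' : forall x, O' x -> (G' x)^T = G' x.
Let J x := jacobian phi x.
Hypothesis GE : forall x, O x -> G x = J x *m G' (phi x) *m (J x)^T.

Let H i j p x := partial i (fun y => J y j p) x.

Let JE x j p : J x j p = partial j (fun y => phi y ord0 p) x.
Proof. by rewrite mxE. Qed.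

Let Js j p : Cinfty O (fun y => J y j p).
Proof.
apply: (Cinfty_ext Oo _ (Cinfty_partial j (phis p))) => x _.
by rewrite JE.
Qed.

Let Jd j p x i : O x -> derivable (fun y => J y j p) x (delta_mx 0 i).
Proof. by move=> Ox; apply: Cinfty_derivable (Js j p) Ox. Qed.

Let HC i j p x : O x -> H i j p x = H j i p x.
Proof.
move=> Ox; rewrite /H.
have E k : (fun y => J y k p) = partial k (fun y => phi y ord0 p).
  by apply/funext => y; rewrite JE.
by rewrite !E; apply: Cinfty_partialC Oo (phis p) Ox.
Qed.

Lemma partial_comp (u : 'rV[R]_n -> R) i x : Cinfty O' u -> O x ->
  derivable (fun y => u (phi y)) x (delta_mx 0 i) /\
  partial i (fun y => u (phi y)) x = \sum_p J x i p * partial p u (phi x).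
Proof.
move=> us Ox.
have [|d e] := @derive_comp_line R n n u phi x (delta_mx 0 i) _
   (Cinfty_differentiable Oo' us (phiO Ox)).
  by move=> j; apply: Cinfty_derivable (phis j) Ox.
split=> //; rewrite /partial [LHS]e; apply: eq_bigr => p _.
by rewrite JE.
Qed.

Let Ju x : O x -> J x \in unitmx.
Proof. by move=> Ox; move: (Gu Ox); rewrite GE // !unitmx_mul => /andP[/andP[]]. Qed.

Let Gu' x : O x -> G' (phi x) \in unitmx.
Proof. by move=> Ox; move: (Gu Ox); rewrite GE // !unitmx_mul => /andP[/andP[]]. Qed.

Let Gsy x p q : O x -> G' (phi x) p q = G' (phi x) q p.
Proof. by move=> Ox; rewrite -[in LHS](Gsym' (phiO Ox)) mxE. Qed.

(** When [J G' J^T] is differentiated, [A] collects a term with a second derivative of [phi], and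
    [C] the terms with a derivative of [G']. *)
Let A x i j a := \sum_p \sum_q H i j p x * J x a q * G' (phi x) p q.
Let C x i j a := \sum_p \sum_q \sum_r
  J x j p * J x a q * J x i r * partial r (fun y => G' y p q) (phi x).

Lemma partial_pullback_metric x i j a : O x ->
  partial i (fun y => G y j a) x = A x i j a + A x i a j + C x i j a.
Proof.
move=> Ox.
have E y : O y -> G y j a = \sum_p \sum_q J y j p * J y a q * G' (phi y) p q.
  move=> Oy; rewrite GE // mxE exchange_big; apply: eq_bigr => q _ /=.
  rewrite mxE mulr_suml; apply: eq_bigr => p _.
  by rewrite [(J y)^T _ _]mxE mulrAC.
rewrite (partial_on_ext i Oo E Ox).
have dG p q := partial_comp i (Gs' p q) Ox.
have dJJ p q : derivable (fun y => J y j p * J y a q) x (delta_mx 0 i).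
  exact (derivable_mulf (@Jd j p x i Ox) (@Jd a q x i Ox)).
have dt p q : derivable (fun y => J y j p * J y a q * G' (phi y) p q) x (delta_mx 0 i).
  exact (derivable_mulf (dJJ p q) (dG p q).1).
have dq p := partial_sum (index_enum 'I_n) (dt p).
rewrite (partial_sum (index_enum 'I_n) (fun p => (dq p).1)).2.
rewrite /A /C.
rewrite [X in _ + X + _](_ : _ = \sum_p \sum_q H i a q x * J x j p * G' (phi x) p q).
  rewrite -!big_split; apply: eq_bigr => p _ /=; rewrite (dq p).2.
  rewrite -!big_split; apply: eq_bigr => q _ /=.
  rewrite (partialM (dJJ p q) (dG p q).1) (dG p q).2.
  rewrite (partialM (@Jd j p x i Ox) (@Jd a q x i Ox)).
  rewrite mulr_sumr [X in X + _](_ : _ = \sum_p0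
    J x j p * J x a q * J x i p0 * partial p0 (fun y => G' y p q) (phi x)).
    by rewrite -/(H i j p x) -/(H i a q x); ring.
  by apply: eq_bigr => r _; rewrite mulrA.
rewrite exchange_big; apply: eq_bigr => p _; apply: eq_bigr => q _ /=.
by rewrite (Gsy q p Ox).
Qed.

(** Second derivatives of [phi] are symmetric, so of the six terms [A] in the Christoffel
    combination four cancel and two equal ones remain. They produce the inhomogeneous term [H]; the
    terms [C] give the Christoffel symbols of [G']. *)
Lemma christoffel_pullback x i j k : O x ->
  \sum_l christoffel G l i j x * J x l k =
  H i j k x + \sum_p \sum_q J x i p * J x j q * christoffel G' k p q (phi x).
Proof.
move=> Ox.
pose S' p q r := partial p (fun y => G' y q r) (phi x)
  + partial q (fun y => G' y p r) (phi x) - partial r (fun y => G' y p q) (phi x).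
pose S a := partial i (fun y => G y j a) x + partial j (fun y => G y i a) x
     - partial a (fun y => G y i j) x.
have SE a : S a = 2 * A x i j a +
    \sum_r J x a r * \sum_p \sum_q J x i p * J x j q * S' p q r.
  rewrite /S !partial_pullback_metric //.
  have A1 b c d : A x b c d = A x c b d.
    by apply: eq_bigr => p _; apply: eq_bigr => q _; rewrite HC.
  have C1 : C x i j a = \sum_r \sum_p \sum_q J x a r * (J x i p * J x j q *
      partial p (fun y => G' y q r) (phi x)).
    rewrite /C exchange_big; apply: eq_bigr => r _ /=.
    rewrite exchange_big; apply: eq_bigr => p _; apply: eq_bigr => q _; ring.
  have C2 : C x j i a = \sum_r \sum_p \sum_q J x a r * (J x i p * J x j q *
      partial q (fun y => G' y p r) (phi x)).
    rewrite /C exchange_big; apply: eq_bigr => r _ /=.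
    apply: eq_bigr => p _; apply: eq_bigr => q _; ring.
  have C3 : C x a i j = \sum_r \sum_p \sum_q J x a r * (J x i p * J x j q *
      partial r (fun y => G' y p q) (phi x)).
    rewrite /C [RHS]exchange_big; apply: eq_bigr => p _ /=.
    rewrite [RHS]exchange_big; apply: eq_bigr => q _ /=.
    apply: eq_bigr => r _; ring.
  rewrite (A1 i a j) (A1 j i a) (A1 j a i).
  have -> : \sum_r J x a r * \sum_p \sum_q J x i p * J x j q * S' p q r =
      C x i j a + C x j i a - C x a i j.
    rewrite C1 C2 C3 -!big_split -sumrB; apply: eq_bigr => r _ /=.
    rewrite mulr_sumr -!big_split -sumrB; apply: eq_bigr => p _ /=.
    rewrite mulr_sumr -!big_split -sumrB; apply: eq_bigr => q _ /=.
    by rewrite /S'; ring.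
  ring.
pose Sc : 'cV[R]_n := \col_a S a.
pose Hc : 'cV[R]_n := \col_p H i j p x.
pose Sc' : 'cV[R]_n := \col_r \sum_p \sum_q J x i p * J x j q * S' p q r.
have ScE : Sc = J x *m (2 *: (G' (phi x) *m Hc) + Sc').
  apply/colP => a; rewrite [LHS]mxE SE mulmxDr [RHS]mxE; congr (_ + _); last first.
    by rewrite [RHS]mxE; apply: eq_bigr => r _; congr (_ * _); rewrite mxE.
  rewrite -scalemxAr [RHS]mxE; congr (_ * _); rewrite /A exchange_big [RHS]mxE.
  apply: eq_bigr => q _ /=; rewrite [X in _ = _ * X]mxE mulr_sumr.
  apply: eq_bigr => p _; rewrite [Hc _ _]mxE (Gsy p q Ox); ring.
have L : (\sum_l christoffel G l i j x * J x l k) =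
    (2^-1 *: ((J x)^T *m (invmx (G x) *m Sc))) k ord0.
  rewrite [RHS]mxE [X in _ = _ * X]mxE mulr_sumr; apply: eq_bigr => l _.
  have -> : christoffel G l i j x = 2^-1 * (invmx (G x) *m Sc) l ord0.
    by congr (_ * _); rewrite mxE; apply: eq_bigr => a _; rewrite [Sc _ _]mxE.
  by rewrite [(J x)^T _ _]mxE -mulrA [X in _ * X]mulrC.
(* This contracts the free index: raising it with [G] and pushing forward by [J] amounts to raising
   it with [G']. *)
have GV : (J x)^T *m invmx (G x) *m J x = invmx (G' (phi x)).
  rewrite (GE Ox) !invmx_mul ?unitmx_mul ?unitmx_tr ?Ju ?Gu' //.
  rewrite !mulmxA mulmxV ?unitmx_tr ?Ju // mul1mx mulmxKV //; exact: Ju.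
rewrite L ScE !mulmxA GV mulmxDr -scalemxAr mulmxA mulVmx ?Gu' // mul1mx.
rewrite scalerDr scalerA mulVf ?pnatr_eq0 // scale1r [LHS]mxE; congr (_ + _).
  by rewrite mxE.
rewrite [LHS]mxE [X in _ * X]mxE mulr_sumr.
under eq_bigr => r _ do rewrite [Sc' _ _]mxE mulr_sumr mulr_sumr.
rewrite exchange_big; apply: eq_bigr => p _ /=.
under eq_bigr => r _ do rewrite mulr_sumr mulr_sumr.
rewrite exchange_big; apply: eq_bigr => q _ /=.
rewrite /christoffel !mulr_sumr; apply: eq_bigr => r _.
by rewrite /S'; ring.
Qed.

Let P k (I K : k.-tuple 'I_n) (a : 'I_k) x :=
  \prod_(b < k | b != a) J x (tnth I b) (tnth K b).

Let prodP k (I K : k.-tuple 'I_n) (a : 'I_k) x :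
  \prod_(b < k) J x (tnth I b) (tnth K b) =
  J x (tnth I a) (tnth K a) * P I K a x.
Proof. by rewrite (bigD1 a). Qed.

Let pull k (t' : tensor k) x I : tmap (J x)^T (t' (phi x)) I =
  \sum_K (\prod_(a < k) J x (tnth I a) (tnth K a)) * t' (phi x) K.
Proof.
apply: eq_bigr => K _; congr (_ * _); apply: eq_bigr => a _.
by rewrite [LHS]mxE.
Qed.

Let pull_tset k (t' : tensor k) x I a l :
  tmap (J x)^T (t' (phi x)) (tset I a l) =
  \sum_K J x l (tnth K a) * P I K a x * t' (phi x) K.
Proof.
rewrite pull; apply: eq_bigr => K _; congr (_ * _).
rewrite (prodP _ _ a) tnth_tset eqxx; congr (_ * _).
by apply: eq_bigr => b ba; rewrite tnth_tset (negbTE ba).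
Qed.

Let partial_pull k (t' : tensor k) i x I :
  (forall K, Cinfty O' (fun x => t' x K)) -> O x ->
  partial i (fun y => tmap (J y)^T (t' (phi y)) I) x =
  \sum_K (\prod_(a < k) J x (tnth I a) (tnth K a)) *
    (\sum_p J x i p * partial p (fun y => t' y K) (phi x)) +
  \sum_(a < k) \sum_K H i (tnth I a) (tnth K a) x * P I K a x * t' (phi x) K.
Proof.
move=> ts Ox.
have -> : (fun y => tmap (J y)^T (t' (phi y)) I) = (fun y =>
   \sum_K (\prod_(a < k) J y (tnth I a) (tnth K a)) * t' (phi y) K).
  by apply/funext => y; rewrite pull.
have dp K := partial_prod (i := i) (index_enum_uniq 'I_k)
  (fun a => @Jd (tnth I a) (tnth K a) x i Ox).
have dt K := partial_comp i (ts K) Ox.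
have dpt K := derivable_mulf (dp K).1 (dt K).1.
rewrite (partial_sum (index_enum _) dpt).2.
rewrite [X in _ + X]exchange_big -big_split; apply: eq_bigr => K _ /=.
rewrite (partialM (dp K).1 (dt K).1) (dp K).2 (dt K).2; congr (_ + _).
rewrite mulr_sumr; apply: eq_bigr => a _; exact: mulrC.
Qed.

(** Differentiating the factors [J] of the pullback gives one term [H] per slot, which is exactly
    the inhomogeneous term of the Christoffel symbols in that slot. *)
Lemma nabla_pullback k (t t' : tensor k) :
  (forall K, Cinfty O' (fun x => t' x K)) ->
  (forall x, O x -> forall I, t x I = tmap (J x)^T (t' (phi x)) I) ->
  forall x, O x -> forall I,
    nabla G t x I = tmap (J x)^T (nabla G' t' (phi x)) I.
Proof.
move=> ts tE x Ox I1; rewrite pull sum_tuple_cons.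
set i := thead I1; set I : k.-tuple 'I_n := behead_tuple I1.
have I1E a : tnth I1 (lift ord0 a) = tnth I a.
  rewrite tnth_behead; congr (tnth _ _); apply: val_inj.
  by rewrite /= inordK // ltnS.
have -> : nabla G t x I1 = partial i (fun y => t y I) x -
  \sum_(a < k) \sum_l christoffel G l i (tnth I a) x * t x (tset I a l) by [].
rewrite (partial_on_ext i Oo (fun y Oy => tE y Oy I) Ox) partial_pull //.
have -> : \sum_(a < k) \sum_l christoffel G l i (tnth I a) x * t x (tset I a l) =
  \sum_(a < k) \sum_K H i (tnth I a) (tnth K a) x * P I K a x * t' (phi x) K +
  \sum_(a < k) \sum_K (\sum_p \sum_q J x i p * J x (tnth I a) q *
     christoffel G' (tnth K a) p q (phi x)) * P I K a x * t' (phi x) K.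
  rewrite -big_split; apply: eq_bigr => a _ /=; rewrite -big_split /=.
  under eq_bigr => l _ do rewrite tE // pull_tset mulr_sumr.
  rewrite exchange_big; apply: eq_bigr => K _ /=.
  rewrite -mulrDl -mulrDl -christoffel_pullback // mulr_suml mulr_suml.
  by apply: eq_bigr => l _; rewrite !mulrA.
(* The second derivatives of [phi] cancel here; the remaining terms are tensorial. *)
rewrite addrKA.
under [RHS]eq_bigr => p _.
  under eq_bigr => K _.
    rewrite big_ord_recl tnth0.
    have -> : nabla G' t' (phi x) [tuple of p :: K] =
        partial p (fun y => t' y K) (phi x) - \sum_(a < k) \sum_l
          christoffel G' l p (tnth K a) (phi x) * t' (phi x) (tset K a l).
      rewrite /nabla theadE; have -> // : behead_tuple [tuple of p :: K] = K.
      exact: val_inj.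
    have -> : \prod_(j < k) J x (tnth I1 (lift ord0 j))
        (tnth [tuple of p :: K] (lift ord0 j)) =
        \prod_(j < k) J x (tnth I j) (tnth K j).
      by apply: eq_bigr => a _; rewrite I1E tnthS.
    rewrite mulrBr; over.
  rewrite sumrB; over.
rewrite sumrB; congr (_ - _).
  rewrite exchange_big; apply: eq_bigr => K _ /=.
  rewrite mulr_sumr; apply: eq_bigr => p _; rewrite -[tnth I1 _]/i; ring.
transitivity (\sum_(a < k) \sum_p \sum_K \sum_q
  J x i p * (J x (tnth I a) q * P I K a x * christoffel G' (tnth K a) p q (phi x)
   * t' (phi x) K)).
  apply: eq_bigr => a _; rewrite exchange_big; apply: eq_bigr => K _ /=.
  rewrite mulr_suml mulr_suml; apply: eq_bigr => p _.
  rewrite mulr_suml mulr_suml; apply: eq_bigr => q _; ring.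
transitivity (\sum_(a < k) \sum_p \sum_K \sum_l
  J x i p * (J x (tnth I a) (tnth K a) * P I K a x *
    christoffel G' l p (tnth K a) (phi x) * t' (phi x) (tset K a l))).
  apply: eq_bigr => a _; apply: eq_bigr => p _.
  (* The summation index of the connection and the index in slot [a] of [K] exchange roles. *)
  rewrite (tset_swap a); apply: eq_bigr => K _; apply: eq_bigr => l _.
  rewrite tnth_tset eqxx; congr (_ * (_ * _ * _ * _)).
  by apply: eq_bigr => b ba; rewrite tnth_tset (negbTE ba).
rewrite exchange_big; apply: eq_bigr => p _ /=.
rewrite exchange_big; apply: eq_bigr => K _ /=.
rewrite mulr_sumr; apply: eq_bigr => a _.
rewrite mulr_sumr; apply: eq_bigr => l _.
by rewrite (prodP _ _ a) -[tnth I1 _]/i; ring.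
Qed.

Hypothesis Gu'all : forall x, O' x -> G' x \in unitmx.

Lemma nabla_iter_pullback p (t t' : tensor p) :
  (forall K, Cinfty O' (fun x => t' x K)) ->
  (forall x, O x -> forall I, t x I = tmap (J x)^T (t' (phi x)) I) ->
  forall k x, O x -> forall I,
    nabla_iter G k t x I = tmap (J x)^T (nabla_iter G' k t' (phi x)) I.
Proof.
move=> ts tE; elim=> [|k IH] x Ox I; first exact: tE.
apply: nabla_pullback Ox I => //.
exact: Cinfty_nabla_iter.
Qed.

Lemma tensor_norm_nabla_iter_pullback (f f' : 'rV[R]_n -> R) k x :
  Cinfty O' f' -> (forall y, O y -> f y = f' (phi y)) -> O x ->
  tensor_norm G (nabla_iter G k (tensor0 f)) x =
  tensor_norm G' (nabla_iter G' k (tensor0 f')) (phi x).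
Proof.
move=> fs fE Ox.
apply: tensor_norm_pullback (Ju Ox) (Gu' Ox) (GE Ox) _.
apply: nabla_iter_pullback Ox => // y Oy I.
rewrite pull (big_pred1 I) => [|K]; last by apply/esym/eqP; rewrite (tuple0 K) (tuple0 I).
by rewrite big_ord0 mul1r /tensor0 fE.
Qed.

End CoordinateChange.

(** * Ricci curvature of cones *)

Section ConeModel.
Context {R : realType} {m : nat}.
Implicit Types (x : 'rV[R]_m.+1) (i j k l : 'I_m).

Definition radius x : R := x ord0 ord0.

Definition link_coord x : 'rV[R]_m := rsubmx (x : 'rV[R]_(1 + m)).

Definition cone_weight (a : 'I_m.+1) : R := (a != ord0)%:R.

Local Notation sh := (lift ord0).

Lemma cone_weight0 : cone_weight ord0 = 0.
Proof. by rewrite /cone_weight eqxx. Qed.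

Lemma cone_weight_sh i : cone_weight (sh i) = 1.
Proof. by rewrite /cone_weight eq_sym neq_lift. Qed.

Lemma rshift1E i : sh i = rshift 1 i :> 'I_(1 + m).
Proof. exact: val_inj. Qed.

Lemma lshift1E : ord0 = lshift m (ord0 : 'I_1) :> 'I_(1 + m).
Proof. exact: val_inj. Qed.

(** Blocks are indexed by [1 + m], coordinates by [m.+1]; this gives the entries in terms of [ord0]
    and [lift ord0], the radial and the link indices. *)
Lemma block1E (A : 'M[R]_1) (S : 'M[R]_m) :
  let B : 'M[R]_m.+1 := block_mx A 0 0 S in
  [/\ B ord0 ord0 = A ord0 ord0, forall i, B ord0 (sh i) = 0,
      forall i, B (sh i) ord0 = 0 & forall i j, B (sh i) (sh j) = S i j].
Proof.
split=> [|i|i|i j].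
- by have := block_mxEul A 0 0 S ord0 ord0; rewrite -lshift1E.
- by have := block_mxEur A 0 0 S ord0 i; rewrite -lshift1E -rshift1E [RHS]mxE.
- by have := block_mxEdl A 0 0 S i ord0; rewrite -lshift1E -rshift1E [RHS]mxE.
- by have := block_mxEdr A 0 0 S i j; rewrite -!rshift1E.
Qed.

Lemma link_coordE x i : link_coord x ord0 i = x ord0 (sh i).
Proof. by rewrite mxE -rshift1E. Qed.

Lemma radius_line x i (h : R) : radius (h *: delta_mx 0 (sh i) + x) = radius x.
Proof. by rewrite /radius !mxE eqxx /= mulr0 add0r. Qed.

Lemma radius_line0 x (h : R) : radius (h *: delta_mx 0 ord0 + x) = h + radius x.
Proof. by rewrite /radius !mxE eqxx mulr1. Qed.

Lemma link_coord_line x i (h : R) :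
  link_coord (h *: delta_mx 0 (sh i) + x) = h *: delta_mx 0 i + link_coord x.
Proof.
apply/rowP => j; rewrite link_coordE !mxE -rshift1E eqxx /=.
by rewrite (inj_eq (@lift_inj _ ord0)).
Qed.

Lemma link_coord_line0 x (h : R) :
  link_coord (h *: delta_mx 0 ord0 + x) = link_coord x.
Proof. by apply/rowP => j; rewrite !link_coordE !mxE eqxx /= mulr0 add0r. Qed.

Lemma constant_on_line n (f : 'rV[R]_n -> R) (x v : 'rV[R]_n) :
  (forall h : R, f (h *: v + x) = f x) -> derivable f x v /\ 'D_v f x = 0.
Proof.
move=> fE.
have E : (fun h : R => h^-1 *: ((f \o shift x) (h *: v) - f x)) = cst 0.
  by apply/funext => h /=; rewrite fE subrr scaler0.
split; first by rewrite /derivable E; apply: is_cvg_cst.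
by rewrite /derive E; apply: lim_cst.
Qed.

Lemma partial_link (u : 'rV[R]_m -> R) i x :
  partial (sh i) (fun x => u (link_coord x)) x = partial i u (link_coord x).
Proof.
rewrite /partial /derive.
set f := (fun h : R => _); set g := (fun h : R => h^-1 *: _).
suff -> : f = g by [].
by apply/funext => h; rewrite /f /g /= link_coord_line.
Qed.

Lemma derivable_link (u : 'rV[R]_m -> R) i x :
  derivable u (link_coord x) (delta_mx 0 i) ->
  derivable (fun x => u (link_coord x)) x (delta_mx 0 (sh i)).
Proof.
rewrite /derivable.
set f := (fun h : R => _); set g := (fun h : R => h^-1 *: _).
suff -> : f = g by [].
by apply/funext => h; rewrite /f /g /= link_coord_line.
Qed.

Lemma derivable_link0 (u : 'rV[R]_m -> R) x :
  derivable (fun x => u (link_coord x)) x (delta_mx 0 ord0) /\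
  partial ord0 (fun x => u (link_coord x)) x = 0.
Proof. by apply: constant_on_line => h; rewrite link_coord_line0. Qed.

Lemma derivable_radius_fun (v : R -> R) i x :
  derivable (fun x => v (radius x)) x (delta_mx 0 (sh i)) /\
  partial (sh i) (fun x => v (radius x)) x = 0.
Proof. by apply: constant_on_line => h; rewrite radius_line. Qed.

Lemma derivable_radius0 (v : R -> R) x : derivable v (radius x) 1 ->
  derivable (fun x => v (radius x)) x (delta_mx 0 ord0) /\
  partial ord0 (fun x => v (radius x)) x = 'D_1 v (radius x).
Proof.
have E : (fun h : R => h^-1 *: (((fun x => v (radius x)) \o shift x)
    (h *: delta_mx 0 ord0) - v (radius x))) =
    (fun h : R => h^-1 *: ((v \o shift (radius x)) h%:A - v (radius x))).
  by apply/funext => h /=; rewrite radius_line0 [h%:A]mulr1.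
by move=> vd; split; [rewrite /derivable E|rewrite /partial /derive E].
Qed.

Lemma derivable_radius x : derivable radius x (delta_mx 0 ord0) /\
  partial ord0 radius x = 1.
Proof.
have [|d e] := @derivable_radius0 id x; first exact: derivable_id.
by split=> //; rewrite e derive_id.
Qed.

Lemma continuous_radius : continuous radius.
Proof. by move=> x; apply: coord_continuous. Qed.

Lemma continuous_link_coord : continuous link_coord.
Proof.
move=> x; apply/(@cvgrPdist_lt _ _ _ (nbhs x)) => e e0.
apply/nbhs_ballP; exists e => // y; rewrite -ball_normE /=; apply: le_lt_trans.
apply: norm_le_coord => // i; rewrite !mxE -!rshift1E.
by have := coord_le_norm (x - y) (sh i); rewrite !mxE.
Qed.

Section Metric.
Variable gh : 'rV[R]_m -> 'M[R]_m.
Local Notation g0 := (cone_metric gh).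

Lemma cone_metric00 x : g0 x ord0 ord0 = 1.
Proof. by rewrite (let: And4 E _ _ _ := block1E _ _ in E) mxE eqxx. Qed.

Lemma cone_metric0s x i : g0 x ord0 (sh i) = 0.
Proof. exact: (let: And4 _ E _ _ := block1E _ _ in E). Qed.

Lemma cone_metrics0 x i : g0 x (sh i) ord0 = 0.
Proof. exact: (let: And4 _ _ E _ := block1E _ _ in E). Qed.

Lemma cone_metricss x i j :
  g0 x (sh i) (sh j) = radius x ^+ 2 * gh (link_coord x) i j.
Proof. by rewrite (let: And4 _ _ _ E := block1E _ _ in E) mxE. Qed.

Definition cone_metricE := (cone_metric00, cone_metric0s, cone_metrics0, cone_metricss).

Definition cone_inverse x : 'M[R]_m.+1 :=
  block_mx (1%:M : 'M[R]_1) 0 0 ((radius x ^+ 2)^-1 *: invmx (gh (link_coord x))).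

Lemma cone_metric_inverse x : radius x != 0 -> gh (link_coord x) \in unitmx ->
  g0 x *m cone_inverse x = 1%:M.
Proof.
move=> r0 ghu; rewrite /cone_metric /cone_inverse.
rewrite (@mulmx_block _ 1 m 1 m 1 m) !(mul0mx, mulmx0, addr0, add0r) mul1mx.
rewrite -scalemxAl -scalemxAr scalerA mulmxV // mulfV ?expf_neq0 // scale1r.
by rewrite -(@scalar_mx_block _ 1 m).
Qed.

Lemma cone_metric_unit x : radius x != 0 -> gh (link_coord x) \in unitmx ->
  g0 x \in unitmx /\ invmx (g0 x) = cone_inverse x.
Proof.
move=> r0 ghu; have E := cone_metric_inverse r0 ghu.
have gu : g0 x \in unitmx by have [] := mulmx1_unit E.
by split=> //; rewrite -[LHS]mulmx1 -E mulKmx.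
Qed.

Section InvEntries.
Variable x : 'rV[R]_m.+1.
Hypotheses (r0 : radius x != 0) (ghu : gh (link_coord x) \in unitmx).
Local Notation P := (invmx (g0 x)).

Let PE : P = cone_inverse x. Proof. by have [] := cone_metric_unit r0 ghu. Qed.

Lemma cone_inv00 : P ord0 ord0 = 1.
Proof. by rewrite PE (let: And4 E _ _ _ := block1E _ _ in E) mxE eqxx. Qed.

Lemma cone_inv0s i : P ord0 (sh i) = 0.
Proof. by rewrite PE; exact: (let: And4 _ E _ _ := block1E _ _ in E). Qed.

Lemma cone_invs0 i : P (sh i) ord0 = 0.
Proof. by rewrite PE; exact: (let: And4 _ _ E _ := block1E _ _ in E). Qed.

Lemma cone_invss i j : P (sh i) (sh j) =
  (radius x ^+ 2)^-1 * invmx (gh (link_coord x)) i j.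
Proof. by rewrite PE (let: And4 _ _ _ E := block1E _ _ in E) mxE. Qed.

End InvEntries.

Lemma partial_cone_metric_cst (a b c : 'I_m.+1) x : b = ord0 \/ c = ord0 ->
  partial a (fun y => g0 y b c) x = 0.
Proof.
move=> bc.
have [C E] : exists C, forall y, g0 y b c = C.
  case: bc => ->; [case: (unliftP ord0 c) => [c'|] ->|case: (unliftP ord0 b) => [b'|] ->].
  - by exists 0 => y; rewrite cone_metricE.
  - by exists 1 => y; rewrite cone_metricE.
  - by exists 0 => y; rewrite cone_metricE.
  - by exists 1 => y; rewrite cone_metricE.
have -> : (fun y => g0 y b c) = cst C by apply/funext => y; rewrite E.
by rewrite /partial derive_cst.
Qed.

Let cone_ssE i j : (fun y => g0 y (sh i) (sh j)) =
  (fun y => radius y ^+ 2 * gh (link_coord y) i j).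
Proof. by apply/funext => y; rewrite cone_metricE. Qed.

Lemma partial0_cone_metric i j x :
  partial ord0 (fun y => g0 y (sh i) (sh j)) x =
  2 * radius x * gh (link_coord x) i j.
Proof.
have [dr er] := derivable_radius x.
have [dg eg] := derivable_link0 (fun y => gh y i j) x.
have d2 := derivable_mulf dr dr.
rewrite cone_ssE [LHS](partialM d2 dg) eg mulr0 add0r.
rewrite (partialM dr dr) er mulr1; ring.
Qed.

Lemma partials_cone_metric i j k x :
  derivable (fun y => gh y i j) (link_coord x) (delta_mx 0 k) ->
  partial (sh k) (fun y => g0 y (sh i) (sh j)) x =
  radius x ^+ 2 * partial k (fun y => gh y i j) (link_coord x).
Proof.
move=> dg; have [dr er] := derivable_radius_fun (fun r => r ^+ 2) k x.
rewrite cone_ssE [LHS](partialM dr (derivable_link dg)) er mulr0 addr0.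
by rewrite (partial_link (fun y => gh y i j)).
Qed.

Section Christoffel.
Variable x : 'rV[R]_m.+1.
Hypotheses (r0 : radius x != 0) (ghu : gh (link_coord x) \in unitmx).
Hypothesis ghT : (gh (link_coord x))^T = gh (link_coord x).
Hypothesis ghd : forall i j k,
  derivable (fun y => gh y i j) (link_coord x) (delta_mx 0 k).
Local Notation Ch := (christoffel g0).

Let pc := partial_cone_metric_cst.

Lemma christoffel_cone0 (b c : 'I_m.+1) : b = ord0 \/ c = ord0 ->
  Ch ord0 b c x = 0.
Proof.
move=> bc; rewrite /christoffel big_ord_recl cone_inv00 //.
rewrite (pc ord0 _ bc) !(pc _ _ (or_intror erefl)) subr0 addr0 mulr0 add0r.
by rewrite big1 ?mulr0 // => i _; rewrite cone_inv0s // mul0r.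
Qed.

Lemma christoffel_cone0ss i j :
  Ch ord0 (sh i) (sh j) x = - (radius x * gh (link_coord x) i j).
Proof.
rewrite /christoffel big_ord_recl cone_inv00 //.
rewrite !(pc _ _ (or_intror erefl)) partial0_cone_metric add0r sub0r.
rewrite big1 => [|k _]; last by rewrite cone_inv0s // mul0r.
by rewrite addr0; field.
Qed.

Lemma christoffel_cones00 k : Ch (sh k) ord0 ord0 x = 0.
Proof.
rewrite /christoffel big1 ?mulr0 // => a _.
by rewrite !(pc _ _ (or_introl erefl)) addr0 subr0 mulr0.
Qed.

Lemma christoffel_cones0s k j : Ch (sh k) ord0 (sh j) x = (k == j)%:R / radius x.
Proof.
rewrite /christoffel big_ord_recl cone_invs0 // mul0r add0r.
transitivity ((radius x)^-1 * (invmx (gh (link_coord x)) *m gh (link_coord x)) k j).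
  rewrite mxE !mulr_sumr; apply: eq_bigr => a _.
  rewrite cone_invss // !(pc _ _ (or_introl erefl)) partial0_cone_metric.
  have -> : gh (link_coord x) j a = gh (link_coord x) a j.
    by rewrite -[in LHS]ghT mxE.
  by field.
by rewrite mulVmx // mxE mulrC.
Qed.

Lemma christoffel_coness0 k j : Ch (sh k) (sh j) ord0 x = (k == j)%:R / radius x.
Proof.
rewrite -christoffel_cones0s /christoffel; congr (_ * _); apply: eq_bigr => c _.
by rewrite [X in X - _]addrC !(pc c _ (or_introl erefl)) !(pc c _ (or_intror erefl)).
Qed.

Lemma christoffel_conesss k i j :
  Ch (sh k) (sh i) (sh j) x = christoffel gh k i j (link_coord x).
Proof.
rewrite /christoffel big_ord_recl cone_invs0 // mul0r add0r; congr (_ * _).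
apply: eq_bigr => a _; rewrite cone_invss // !partials_cone_metric //.
by field.
Qed.

End Christoffel.

Lemma warped_sum (p s r g1 g2 d : R) : r != 0 ->
  p + (1 / r * - (r * g1) - d / r * - (r * g2) + s) = p + s - g1 + d * g2.
Proof. by move=> r0; field. Qed.

Section Ricci.
Variable U : set 'rV[R]_m.
Hypothesis Uo : open U.
Hypothesis ghs : forall i j, Cinfty U (fun y => gh y i j).
Hypothesis ghu : forall y, U y -> gh y \in unitmx.
Hypothesis ghT : forall y, U y -> (gh y)^T = gh y.

Definition cone_over : set 'rV[R]_m.+1 :=
  [set x | 0 < radius x] `&` link_coord @^-1` U.
Local Notation E := cone_over.

Lemma cone_over_open : open E.
Proof.
apply: openI.
  have -> : [set x : 'rV[R]_m.+1 | 0 < radius x] = radius @^-1` [set r | 0 < r] by [].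
  by apply: open_comp => [x _|]; [exact: continuous_radius|exact: open_gt].
by apply: open_comp => // x _; exact: continuous_link_coord.
Qed.
Let Eo := cone_over_open.

Let r0 x : E x -> radius x != 0. Proof. by move=> [/gt_eqF r _]; rewrite r. Qed.
Let gu x : E x -> gh (link_coord x) \in unitmx. Proof. by move=> [_ /ghu]. Qed.
Let gT x : E x -> (gh (link_coord x))^T = gh (link_coord x).
Proof. by move=> [_ /ghT]. Qed.
Let gd x : E x -> forall i j k,
  derivable (fun y => gh y i j) (link_coord x) (delta_mx 0 k).
Proof. by move=> [_ Ux] i j k; apply: Cinfty_derivable (ghs i j) Ux. Qed.

Local Notation Ch := (christoffel g0).
Local Notation Chh := (christoffel gh).

Let C000 x : E x -> Ch ord0 ord0 ord0 x = 0.
Proof. by move=> Ex; apply: christoffel_cone0 (r0 Ex) (gu Ex) _ _ _; left. Qed.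
Let C00s j x : E x -> Ch ord0 ord0 (sh j) x = 0.
Proof. by move=> Ex; apply: christoffel_cone0 (r0 Ex) (gu Ex) _ _ _; left. Qed.
Let C0s0 j x : E x -> Ch ord0 (sh j) ord0 x = 0.
Proof. by move=> Ex; apply: christoffel_cone0 (r0 Ex) (gu Ex) _ _ _; right. Qed.
Let C0ss i j x : E x -> Ch ord0 (sh i) (sh j) x = - (radius x * gh (link_coord x) i j).
Proof. by move=> Ex; apply: christoffel_cone0ss (r0 Ex) (gu Ex) _ _. Qed.
Let Cs00 k x : E x -> Ch (sh k) ord0 ord0 x = 0.
Proof. by move=> Ex; apply: christoffel_cones00. Qed.
Let Cs0s k j x : E x -> Ch (sh k) ord0 (sh j) x = (k == j)%:R / radius x.
Proof. by move=> Ex; apply: christoffel_cones0s (r0 Ex) (gu Ex) (gT Ex) _ _. Qed.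
Let Css0 k j x : E x -> Ch (sh k) (sh j) ord0 x = (k == j)%:R / radius x.
Proof. by move=> Ex; apply: christoffel_coness0 (r0 Ex) (gu Ex) (gT Ex) _ _. Qed.
Let Csss k i j x : E x -> Ch (sh k) (sh i) (sh j) x = Chh k i j (link_coord x).
Proof. by move=> Ex; apply: christoffel_conesss (r0 Ex) (gu Ex) (gd Ex) _ _ _. Qed.

Let dC0 a b c x : E x -> (forall y, E y -> Ch a b c y = 0) ->
  forall d, partial d (Ch a b c) x = 0.
Proof.
move=> Ex H d; rewrite (partial_on_ext d Eo H Ex).
by rewrite /partial derive_cst.
Qed.

Let d0Cs0s k j x : E x -> partial ord0 (Ch (sh k) ord0 (sh j)) x =
  - (k == j)%:R / radius x ^+ 2.
Proof.
move=> Ex; rewrite (partial_on_ext _ Eo (Cs0s k j) Ex).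
have [dr er] := derivable_radius x.
have dV := @derivableV _ _ radius x (delta_mx 0 ord0) (r0 Ex) dr.
have dc := derivable_cst ((k == j)%:R : R) x (delta_mx 0 ord0).
rewrite [LHS](partialM dc dV) [partial ord0 (cst _) x]derive_cst mulr0 addr0.
have -> : partial ord0 (fun y => (radius y)^-1) x = - (radius x) ^- 2 * 1.
  by rewrite -er; exact: (deriveV (r0 Ex) dr).
by rewrite mulr1 mulrN mulNr.
Qed.

Let dsCs0s k j i x : E x -> partial (sh i) (Ch (sh k) ord0 (sh j)) x = 0.
Proof.
move=> Ex; rewrite (partial_on_ext _ Eo (Cs0s k j) Ex).
by have [_ ->] := derivable_radius_fun (fun r => (k == j)%:R / r) i x.
Qed.

Let dsCss0 k j i x : E x -> partial (sh i) (Ch (sh k) (sh j) ord0) x = 0.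
Proof.
move=> Ex; rewrite (partial_on_ext _ Eo (Css0 k j) Ex).
by have [_ ->] := derivable_radius_fun (fun r => (k == j)%:R / r) i x.
Qed.

Let d0Css0 k j x : E x -> partial ord0 (Ch (sh k) (sh j) ord0) x =
  - (k == j)%:R / radius x ^+ 2.
Proof.
have S y : E y -> Ch (sh k) (sh j) ord0 y = Ch (sh k) ord0 (sh j) y.
  by move=> Ey; rewrite Cs0s // Css0.
by move=> Ex; rewrite (partial_on_ext _ Eo S Ex); exact: d0Cs0s.
Qed.

Let d0Csss k i j x : E x -> partial ord0 (Ch (sh k) (sh i) (sh j)) x = 0.
Proof.
move=> Ex; rewrite (partial_on_ext _ Eo (Csss k i j) Ex).
by have [_ ->] := derivable_link0 (Chh k i j) x.
Qed.

Let dsCsss k i j l x : E x -> partial (sh l) (Ch (sh k) (sh i) (sh j)) x =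
  partial l (Chh k i j) (link_coord x).
Proof.
by move=> Ex; rewrite (partial_on_ext _ Eo (Csss k i j) Ex) partial_link.
Qed.

Let d0C0ss i j x : E x -> partial ord0 (Ch ord0 (sh i) (sh j)) x =
  - gh (link_coord x) i j.
Proof.
move=> Ex; rewrite (partial_on_ext _ Eo (C0ss i j) Ex).
have [dr er] := derivable_radius x.
have [dg eg] := derivable_link0 (fun y => gh y i j) x.
have dm := derivable_mulf dr dg.
rewrite [LHS](deriveN dm); congr (- _).
by rewrite [LHS](partialM dr dg) er eg mulr0 add0r mulr1.
Qed.

Let sumd i (F : 'I_m -> R) : \sum_j (i == j)%:R * F j = F i.
Proof.
rewrite (bigD1 i) //= eqxx mul1r big1 ?addr0 // => j /negbTE.
by rewrite eq_sym => ->; rewrite mul0r.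
Qed.

Let sumdd (i : 'I_m) (F : 'I_m -> R) : \sum_j (j == i)%:R * F j = F i.
Proof. by rewrite -[RHS]sumd; apply: eq_bigr => j _; rewrite eq_sym. Qed.

(** In each plane spanned by the radial and a link direction, the derivative of [1 / r] contributes
    [r^-2] and the product of Christoffel symbols [- r^-2]. *)
Lemma ricci_cone00 x : E x -> ricci g0 ord0 ord0 x = 0.
Proof.
move=> Ex; rewrite /ricci big_ord_recl /riemann.
rewrite [X in X + _](_ : _ = 0) ?add0r; last first.
  rewrite subrr big1 ?addr0 // => a _; by rewrite subrr.
rewrite big1 // => l _; rewrite (dC0 Ex) => [|y]; last exact: Cs00.
rewrite d0Css0 // eqxx sub0r mulNr opprK big_ord_recl.
rewrite C000 // Cs00 // mulr0 mul0r subrr add0r.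
rewrite (eq_bigr (fun a => (l == a)%:R * - ((a == l)%:R / radius x / radius x)))
  => [|a _]; last by rewrite Cs00 // mulr0 sub0r Cs0s // Css0 //; ring.
rewrite sumd eqxx; have rx := r0 Ex; by field.
Qed.

(** The two products of Christoffel symbols that survive are both [1 / r] times the same Christoffel
    symbol of the link. *)
Lemma ricci_cone0s k x : E x -> ricci g0 ord0 (sh k) x = 0.
Proof.
move=> Ex; rewrite /ricci big_ord_recl /riemann.
rewrite [X in X + _](_ : _ = 0) ?add0r; last first.
  rewrite subrr big1 ?addr0 // => a _; by rewrite subrr.
rewrite big1 // => l _; rewrite dsCs0s // d0Csss // subrr add0r big_ord_recl.
rewrite C00s // C0ss // Css0 // Cs00 // mulr0 mul0r subrr add0r.
rewrite sumrB.
rewrite (eq_bigr (fun a => (a == k)%:R * (Chh l l a (link_coord x) / radius x)))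
  => [|a _]; last by rewrite Csss // Cs0s //; ring.
rewrite [X in _ - X](eq_bigr (fun a => (l == a)%:R * (Chh a l k (link_coord x) / radius x)))
  => [|a _]; last by rewrite Csss // Cs0s //; ring.
by rewrite sumd sumdd subrr.
Qed.

Let christoffelC0 l k x : E x ->
  Chh l l k (link_coord x) = Chh l k l (link_coord x).
Proof.
move=> Ex; rewrite -!Csss // /christoffel; congr (_ * _); apply: eq_bigr => c _.
congr (_ * (_ - _)); first by rewrite addrC.
apply: (partial_on_ext _ Eo) Ex => y [_ Uy].
by rewrite !cone_metricE -[in LHS](ghT Uy) mxE.
Qed.

Lemma ricci_cones0 k x : E x -> ricci g0 (sh k) ord0 x = 0.
Proof.
move=> Ex; rewrite /ricci big_ord_recl /riemann.
rewrite [X in X + _](_ : _ = 0) ?add0r; last first.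
  rewrite (dC0 Ex) => [|y]; last exact: C0s0.
  rewrite (dC0 Ex) => [|y]; last exact: C000.
  rewrite subrr add0r big_ord_recl C000 // C0s0 // mulr0 subrr add0r.
  by rewrite big1 // => a _; rewrite C00s // Cs00 // mul0r mulr0 subrr.
rewrite big1 // => l _.
rewrite !dsCss0 // subrr add0r big_ord_recl.
rewrite C0s0 // C0s0 // !mulr0 subrr add0r.
rewrite sumrB.
rewrite (eq_bigr (fun a => (a == k)%:R * (Chh l l a (link_coord x) / radius x)))
  => [|a _]; last by rewrite Csss // Css0 //; ring.
rewrite [X in _ - X](eq_bigr (fun a => (a == l)%:R * (Chh l k a (link_coord x) / radius x)))
  => [|a _]; last by rewrite Csss // Css0 //; ring.
by rewrite !sumdd christoffelC0 // subrr.
Qed.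

(** The radial direction contributes nothing. Through the products of Christoffel symbols with a
    radial index, each of the [m] link directions contributes [- gh i j], and the direction [l = i]
    gives one copy back. *)
Lemma ricci_coness i j x : E x -> ricci g0 (sh i) (sh j) x =
  ricci gh i j (link_coord x) - (m%:R - 1) * gh (link_coord x) i j.
Proof.
move=> Ex; rewrite /ricci big_ord_recl.
have -> : riemann g0 ord0 (sh j) ord0 (sh i) x = 0.
  rewrite /riemann d0C0ss // (dC0 Ex) => [|y]; last exact: C00s.
  rewrite subr0 big_ord_recl C000 // C0s0 // !mul0r subrr add0r.
  rewrite (eq_bigr (fun a => (a == j)%:R * gh (link_coord x) i a)) => [|a _];
    last by rewrite C00s // mul0r sub0r C0ss // Cs0s //; have rx := r0 Ex; by field.
  by rewrite sumdd addNr.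
rewrite add0r.
have H l : riemann g0 (sh l) (sh j) (sh l) (sh i) x =
   riemann gh l j l i (link_coord x) - gh (link_coord x) i j
   + (l == i)%:R * gh (link_coord x) l j.
  rewrite /riemann !dsCsss // big_ord_recl Css0 // C0ss // Css0 // C0ss // eqxx.
  rewrite (eq_bigr (fun a => Chh l l a (link_coord x) * Chh a i j (link_coord x)
    - Chh l i a (link_coord x) * Chh a l j (link_coord x))) => [|a _];
    last by rewrite !Csss.
  exact: warped_sum (r0 Ex).
rewrite (eq_bigr _ (fun l _ => H l)) big_split /= sumdd sumrB sumr_const card_ord.
by rewrite -mulr_natl; ring.
Qed.

End Ricci.

End Metric.

End ConeModel.

(** * Asymptotics on a patch of the link *)

Section Bounded.
Context {R : realType}.

Lemma compact_pointwise_bounded (T : topologicalType) (B : set T) (u : T -> R) :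
  compact B -> (forall x, B x -> {for x, continuous u}) ->
  exists M : R, forall x, B x -> `|u x| <= M.
Proof.
move=> Bc uc.
have : {within B, continuous u} by apply: continuous_in_subspaceT => x /set_mem; exact: uc.
move=> /(continuous_compact)/(_ Bc)/compact_bounded[M [_ HM]].
exists (M + 1) => x Bx; apply: HM; first by rewrite ltrDl.
by exists x.
Qed.

Lemma small_powR (b C e : R) : 0 < b -> 0 <= C -> 0 < e ->
  exists2 eta : R, 0 < eta & forall r, 0 < r < eta -> C * r `^ b <= e.
Proof.
move=> b0 C0 e0; have C1 : 0 < C + 1 by rewrite ltr_wpDl.
(* Since [C] may be 0, the radius is obtained by solving [(C + 1) r^b = e]. *)
pose y := e / (C + 1); have y0 : 0 < y by rewrite divr_gt0.
exists (y `^ b^-1); first exact: powR_gt0.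
move=> r /andP[r0 ry].
have rb : r `^ b <= y.
  have -> : y = (y `^ b^-1) `^ b by rewrite -powRrM mulVf ?gt_eqF // powRr1 // ltW.
  by apply: ge0_ler_powR; rewrite ?nnegrE ?powR_ge0 // ltW.
apply: le_trans (_ : (C + 1) * y <= e); last first.
  by rewrite /y mulrCA mulfV ?gt_eqF // mulr1.
by apply: ler_pM => //; rewrite ?powR_ge0 // lerDl.
Qed.

End Bounded.

Section Patch.
Context {R : realType} {m : nat}.
Variables (U V B : set 'rV[R]_m).
Hypotheses (Uo : open U) (Vo : open V) (Bc : compact B).
Hypotheses (VB : V `<=` B) (BU : B `<=` U).
Implicit Types (x : 'rV[R]_m.+1) (i j k l : 'I_m).
Local Notation sh := (lift ord0).
Local Notation w := (@cone_weight R m).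

Definition truncated_cone : set 'rV[R]_m.+1 :=
  [set x | radius x < 1] `&` cone_over V.
Local Notation D := truncated_cone.

Lemma truncated_cone_open : open D.
Proof.
apply: openI; last exact: cone_over_open.
have -> : [set x : 'rV[R]_m.+1 | radius x < 1] = radius @^-1` [set r | r < 1] by [].
by apply: open_comp => [x _|]; [exact: continuous_radius|exact: open_lt].
Qed.

Lemma truncated_cone_link x : D x -> U (link_coord x).
Proof. by move=> [_ [_ /VB/BU]]. Qed.

Lemma truncated_cone_radius x : D x -> 0 < radius x.
Proof. by move=> [_ []]. Qed.

(** The constants are uniform in the link coordinate over [V], and nothing is claimed for radii
    between [eta] and 1. *)
Definition tip_bound (b : R) (u : 'rV[R]_m.+1 -> R) : Prop :=
  exists C eta : R, [/\ 0 <= C, 0 < eta &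
    forall x, D x -> radius x < eta -> `|u x| <= C * radius x `^ b].
Local Notation bd := tip_bound.

Lemma tip_growth : growth D bd.
Proof.
split.
- exact: truncated_cone_open.
- move=> b u v uv [C [eta [C0 e0 H]]]; exists C, eta; split=> // x Dx xe.
  by rewrite -uv //; apply: H.
- by move=> b; exists 0, 1; split=> // x Dx _; rewrite normr0 mul0r.
- by move=> c; exists `|c|, 1; split=> // x Dx _; rewrite powRr0 mulr1.
- move=> b u v [C [eta [C0 e0 H]]] [C' [eta' [C0' e0' H']]].
  exists (C + C'), (Num.min eta eta'); split; first exact: addr_ge0.
    by rewrite lt_min e0.
  move=> x Dx; rewrite lt_min => /andP[xe xe']; rewrite (le_trans (ler_normD _ _)) //.
  by rewrite mulrDl lerD // ?H ?H'.
- move=> b c u v [C [eta [C0 e0 H]]] [C' [eta' [C0' e0' H']]].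
  exists (C * C'), (Num.min eta eta'); split; first exact: mulr_ge0.
    by rewrite lt_min e0.
  move=> x Dx; rewrite lt_min => /andP[xe xe'].
  have x0 := truncated_cone_radius Dx.
  rewrite normrM powRD ?(gt_eqF x0) ?implybT // mulrACA.
  by apply: ler_pM => //; [exact: H|exact: H'].
Qed.
Let gr := tip_growth.

Lemma tip_bound_weaken b c u : c <= b -> bd b u -> bd c u.
Proof.
move=> cb [C [eta [C0 e0 H]]]; exists C, eta; split=> // x Dx xe.
have x0 := truncated_cone_radius Dx; have [x1 _] := Dx.
apply: le_trans (H x Dx xe) _; apply: ler_wpM2l => //.
by apply: ger_powR => //; rewrite x0 ltW.
Qed.

Local Notation sym := (symbol D bd w).
Local Notation syms b u := (forall N, symbol D bd w N b u).

(** The compact set [B] between [V] and [U] bounds [u] and each of its derivatives on [V]. A link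
    derivative keeps degree 0 because its weight 1 offsets the loss of one degree; the radial
    derivative is 0. *)
Lemma link_symbol (u : 'rV[R]_m -> R) : Cinfty U u ->
  syms 0 (fun x => u (link_coord x)).
Proof.
move=> us N; elim: N u us => [|N IH] u us.
  split=> [x Dx|].
    apply: continuous_comp; first exact: continuous_link_coord.
    exact: Cinfty_continuous us (truncated_cone_link Dx).
  split=> //; have [|M HM] := compact_pointwise_bounded (u := u) Bc.
    by move=> x /BU; apply: Cinfty_continuous.
  exists (Num.max M 0), 1; split=> // [|x [_ [_ /VB Bx]] _].
    by rewrite le_max lexx orbT.
  by rewrite powRr0 mulr1 le_max HM.
split.
  by move=> x Dx; apply: (symbol_continuous (IH u us)) Dx.
split; first exact: symbol_bd (IH u us).
move=> a; case: (unliftP ord0 a) => [i|] ->.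
  split=> [x Dx|].
    by apply: derivable_link; apply: Cinfty_derivable us (truncated_cone_link Dx).
  apply: symbol_exponent (symbol_ext gr _ (IH _ (Cinfty_partial i us))).
    by rewrite cone_weight_sh; ring.
  by move=> x _; rewrite partial_link.
split=> [x Dx|]; first by case: (derivable_link0 u x).
by apply: (symbol_ext gr) (symbol0 gr N _) => x _; case: (derivable_link0 u x).
Qed.

Lemma radius_symbol : syms 1 radius.
Proof.
have rb : bd 1 radius.
  exists 1, 1; split=> // x Dx _; have x0 := truncated_cone_radius Dx.
  by rewrite mul1r (powRr1 (ltW x0)) gtr0_norm.
case=> [|N]; (split=> [x _|]; first exact: continuous_radius); split=> // a.
case: (unliftP ord0 a) => [i|] ->.
  split=> [x Dx|]; first by case: (derivable_radius_fun id i x).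
  by apply: (symbol_ext gr) (symbol0 gr N _) => x _; case: (derivable_radius_fun id i x).
split=> [x Dx|]; first by case: (derivable_radius x).
apply: symbol_exponent (symbol_ext gr _ (symbol_cst gr N 1)).
  by rewrite cone_weight0; ring.
by move=> x _; case: (derivable_radius x).
Qed.

Lemma inv_radius_symbol : syms (-1) (fun x => (radius x)^-1).
Proof.
move=> N; apply: (symbolV gr) (radius_symbol N) => [x Dx|].
  by rewrite gt_eqF // truncated_cone_radius.
exists 1, 1; split=> // x Dx _; have x0 := truncated_cone_radius Dx.
by rewrite mul1r powRN (powRr1 (ltW x0)) gtr0_norm // invr_gt0.
Qed.

Section Metric.
Variables (gh : 'rV[R]_m -> 'M[R]_m).
Hypothesis ghs : forall i j, Cinfty U (fun y => gh y i j).
Hypothesis ghu : forall y, U y -> gh y \in unitmx.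
Hypothesis ghT : forall y, U y -> (gh y)^T = gh y.
Local Notation g0 := (cone_metric gh).

Lemma link_inverse_Cinfty i j : Cinfty U (fun y => invmx (gh y) i j).
Proof.
have [_ H] := @Cinfty_metric _ _ U gh (fun=> 0) Uo ghs ghu.
exact: (iffRL (Cinfty_symbolP _ _ _ _) (H i j)).
Qed.

Lemma cone_metric_unit_on x : D x -> g0 x \in unitmx.
Proof.
move=> Dx; have [] := @cone_metric_unit _ _ gh x => //.
  by rewrite gt_eqF // truncated_cone_radius.
exact: ghu (truncated_cone_link Dx).
Qed.

Lemma cone_metric_symbol : metric_symbol (D := D) (bd := bd) (w := w) g0.
Proof.
have dr N := symbolM gr (radius_symbol N) (radius_symbol N).
have di N := symbolM gr (inv_radius_symbol N) (inv_radius_symbol N).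
split=> a b N; case: (unliftP ord0 a) => [i|] ->; case: (unliftP ord0 b) => [j|] ->;
  rewrite ?cone_weight_sh ?cone_weight0.
- apply: symbol_exponent (symbol_ext gr _ (symbolM gr (dr N) (link_symbol (ghs i j) N))).
    ring.
  by move=> x _; rewrite cone_metricE expr2.
- by apply: (symbol_ext gr) (symbol0 gr N _) => x _; rewrite cone_metricE.
- by apply: (symbol_ext gr) (symbol0 gr N _) => x _; rewrite cone_metricE.
- apply: symbol_exponent (symbol_ext gr _ (symbol_cst gr N 1)); first ring.
  by move=> x _; rewrite cone_metricE.
- apply: symbol_exponent (symbol_ext gr _ (symbolM gr (di N) (link_symbol (link_inverse_Cinfty i j) N))).
    ring.
  move=> x Dx; rewrite cone_invss ?expr2 ?invfM //.
    by rewrite gt_eqF // truncated_cone_radius.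
  exact: ghu (truncated_cone_link Dx).
- apply: (symbol_ext gr) (symbol0 gr N _) => x Dx; rewrite cone_invs0 //.
    by rewrite gt_eqF // truncated_cone_radius.
  exact: ghu (truncated_cone_link Dx).
- apply: (symbol_ext gr) (symbol0 gr N _) => x Dx; rewrite cone_inv0s //.
    by rewrite gt_eqF // truncated_cone_radius.
  exact: ghu (truncated_cone_link Dx).
- apply: symbol_exponent (symbol_ext gr _ (symbol_cst gr N 1)); first ring.
  move=> x Dx; rewrite cone_inv00 //.
    by rewrite gt_eqF // truncated_cone_radius.
  exact: ghu (truncated_cone_link Dx).
Qed.

Hypothesis ghp : forall y, U y -> pos_def (gh y).

Lemma cone_metric_pos_def x : D x -> pos_def (g0 x).
Proof.
move=> Dx v v0.
have x0 := truncated_cone_radius Dx.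
rewrite mxE big_ord_recl.
have vg0 : (v *m g0 x) ord0 ord0 = v ord0 ord0.
  rewrite mxE big_ord_recl cone_metricE mulr1 big1 ?addr0 // => i _.
  by rewrite cone_metricE mulr0.
have vgs i : (v *m g0 x) ord0 (sh i) =
    radius x ^+ 2 * (link_coord v *m gh (link_coord x)) ord0 i.
  rewrite mxE big_ord_recl cone_metricE mulr0 add0r mxE mulr_sumr.
  by apply: eq_bigr => j _; rewrite cone_metricE link_coordE; ring.
rewrite vg0 mxE -expr2.
have -> : \sum_(i < m) (v *m g0 x) ord0 (sh i) * v^T (sh i) ord0 =
   radius x ^+ 2 * (link_coord v *m gh (link_coord x) *m (link_coord v)^T) ord0 ord0.
  rewrite [in RHS]mxE mulr_sumr; apply: eq_bigr => i _.
  by rewrite vgs [v^T _ _]mxE [X in _ = _ * (_ * X)]mxE link_coordE mulrA.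
have [lv|lv] := eqVneq (link_coord v) 0.
  rewrite lv !mul0mx mxE mulr0 addr0 exprn_even_gt0 //=.
  apply: contra_neq v0 => v00; apply/rowP => a; rewrite mxE.
  by case: (unliftP ord0 a) => [i|] -> //; rewrite -link_coordE lv mxE.
rewrite ltr_wpDl ?sqr_ge0 // mulr_gt0 ?exprn_gt0 //.
exact: ghp (truncated_cone_link Dx) _ lv.
Qed.

Lemma tip_bound_le b u v : (forall x, D x -> `|u x| <= `|v x|) -> bd b v -> bd b u.
Proof.
move=> uv [C [eta [C0 e0 H]]]; exists C, eta; split=> // x Dx xe.
exact: le_trans (uv x Dx) (H x Dx xe).
Qed.

Lemma tip_bound_sqrt b u : bd (b + b) u -> bd b (fun x => Num.sqrt (u x)).
Proof.
move=> [C [eta [C0 e0 H]]]; exists (Num.sqrt C), eta; split=> // x Dx xe.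
have x0 := truncated_cone_radius Dx.
have -> : radius x `^ b = Num.sqrt (radius x `^ (b + b)).
  rewrite powRD ?(gt_eqF x0) ?implybT // -expr2 sqrtr_sqr ger0_norm //.
  exact: powR_ge0.
rewrite ger0_norm ?sqrtr_ge0 // -sqrtrM // ler_wsqrtr //.
exact: le_trans (ler_norm _) (H x Dx xe).
Qed.

Lemma tip_bound_prod (I : Type) (r : seq I) (b : I -> R)
    (F : I -> 'rV[R]_m.+1 -> R) : (forall c : I, bd (b c) (F c)) ->
  bd (\sum_(c <- r) b c) (fun x => \prod_(c <- r) F c x).
Proof.
move=> H; elim: r => [|c r IH].
  rewrite big_nil; apply: (growth_ext gr) (growth_cst gr 1) => x _.
  by rewrite big_nil.
rewrite big_cons; apply: (growth_ext gr) (growthM gr (H c) IH) => x _.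
by rewrite big_cons.
Qed.

Lemma symbol_Ck (k : nat) b u : sym k b u -> Ck k D u.
Proof.
elim: k b u => [|k IH] b u; first by move=> [uc _].
move=> [uc [_ ud]]; split=> // i; have [uid us] := ud i; split=> //.
exact: IH us.
Qed.

Lemma syms_Cinfty b u : syms b u -> Cinfty D u.
Proof. by move=> us k; apply: symbol_Ck (us k). Qed.

(** * From decay of covariant derivatives to decay of the components of the metric *)

Section Perturbation.
Variables (G : 'rV[R]_m.+1 -> 'M[R]_m.+1) (al : R).
Hypothesis Gs : forall a b, Cinfty D (fun x => G x a b).
Let h x := G x - g0 x.
Hypothesis hb : forall k : nat, bd al (fun x =>
  radius x ^+ k * tensor_norm g0 (nabla_iter g0 k (tensor2 h)) x).

Let g0s := cone_metric_symbol.
Let T (k : nat) := nabla_iter g0 k (tensor2 h).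
Arguments T : clear implicits.

Let Ts (k : nat) I : Cinfty D (fun x => T k x I).
Proof.
apply: Cinfty_nabla_iter => [|a b||J].
- exact: truncated_cone_open.
- exact: syms_Cinfty (g0s.1 a b).
- exact: cone_metric_unit_on.
set a := tnth J ord0; set b := tnth J ord_max.
have E := Cinfty_symbolP D w 0.
apply/E => N; have tg := trivial_growth truncated_cone_open.
apply: (symbol_ext tg) (symbolB tg (iffLR (E _) (Gs a b) N)
  (iffLR (E _) (syms_Cinfty (g0s.1 a b)) N)) => x _.
by rewrite /tensor2 /h !mxE.
Qed.

(** A component is at most a constant times the norm times the lengths of the coordinate vectors,
    and the length of [d_a] in the cone metric is [O(r^(w a))]. *)
Let Tb (k : nat) I : bd (al - k%:R + tweight (w := w) I) (fun x => T k x I).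
Proof.
have nb : bd (al - k%:R) (fun x => tensor_norm g0 (T k) x).
  have ri : bd (- k%:R) (fun x => (radius x ^+ k)^-1).
    exists 1, 1; split=> // x Dx _; have x0 := truncated_cone_radius Dx.
    by rewrite mul1r (powR_invn _ (ltW x0)) ger0_norm // invr_ge0 exprn_ge0 // ltW.
  apply: (growth_ext gr) (growthM gr (hb k) ri) => x Dx.
  have x0 := truncated_cone_radius Dx.
  by rewrite mulrAC mulfV ?mul1r // expf_neq0 // gt_eqF.
have pb := tip_bound_prod (index_enum _) (fun a => tip_bound_sqrt
  (symbol_bd (g0s.1 (tnth I a) (tnth I a) 0%N))).
have cb := growthM gr (growthM gr (growth_cst gr #|{: (k + 2).-tuple 'I_m.+1}|%:R) pb) nb.
rewrite add0r addrC in cb.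
apply: tip_bound_le cb => x Dx.
apply: le_trans (component_le_tensor_norm _ _ _ _) (ler_norm _).
  apply/matrixP => a b; rewrite mxE.
  have E : (g0 x)^T a b = g0 x b a by rewrite mxE.
  case: (unliftP ord0 a) => [i|] ->; case: (unliftP ord0 b) => [j|] ->;
    rewrite !cone_metricE //.
  by rewrite -[in LHS](ghT (truncated_cone_link Dx)) mxE.
exact: cone_metric_pos_def.
Qed.

(** A partial derivative of a component of the [k]-th covariant derivative is a component of the
    next one plus Christoffel symbols times components of the [k]-th. Hence the induction on [N]
    treats all [k] together. *)
Let Tsym N (k : nat) I : sym N (al - k%:R + tweight (w := w) I) (fun x => T k x I).
Proof.
elim: N k I => [|N IH] k I.
  split; last by split=> //; apply: Tb.
  by move=> x Dx; apply: Cinfty_continuous (@Ts k I) Dx.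
split; first by move=> x Dx; apply: Cinfty_continuous (@Ts k I) Dx.
split; first exact: Tb.
move=> a; split=> [x Dx|]; first exact: Cinfty_derivable (@Ts k I) Dx.
pose J := [tuple of a :: I].
have JI : behead_tuple J = I by apply: val_inj.
have E x : T k.+1 x J + (\sum_(c < k + 2) \sum_l
    christoffel g0 l a (tnth I c) x * T k x (tset I c l)) =
    partial a (fun y => T k y I) x.
  by rewrite /T /= /nabla theadE JI subrK.
apply: (symbol_ext gr) (symbolD gr (symbol_exponent _ (IH k.+1 J)) _) => [x _||].
- exact: E.
- by rewrite tweight_cons theadE JI -natr1; ring.
apply: (symbol_sum gr) => c _; apply: (symbol_sum gr) => l _.
have Cs := christoffel_symbol gr l a (tnth I c) g0s N.
apply: symbol_exponent (symbolM gr Cs (IH k (tset I c l))).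
by rewrite tweight_set; ring.
Qed.

Lemma perturbation_symbol a b :
  syms (al + w a + w b) (fun x => G x a b - g0 x a b).
Proof.
move=> N; apply: symbol_exponent (symbol_ext gr _ (@Tsym N 0%N [tuple a; b])).
  by rewrite tweight_cons tweight_cons tweight0 !theadE /=; rewrite /= subr0; ring.
by move=> x _; rewrite /T /= /tensor2 /h !mxE.
Qed.

Lemma tip_bound_small b u e : 0 < b -> 0 < e -> bd b u ->
  exists2 eta : R, 0 < eta & forall x, D x -> radius x < eta -> `|u x| <= e.
Proof.
move=> b0 e0 [C [eta [C0 eta0 H]]].
have [eta' eta0' H'] := small_powR b0 C0 e0.
exists (Num.min eta eta'); first by rewrite lt_min eta0.
move=> x Dx; rewrite lt_min => /andP[xe xe'].
by rewrite (le_trans (H x Dx xe)) // H' // xe' truncated_cone_radius.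
Qed.

Hypothesis al0 : 0 < al.
Hypothesis Gu : forall x, D x -> G x \in unitmx.

Let Gsy a b : syms (w a + w b) (fun x => G x a b).
Proof.
move=> N; apply: (symbol_ext gr) (symbolD gr (g0s.1 a b N)
  (symbol_weaken tip_bound_weaken _ (perturbation_symbol a b N))) => [x _|].
  by rewrite addrC subrK.
by rewrite -addrA lerDr ltW.
Qed.

(** The factor [r^(- w a)]. The matrix [nrm H] represents [H] in the frame made of the radial vector
    and the link vectors divided by [r]; there [G] has degree 0 and its determinant can be bounded
    below. *)
Let s (a : 'I_m.+1) x : R := if a == ord0 then 1 else (radius x)^-1.

Let s_symbol a : syms (- w a) (s a).
Proof.
move=> N; rewrite /s; case: (unliftP ord0 a) => [i|] ->.
  by rewrite cone_weight_sh; apply: inv_radius_symbol.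
rewrite cone_weight0 oppr0; exact: symbol_cst.
Qed.

Let nrm (H : 'rV[R]_m.+1 -> 'M[R]_m.+1) x : 'M[R]_m.+1 :=
  \matrix_(a, b) (s a x * s b x * H x a b).

Let S x : 'M[R]_m.+1 := diag_mx (\row_a s a x).

Let s0 a x : D x -> s a x != 0.
Proof.
move=> Dx; rewrite /s; case: ifP => _; first exact: oner_neq0.
by rewrite invr_eq0 gt_eqF // truncated_cone_radius.
Qed.

Let nrmE H x : nrm H x = S x *m H x *m S x.
Proof.
apply/matrixP => a b; rewrite mul_mx_diag mxE [RHS]mxE mul_diag_mx mxE.
by rewrite [X in _ = X * _ * _]mxE [X in _ = _ * X]mxE mulrAC.
Qed.

Let Su x : D x -> S x \in unitmx.
Proof.
move=> Dx; rewrite unitmxE unitfE det_diag.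
by apply/prodf_neq0 => a _; rewrite mxE s0.
Qed.

Let nrm_symbol (H : 'rV[R]_m.+1 -> 'M[R]_m.+1) b :
  (forall c d, syms (b + w c + w d) (fun x => H x c d)) ->
  forall c d, syms b (fun x => nrm H x c d).
Proof.
move=> Hs c d N.
apply: symbol_exponent (symbol_ext gr _ (symbolM gr (symbolM gr
  (s_symbol c N) (s_symbol d N)) (Hs c d N))) => [|x _]; first ring.
by rewrite mxE.
Qed.

Let nG0 c d : syms 0 (fun x => nrm g0 x c d).
Proof. by apply: nrm_symbol => a b N; rewrite add0r; exact: g0s.1. Qed.

Let nG c d : syms 0 (fun x => nrm G x c d).
Proof. by apply: nrm_symbol => a b N; rewrite add0r; exact: Gsy. Qed.

Let nGG0 c d : syms al (fun x => nrm G x c d - nrm g0 x c d).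
Proof.
move=> N.
have H := @nrm_symbol (fun x => G x - g0 x) al _ c d N.
apply: (symbol_ext gr) (H _) => [x _|a b M]; first by rewrite !mxE mulrBr.
apply: (symbol_ext gr) (perturbation_symbol a b M) => x _.
by rewrite !mxE.
Qed.

Let detG0 x : D x -> \det (nrm g0 x) = \det (gh (link_coord x)).
Proof.
move=> Dx; have x0 := truncated_cone_radius Dx.
have -> : nrm g0 x = block_mx (1%:M : 'M[R]_1) 0 0 (gh (link_coord x)).
  have [e1 e2 e3 e4] := block1E 1%:M (gh (link_coord x)).
  apply/matrixP => a b; rewrite mxE /s.
  case: (unliftP ord0 a) => [i|] ->; case: (unliftP ord0 b) => [j|] ->.
  - rewrite e4 cone_metricE /=; by field; rewrite gt_eqF.
  - by rewrite e3 cone_metricE mulr0.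
  - by rewrite e2 cone_metricE mulr0.
  - by rewrite e1 cone_metricE !mulr1 mxE.
by rewrite (@det_ublock _ 1 m) det1 mul1r.
Qed.

Let det_diff : bd al (fun x => \det (nrm G x) - \det (nrm g0 x)).
Proof.
have P (t : 'S_m.+1) (r : seq 'I_m.+1) : sym 0 al (fun x =>
    \prod_(a <- r) nrm G x a (t a) - \prod_(a <- r) nrm g0 x a (t a)).
  elim: r => [|a r IH].
    by apply: (symbol_ext gr) (symbol0 gr 0 _) => x _; rewrite !big_nil subrr.
  have p0 := symbol_prod0 gr r (fun c => nG c (t c) 0%N).
  have q := symbolMB gr (nG0 a (t a) 0%N) p0
    (symbol_exponent (esym (addr0 al)) (nGG0 a (t a) 0%N))
    (symbol_exponent (esym (addr0 al)) IH).
  apply: symbol_exponent (symbol_ext gr _ q) => [|x _]; first by rewrite !addr0.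
  by rewrite !big_cons.
have Q := symbol_sum gr (index_enum _) (fun (t : 'S_m.+1) (_ : true) =>
  symbolZ gr ((-1) ^+ t) (P t (index_enum _))).
apply: (growth_ext gr) (symbol_bd Q) => x _ /=.
by rewrite -sumrB; apply: eq_bigr => t _; rewrite mulrBr.
Qed.

(** In the rescaled frame the determinant of the cone metric is that of [gh], which is at least
    [(M + 1)^-1] near the tip. The determinant of [G] differs from it by [O(r^al)], so near the tip
    by at most half of this. *)
Let det_inv_bound : bd 0 (fun x => (\det (nrm G x))^-1).
Proof.
have : bd 0 (fun x => \det (invmx (gh (link_coord x)))).
  apply: symbol_bd (link_symbol (u := fun y => \det (invmx (gh y))) _ 0%N).
  apply/(Cinfty_symbolP U (fun=> 0) 0) => k.
  apply: (symbol_det (trivial_growth Uo)) => i j.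
  exact: (iffLR (Cinfty_symbolP U (fun=> 0) 0 _) (link_inverse_Cinfty i j)).
move=> [M [eta [M0 eta0 HM]]].
have e0 : 0 < (M + 1)^-1 / 2 by rewrite divr_gt0 // invr_gt0 ltr_wpDl.
have [eta' eta0' HD] := tip_bound_small al0 e0 det_diff.
exists (2 * (M + 1)), (Num.min eta eta'); split.
- by rewrite mulr_ge0 // addr_ge0.
- by rewrite lt_min eta0.
move=> x Dx; rewrite lt_min => /andP[xe xe'].
have := HM x Dx xe; have := HD x Dx xe'.
rewrite powRr0 !mulr1 detG0 // det_inv normrV; last first.
  by have := ghu (truncated_cone_link Dx); rewrite unitmxE.
have : \det (gh (link_coord x)) != 0.
  by have := ghu (truncated_cone_link Dx); rewrite unitmxE unitfE.
set d0 := \det (gh _); set d := \det (nrm G x) => d00 dd dM.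
have d00' : 0 < `|d0| by rewrite normr_gt0.
have M1 : 0 < M + 1 by rewrite ltr_wpDl.
have d0b : (M + 1)^-1 <= `|d0|.
  by rewrite -[`|d0|]invrK lef_pV2 ?posrE ?invr_gt0 // (le_trans dM) // lerDl.
have db : (M + 1)^-1 / 2 <= `|d|.
  have : `|d0| <= `|d| + `|d - d0|.
    by have := ler_normB d (d - d0); rewrite opprB addrC subrK.
  lra.
have d_0 : 0 < `|d| by apply: lt_le_trans db.
rewrite normfV -[2 * _]invrK lef_pV2 ?posrE ?invr_gt0 ?mulr_gt0 //.
by rewrite invfM mulrC.
Qed.

Lemma perturbed_metric_symbol : metric_symbol (D := D) (bd := bd) (w := w) G.
Proof.
split=> [|a b N]; first exact: Gsy.
have nu x : D x -> nrm G x \in unitmx.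
  by move=> Dx; rewrite nrmE !unitmx_mul Su // Gu.
have dn x : D x -> \det (nrm G x) != 0.
  by move=> /nu; rewrite unitmxE unitfE.
have I := symbol_invmx gr (fun c d => nG c d N) dn det_inv_bound a b.
apply: symbol_exponent (symbol_ext gr _ (symbolM gr (symbolM gr
  (s_symbol a N) I) (s_symbol b N))) => [|x Dx]; first ring.
have -> : invmx (G x) = S x *m invmx (nrm G x) *m S x.
  rewrite nrmE !invmx_mul ?unitmx_mul ?Su ?Gu // !mulmxA mulmxV ?Su //.
  by rewrite mul1mx mulmxKV // Su.
rewrite mul_mx_diag [RHS]mxE mul_diag_mx [X in _ = X * _]mxE.
by rewrite [X in _ = X * _ * _]mxE [X in _ = _ * X]mxE.
Qed.

End Perturbation.

End Metric.

End Patch.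

(** * Asymptotics of the potential *)

Lemma tuple2E (T : Type) (I : 2.-tuple T) :
  I = [tuple thead I; thead (behead_tuple I)].
Proof.
case/tupleP: I => a I; case/tupleP: I => b I; rewrite (tuple0 I).
exact: val_inj.
Qed.

(** * One-variable estimates along rays and segments *)

Section OneVariable.
Context {R : realType}.

Lemma mvt_segment n (f : 'rV[R]_n -> R) (x v : 'rV[R]_n) :
  (forall c : R, c \in `[0, 1] -> derivable f (c *: v + x) v) ->
  exists2 c : R, c \in `[0, 1] & f (v + x) - f x = 'D_v f (c *: v + x).
Proof.
move=> fd; pose F t : R := f (t *: v + x); pose dF t : R := 'D_v f (t *: v + x).
have Fd (c : R) : c \in `[0, 1] -> is_derive c (1 : R) F (dF c).
  by move=> /fd; apply: is_derive_line.
have F1 (c : R) : c \in `]0, 1[ -> is_derive c (1 : R) F (dF c).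
  by move=> /subset_itv_oo_cc; apply: Fd.
have F2 : {within `[0, 1], continuous F}.
  by apply: derivable_within_continuous => c /Fd[].
have [c cI E] := @MVT_segment R F dF 0 1 ler01 F1 F2.
by exists c => //; move: E; rewrite /F scale1r scale0r add0r subr0 mulr1.
Qed.

Lemma derive_partials n (f : 'rV[R]_n -> R) (x v : 'rV[R]_n) :
  differentiable f x -> 'D_v f x = \sum_i v ord0 i * partial i f x.
Proof.
move=> fd; rewrite (deriveE _ fd) [in LHS](row_sum_delta v) linear_sum.
by apply: eq_bigr => i _; rewrite linearZ /= /partial (deriveE _ fd).
Qed.

(** If [N] exceeded [K] at [r], its maximum over [[r, r0]] would exceed [K], hence be attained
    before [r0]. But [N] increases just to the right of such a point. *)
Lemma barrier (N dN : R -> R) (r0 K : R) :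
  (forall r, 0 < r <= r0 -> is_derive r (1 : R) N (dN r)) ->
  (forall r, 0 < r <= r0 -> K < N r -> 0 < dN r) ->
  N r0 <= K -> forall r, 0 < r <= r0 -> N r <= K.
Proof.
move=> Nd Np N0 r /andP[rp rr0]; rewrite leNgt; apply/negP => Kr.
have Nc s : 0 < s <= r0 -> {for s, continuous N}.
  by move=> /Nd[d _]; apply/differentiable_continuous/derivable1_diffP.
have Ncr : {within `[r, r0], continuous N}.
  apply: continuous_in_subspaceT => s; rewrite inE /= in_itv /= => /andP[rs sr].
  by apply: Nc; rewrite sr (lt_le_trans rp rs).
have [c cI cmax] := EVT_max rr0 Ncr.
move: cI; rewrite in_itv /= => /andP[rc cr0].
have c0 : 0 < c by apply: lt_le_trans rc.
have Kc : K < N c by apply: (lt_le_trans Kr); apply: cmax; rewrite in_itv /= lexx.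
have {}cr0 : c < r0.
  by rewrite lt_neqAle cr0 andbT; apply: contraTneq Kc => ->; rewrite -leNgt.
have cr0' : 0 < c <= r0 by rewrite c0 ltW.
have [e /= e0 He] : exists2 e : R, 0 < e & forall t, `|c - t| < e -> K < N t.
  have /cvgrPdist_lt /(_ (N c - K)) := Nc c cr0'.
  rewrite subr_gt0 => /(_ Kc) /nbhs_ballP[e /= e0 He]; exists e => // t ct.
  have := He t ct; rewrite /= => /ltr_normlP[] H1 H2; lra.
(* The interval from [c] to [c + d] stays below [r0] and inside the region where [N > K]. *)
pose d := Num.min (r0 - c) (e / 2).
have d0 : 0 < d by rewrite lt_min subr_gt0 cr0 divr_gt0.
have dr : c + d <= r0 by rewrite -lerBrDl ge_min lexx.
have de : d < e by apply: le_lt_trans (_ : e / 2 < e); [rewrite ge_min lexx orbT|lra].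
have I t : t \in `[c, c + d] -> 0 < t <= r0.
  by rewrite in_itv /= => /andP[ct td]; rewrite (lt_le_trans c0 ct) (le_trans td dr).
have F1 t : t \in `]c, c + d[ -> is_derive t 1 N (dN t).
  by move=> /subset_itv_oo_cc /I; apply: Nd.
have F2 : {within `[c, c + d], continuous N}.
  by apply: continuous_in_subspaceT => t; rewrite inE => /I; apply: Nc.
have cd : c < c + d by rewrite ltrDl.
have [t tI E] := @MVT R N dN c (c + d) cd F1 F2.
have : N (c + d) <= N c by apply: cmax; rewrite in_itv /= dr andbT (le_trans rc) // lerDl ltW.
rewrite -subr_le0 E leNgt mulr_gt0 //; last by rewrite addrAC subrr add0r.
apply: Np; first by apply/I/subset_itv_oo_cc.
apply: He; move: tI; rewrite in_itv /= => /andP[ct td].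
by rewrite ltr_norml; lra.
Qed.

(** By Young's inequality [d |v a| |v b|] is at most [d / 2] times the sum of the squares, and
    [C |v a|] at most [c / 4 * v a ^ 2 + C ^ 2 / c]. Summing, with [d n <= c / 4], the errors cost
    at most half of [c N] plus [n C ^ 2 / c], where [N] is the squared norm; the threshold on [N] is
    where the other half exceeds this constant. *)
Lemma dissipation_positive n (c d C : R) (v E : 'I_n -> R) :
  0 < c -> 0 <= d -> 0 <= C -> d * n%:R <= c / 4%:R ->
  (forall a, `|E a| <= d * (\sum_b `|v b|) + C) ->
  2 * n%:R * C ^+ 2 / c ^+ 2 < \sum_a v a ^+ 2 ->
  0 < \sum_a v a * (c * v a + E a).
Proof.
move=> c0 d0 C0 dn HE HK.
set N := \sum_a v a ^+ 2 in HK *.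
have sc (z : R) : \sum_(a < n) z = n%:R * z.
  by rewrite mulr_natl sumr_const card_ord.
have H a : - (d / 2 * (n%:R * v a ^+ 2 + N) + c / 4%:R * v a ^+ 2 + C ^+ 2 / c)
    <= v a * E a.
  rewrite lerNl -mulrN (le_trans (ler_norm _)) // normrM normrN.
  apply: le_trans (ler_wpM2l (normr_ge0 _) (HE a)) _.
  rewrite mulrDr -[leRHS]addrA lerD //.
    rewrite mulrCA -mulrA ler_wpM2l // mulr_sumr.
    have -> : 2^-1 * (n%:R * v a ^+ 2 + N) =
        \sum_b (2^-1 * v a ^+ 2 + 2^-1 * v b ^+ 2).
      rewrite big_split /= sumr_const card_ord -mulr_sumr -[_ *+ n]mulr_natl -/N; ring.
    apply: ler_sum => b _; rewrite -(real_normK (num_real (v a))).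
    rewrite -(real_normK (num_real (v b))).
    have := sqr_ge0 (`|v a| - `|v b|); move: `|v a| `|v b| => p q; rewrite sqrrB; lra.
  rewrite -(real_normK (num_real (v a))); move: `|v a| => p.
  have : 0 <= (c / 2 * p - C) ^+ 2 / c by rewrite divr_ge0 ?sqr_ge0 ?ltW.
  have -> : (c / 2 * p - C) ^+ 2 / c = c / 4%:R * p ^+ 2 + C ^+ 2 / c - p * C.
    by field; rewrite gt_eqF.
  by rewrite subr_ge0.
have -> : \sum_a v a * (c * v a + E a) = c * N + \sum_a v a * E a.
  by rewrite mulr_sumr -big_split; apply: eq_bigr => a _ /=; ring.
apply: lt_le_trans (lerD (lexx _) (ler_sum (index_enum _) (fun a _ => H a))).
have -> : \sum_(a < n) - (d / 2 * (n%:R * v a ^+ 2 + N) + c / 4%:R * v a ^+ 2 + C ^+ 2 / c)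
   = - (d * n%:R * N + c / 4%:R * N + n%:R * C ^+ 2 / c).
  rewrite sumrN; congr (- _); rewrite !big_split /= -mulr_sumr -mulr_sumr.
  rewrite big_split /= -mulr_sumr -/N !sc; by field; rewrite gt_eqF.
have N0 : 0 <= N by apply: sumr_ge0 => a _; apply: sqr_ge0.
have h1 : d * n%:R * N <= c / 4%:R * N by apply: ler_wpM2r.
have h2 : n%:R * C ^+ 2 / c < c / 2 * N.
  have -> : n%:R * C ^+ 2 / c = c / 2 * (2 * n%:R * C ^+ 2 / c ^+ 2).
    by field; rewrite gt_eqF.
  by rewrite ltr_pM2l // divr_gt0.
lra.
Qed.

Lemma is_derive_sum_fun (I : Type) (r : seq I) (F : I -> R -> R) (dF : I -> R) (t : R) :
  (forall a, is_derive t (1 : R) (F a) (dF a)) ->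
  is_derive t (1 : R) (fun s => \sum_(a <- r) F a s) (\sum_(a <- r) dF a).
Proof.
move=> H; elim: r => [|a r IH].
  have -> : (fun s => \sum_(a <- [::]) F a s) = cst 0.
    by apply/funext => s; rewrite big_nil.
  by rewrite big_nil; apply: is_derive_cst.
have -> : (fun s => \sum_(b <- a :: r) F b s) = F a + (fun s => \sum_(b <- r) F b s).
  by apply/funext => s; rewrite big_cons.
by rewrite big_cons; apply: is_deriveD.
Qed.

End OneVariable.

Lemma nabla_tensor0 (R : realType) n (G : 'rV[R]_n -> 'M[R]_n)
    (f : 'rV[R]_n -> R) x (I : 1.-tuple 'I_n) :
  nabla G (tensor0 f) x I = partial (thead I) f x.
Proof. by rewrite /nabla big_ord0 subr0. Qed.

Lemma hessianE (R : realType) n (G : 'rV[R]_n -> 'M[R]_n) f a b x :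
  hessian G f a b x =
  partial a (partial b f) x - \sum_c christoffel G c a b x * partial c f x.
Proof.
pose J : 1.-tuple 'I_n := behead_tuple [tuple a; b].
have E : (fun y => nabla G (tensor0 f) y J) = partial b f.
  by apply/funext => y; rewrite nabla_tensor0.
have -> : hessian G f a b x = partial a (fun y => nabla G (tensor0 f) y J) x -
    \sum_(d < 1) \sum_c christoffel G c a (tnth J d) x *
      nabla G (tensor0 f) x (tset J d c) by [].
rewrite E big_ord1; congr (_ - _); apply: eq_bigr => c _; congr (_ * _).
by rewrite nabla_tensor0 /thead tnth_tset.
Qed.

(** * The soliton equation near the tip, over one patch of the link *)

Section TipAnalysis.
Context {R : realType} {m : nat}.
Variables (U V B : set 'rV[R]_m).
Hypotheses (Uo : open U) (Vo : open V) (Bc : compact B).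
Hypotheses (VB : V `<=` B) (BU : B `<=` U).
Implicit Types (x : 'rV[R]_m.+1) (i j k l : 'I_m) (y : 'rV[R]_m).
Local Notation sh := (lift ord0).
Local Notation w := (@cone_weight R m).
Local Notation D := (truncated_cone V).
Local Notation bd := (tip_bound V).
Local Notation syms b u := (forall N, symbol D bd w N b u).
Let gr := tip_growth Vo.
Let Do := truncated_cone_open Vo.

Definition cone_point (r : R) y : 'rV[R]_m.+1 := row_mx (r%:M : 'M[R]_1) y.

Lemma cone_point_radius r y : radius (cone_point r y) = r.
Proof.
have := row_mxEl (r%:M : 'M[R]_1) y ord0 ord0.
by rewrite -lshift1E => E; rewrite /radius [LHS]E mxE eqxx mulr1n.
Qed.

Lemma cone_point_link r y : link_coord (cone_point r y) = y.
Proof. exact: row_mxKr. Qed.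

Lemma cone_pointK x : cone_point (radius x) (link_coord x) = x.
Proof.
apply/rowP => a; case: (unliftP ord0 a) => [i|] ->.
  by rewrite -!link_coordE cone_point_link.
exact: cone_point_radius.
Qed.

Lemma cone_point_line r y (s : R) :
  s *: delta_mx 0 ord0 + cone_point r y = cone_point (s + r) y.
Proof.
rewrite -[LHS]cone_pointK radius_line0 link_coord_line0.
by rewrite cone_point_radius cone_point_link.
Qed.

Lemma cone_point_lines r y i (s : R) :
  s *: delta_mx 0 (sh i) + cone_point r y = cone_point r (s *: delta_mx 0 i + y).
Proof.
rewrite -[LHS]cone_pointK radius_line link_coord_line.
by rewrite cone_point_radius cone_point_link.
Qed.

Lemma continuous_cone_point r : continuous (cone_point r).
Proof.
move=> y; apply/(@cvgrPdist_lt _ _ _ (nbhs y)) => e e0.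
apply/nbhs_ballP; exists e => // y'; rewrite -ball_normE /=; apply: le_lt_trans.
apply: norm_le_coord => // a; case: (unliftP ord0 a) => [i|] ->.
  have E z : cone_point r z ord0 (sh i) = z ord0 i.
    by rewrite -link_coordE cone_point_link.
  by have := coord_le_norm (y - y') i; rewrite 2!mxE [in X in _ -> X]mxE [X in _ -> `|_ + X| <= _]mxE !E.
have E z : cone_point r z ord0 ord0 = r := cone_point_radius r z.
by rewrite mxE [X in _ + X]mxE !E subrr normr0.
Qed.

Lemma cone_point_in W r y : 0 < r < 1 -> W y -> truncated_cone W (cone_point r y).
Proof.
move=> /andP[r0 r1] Wy; split; first by rewrite /= cone_point_radius.
by split; rewrite /= ?cone_point_radius ?cone_point_link.
Qed.

Lemma is_derive_radial (u : 'rV[R]_m.+1 -> R) r y :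
  derivable u (cone_point r y) (delta_mx 0 ord0) ->
  is_derive r (1 : R) (fun t : R => u (cone_point t y))
    (partial ord0 u (cone_point r y)).
Proof.
move=> ud; have E t : cone_point t y = t *: delta_mx 0 ord0 + cone_point 0 y.
  by rewrite cone_point_line addr0.
have -> : (fun t : R => u (cone_point t y)) =
    (fun t : R => u (t *: delta_mx 0 ord0 + cone_point 0 y)).
  by apply/funext => t; rewrite E.
by rewrite E in ud *; apply: is_derive_line.
Qed.

Variables (G g0 : 'rV[R]_m.+1 -> 'M[R]_m.+1) (al La : R) (f : 'rV[R]_m.+1 -> R).
Hypotheses (al0 : 0 < al) (al1 : al < 1).
Hypothesis fs : Cinfty (truncated_cone U) f.
Hypothesis Gs : metric_symbol (D := D) (bd := bd) (w := w) G.
Hypothesis Ricp : forall a b,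
  syms (al + w a + w b - 2) (fun x => ricci G a b x - ricci g0 a b x).
Hypothesis Chp : forall c a b, syms (al + w a + w b - w c - 1)
  (fun x => christoffel G c a b x - christoffel g0 c a b x).
Hypothesis Ch0 : forall c a x, D x ->
  christoffel g0 c ord0 a x = (c == a)%:R * w a / radius x.
Hypothesis Ric00 : forall a x, D x -> ricci g0 ord0 a x = 0.
Hypothesis Ric0s0 : forall i x, D x -> ricci g0 (sh i) ord0 x = 0.
Variable S : 'I_m -> 'I_m -> 'rV[R]_m -> R.
Hypothesis Ric0ss : forall i j x, D x -> ricci g0 (sh i) (sh j) x = S i j (link_coord x).
Hypothesis Sc : forall i j y, V y -> {for y, continuous (S i j)}.
Hypothesis soliton : forall a b x, D x ->
  ricci G a b x + hessian G f a b x = La * G x a b.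

Let DU x : D x -> truncated_cone U x.
Proof. by move=> [x1 [x0 /VB/BU Ux]]; split. Qed.

Let fD : Cinfty D f. Proof. by apply: Cinfty_sub fs => x /DU. Qed.

Let weak b c u : c <= b -> syms b u -> syms c u.
Proof. by move=> cb us N; apply: symbol_weaken (us N) => //; apply: tip_bound_weaken. Qed.

Let hess2 a b x : D x -> partial a (partial b f) x =
  \sum_c christoffel G c a b x * partial c f x + La * G x a b - ricci G a b x.
Proof. by move=> /(soliton a b); rewrite hessianE; lra. Qed.

(* The radial part of the Hessian equation is a linear ODE for the gradient
   along the rays. *)
Let err a x := \sum_c (christoffel G c ord0 a x - christoffel g0 c ord0 a x) * partial c f x
  + (La * G x ord0 a - ricci G ord0 a x).

Let radial_ode a x : D x -> partial ord0 (partial a f) x =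
  w a / radius x * partial a f x + err a x.
Proof.
move=> Dx; rewrite hess2 // -addrA [RHS]addrA; congr (_ + _).
have -> : w a / radius x * partial a f x =
    \sum_c christoffel g0 c ord0 a x * partial c f x.
  rewrite (bigD1 a) //= Ch0 // eqxx mul1r big1 ?addr0 // => c /negbTE ca.
  by rewrite Ch0 // ca !mul0r.
by rewrite -big_split /=; apply: eq_bigr => c _; rewrite -mulrDl addrC subrK.
Qed.

Let err_source a : syms (al + w a - 2) (fun x => La * G x ord0 a - ricci G ord0 a x).
Proof.
move=> N; apply: (symbolB gr).
  apply: (symbolZ gr); apply: weak (Gs.1 ord0 a) N.
  by rewrite cone_weight0; move: (w a) al1 => wa; lra.
apply: symbol_exponent (symbol_ext gr _ (Ricp ord0 a N)) => [|x Dx].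
  by rewrite cone_weight0 addr0.
by rewrite Ric00 // subr0.
Qed.

(** A single constant and a single radius for a finite family, whose members may have different
    exponents. *)
Let unif (I : finType) (b : I -> R) (u : I -> 'rV[R]_m.+1 -> R) :
  (forall t, bd (b t) (u t)) -> exists C eta : R, [/\ 0 <= C, 0 < eta &
    forall t x, D x -> radius x < eta -> `|u t x| <= C * radius x `^ b t].
Proof.
move=> ub.
suff [C [eta [C0 e0 H]]] : exists C eta : R, [/\ 0 <= C, 0 < eta &
    forall t x, t \in enum I -> D x -> radius x < eta ->
      `|u t x| <= C * radius x `^ b t].
  by exists C, eta; split=> // t x; apply: H; rewrite mem_enum.
elim: (enum I) => [|t r [C [eta [C0 e0 H]]]]; first by exists 0, 1; split.
have [C' [eta' [C0' e0' H']]] := ub t.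
exists (Num.max C C'), (Num.min eta eta'); split.
- by rewrite le_max C0.
- by rewrite lt_min e0.
move=> t' x; rewrite inE lt_min => /orP[/eqP ->|tr] Dx /andP[xe xe'].
  apply: le_trans (H' x Dx xe') _; apply: ler_wpM2r; first exact: powR_ge0.
  by rewrite le_max lexx orbT.
apply: le_trans (H t' x tr Dx xe) _; apply: ler_wpM2r; first exact: powR_ge0.
by rewrite le_max lexx.
Qed.

Let err_bound : exists C eta : R, [/\ 0 <= C, 0 < eta &
  forall a x, D x -> radius x < eta -> `|err a x| <=
    \sum_c C * radius x `^ (al + w a - w c - 1) * `|partial c f x|
    + C * radius x `^ (al + w a - 2)].
Proof.
have [C1 [e1 [C10 e10 H1]]] := unif (fun ca : 'I_m.+1 * 'I_m.+1 =>
  symbol_bd (Chp ca.1 ord0 ca.2 0%N)).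
have [C2 [e2 [C20 e20 H2]]] := unif (fun a => symbol_bd (err_source a 0%N)).
exists (Num.max C1 C2), (Num.min e1 e2); split.
- by rewrite le_max C10.
- by rewrite lt_min e10.
move=> a x Dx; rewrite lt_min => /andP[xe1 xe2].
apply: le_trans (ler_normD _ _) _; apply: lerD.
  apply: le_trans (ler_norm_sum _ _ _) _; apply: ler_sum => c _.
  rewrite normrM ler_wpM2r //; apply: le_trans (H1 (c, a) x Dx xe1) _.
  rewrite /= cone_weight0 addr0 ler_wpM2r ?powR_ge0 //.
  by rewrite le_max lexx.
apply: le_trans (H2 a x Dx xe2) _; rewrite ler_wpM2r ?powR_ge0 //.
by rewrite le_max lexx orbT.
Qed.

Let powDr (r b c : R) : 0 < r -> r `^ (b + c) = r `^ b * r `^ c.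
Proof. by move=> r0; rewrite powRD // (gt_eqF r0) implybT. Qed.

(** The expected bound [d_a f = O(r^(al - 1 + w a))] says that [v] is bounded. *)
Let v y a (r : R) := r `^ (1 - al - w a) * partial a f (cone_point r y).

Let vE a y r : 0 < r -> partial a f (cone_point r y) = r `^ (al - 1 + w a) * v y a r.
Proof.
move=> r0; rewrite /v mulrA -powDr // [X in _ `^ X](_ : _ = 0) ?powRr0 ?mul1r //.
ring.
Qed.

Let E y a (r : R) := r `^ (2 - al - w a) * err a (cone_point r y).

(** The power of [r] contributes the rate [1 - al - w a] and the cone connection the rate [w a], so
    the weights cancel. The exponent in [E] is larger by one than that in [v] because the right-hand
    side is divided by [r]. *)
Let v_derive y a (r : R) : 0 < r < 1 -> V y ->
  is_derive r (1 : R) (v y a) (((1 - al) * v y a r + E y a r) / r).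
Proof.
move=> r01 Vy; have /andP[r0 r1] := r01; have Dx := cone_point_in r01 Vy.
have d1 := is_derive1_powR (1 - al - w a) r0.
have d2 := is_derive_radial (Cinfty_derivable (Cinfty_partial a fD) Dx).
have d := is_deriveM d1 d2.
apply: is_derive_eq d _.
rewrite radial_ode // cone_point_radius /E /v.
have -> : r `^ (2 - al - w a) = r `^ (1 - al - w a) * r.
  by rewrite -{3}(powRr1 (ltW r0)) -powDr //; congr (_ `^ _); ring.
have -> : r `^ (1 - al - w a - 1) = r `^ (1 - al - w a) / r.
  by rewrite powDr // powRN powRr1 // ltW.
rewrite /GRing.scale /=; by field; rewrite gt_eqF.
Qed.

Lemma gradient_bound a : bd (al - 1 + w a) (partial a f).
Proof.
have [C [eta [C0 eta0 HE]]] := err_bound.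
have c0 : 0 < 1 - al by rewrite subr_gt0.
pose n := m.+1.
have n0 : 0 < n%:R :> R by rewrite ltr0n.
have C1 : 0 < C + 1 by rewrite ltr_wpDl.
(* Chosen so that [(C + 1) q^al n = (1 - al) / 4]: for [r <= q] the coupling [d = C r^al] satisfies
   the smallness condition of [dissipation_positive] with [c = 1 - al]. *)
pose q := ((1 - al) / 4%:R / ((C + 1) * n%:R)) `^ al^-1.
have q0 : 0 < q by apply: powR_gt0; rewrite divr_gt0 ?divr_gt0 ?mulr_gt0.
pose r0 := Num.min (2^-1) (Num.min (eta / 2) q).
have r00 : 0 < r0 by rewrite !lt_min q0 divr_gt0 //= invr_gt0 ltr0n.
have r01 : r0 < 1 by rewrite !gt_min; apply/orP; left; lra.
have r0e : r0 < eta by rewrite !gt_min; apply/orP; right; apply/orP; left; lra.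
have r0q r : 0 < r <= r0 -> C * r `^ al * n%:R <= (1 - al) / 4%:R.
  move=> /andP[rp rr0]; have rq : r <= q.
    by rewrite (le_trans rr0) // !ge_min lexx !orbT.
  have Q0 : 0 < (1 - al) / 4%:R / ((C + 1) * n%:R).
    by rewrite divr_gt0 ?divr_gt0 ?mulr_gt0.
  have rQ : r `^ al <= (1 - al) / 4%:R / ((C + 1) * n%:R).
    have -> : (1 - al) / 4%:R / ((C + 1) * n%:R) = q `^ al.
      by rewrite /q -powRrM mulVf ?gt_eqF // powRr1 // ltW.
    by apply: ge0_ler_powR; rewrite ?nnegrE ?powR_ge0 // ltW.
  have : (C + 1) * r `^ al * n%:R <= (1 - al) / 4%:R.
    by rewrite mulrAC mulrC -ler_pdivlMr // mulr_gt0.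
  apply: le_trans; rewrite ler_wpM2r ?(ltW n0) // ler_wpM2r ?powR_ge0 //.
  by rewrite lerDl.
have Eb y a' r : V y -> 0 < r <= r0 ->
    `|E y a' r| <= C * r `^ al * (\sum_c `|v y c r|) + C.
  move=> Vy /andP[rp rr0].
  have r01' : 0 < r < 1 by rewrite rp (le_lt_trans rr0 r01).
  have Dx := cone_point_in r01' Vy.
  rewrite /E normrM ger0_norm ?powR_ge0 //.
  have := HE a' _ Dx; rewrite cone_point_radius => /(_ (le_lt_trans rr0 r0e)).
  move=> /(ler_wpM2l (powR_ge0 r (2 - al - w a'))) /le_trans; apply.
  (* The power in [E] times that of a coupling coefficient is [r^(1 - w c) = r^al r^(1 - al - w c)],
     which leaves a factor [r^al] in front of [v]; for the source term the exponents add up to 0. *)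
  rewrite mulrDr; apply: lerD.
    rewrite !mulr_sumr; apply: ler_sum => c _.
    rewrite /v normrM (ger0_norm (powR_ge0 _ _)) !mulrA ler_wpM2r //.
    rewrite mulrAC [X in X <= _]mulrC [X in _ <= X]mulrAC -!powDr // mulrC.
    rewrite -mulrA -powDr // mulrC le_eqVlt; apply/orP; left; apply/eqP.
    by congr (_ * _ `^ _); ring.
  rewrite mulrCA -powDr // [X in _ `^ X](_ : _ = 0) ?powRr0 ?mulr1 //; ring.
(* The starting value for the barrier: at the fixed radius [r0] the gradient is continuous over the
   compact set [B]. *)
have [M [M0 HM]] : exists M : R, 0 <= M /\ forall y, V y -> \sum_c v y c r0 ^+ 2 <= M.
  have /choice[Mc HMc] : forall c, exists Mc : R, forall y, B y ->
      `|partial c f (cone_point r0 y)| <= Mc.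
    move=> c; apply: compact_pointwise_bounded Bc _ => y /BU Uy.
    apply: continuous_comp; last first.
      apply: Cinfty_continuous (Cinfty_partial c fs) _.
      by apply: cone_point_in Uy; rewrite r00.
    exact: continuous_cone_point.
  exists (\sum_c (r0 `^ (1 - al - w c) * Mc c) ^+ 2); split.
    by apply: sumr_ge0 => c _; apply: sqr_ge0.
  move=> y Vy; apply: ler_sum => c _.
  rewrite /v !exprMn ler_wpM2l ?sqr_ge0 // -(real_normK (num_real (partial _ _ _))).
  by rewrite lerXn2r ?nnegrE // ?(le_trans _ (HMc c y (VB Vy))) // HMc //; apply: VB.
(* The larger of the threshold beyond which the squared norm increases and its bound at [r0]. *)
pose K := Num.max (2 * n%:R * C ^+ 2 / (1 - al) ^+ 2) M.
have NK y r : V y -> 0 < r <= r0 -> \sum_c v y c r ^+ 2 <= K.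
  move=> Vy; pose N r := \sum_c v y c r ^+ 2.
  pose dN r := \sum_c (2 * (v y c r * (((1 - al) * v y c r + E y c r) / r))).
  have i01 t : 0 < t <= r0 -> 0 < t < 1.
    by move=> /andP[-> tr]; rewrite (le_lt_trans tr r01).
  apply: (@barrier R N dN r0 K _ _ _ r).
  - move=> t tI; apply: is_derive_sum_fun => c.
    have d := @v_derive y c t (i01 _ tI) Vy.
    have -> : (fun s : R => v y c s ^+ 2) = v y c * v y c.
      by apply/funext => s; rewrite expr2.
    apply: is_derive_eq (is_deriveM d d) _.
    by rewrite mulr_natl mulr2n.
  - move=> t tI KN; have /andP[t0 tr] := tI.
    have P := @dissipation_positive R n (1 - al) (C * t `^ al) C
      (fun c => v y c t) (fun c => E y c t) c0 (mulr_ge0 C0 (powR_ge0 _ _)) C0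
      (r0q _ tI) (fun c => Eb y c t Vy tI) (le_lt_trans _ KN).
    rewrite /dN -mulr_sumr mulr_gt0 //.
    rewrite (eq_bigr (fun c => v y c t * ((1 - al) * v y c t + E y c t) / t)).
      by rewrite -mulr_suml divr_gt0 // P // le_max lexx.
    by move=> c _; rewrite mulrA.
  - by apply: le_trans (HM y Vy) _; rewrite le_max lexx orbT.
exists (Num.sqrt K), r0; split=> // x Dx xr0.
have x0 := truncated_cone_radius Dx.
have Vx : V (link_coord x) by case: Dx => _ [].
rewrite -[x in partial a f x]cone_pointK (vE a (link_coord x) x0) normrM.
rewrite (ger0_norm (powR_ge0 _ _)) mulrC ler_wpM2r ?powR_ge0 //.
rewrite -sqrtr_sqr ler_wsqrtr //.
apply: le_trans (NK _ _ Vx (_ : 0 < radius x <= r0)); last by rewrite x0 ltW.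
by rewrite (bigD1 a) //= lerDl; apply: sumr_ge0 => c _; apply: sqr_ge0.
Qed.

Let nonincreasing_line (N dN : R -> R) (s t : R) : s <= t ->
  (forall r, r \in `[s, t] -> is_derive r (1 : R) N (dN r)) ->
  (forall r, r \in `[s, t] -> dN r <= 0) -> N t <= N s.
Proof.
move=> st Nd N0; rewrite -subr_le0.
have F1 (r : R) : r \in `]s, t[ -> is_derive r 1 N (dN r).
  by move=> /subset_itv_oo_cc; apply: Nd.
have F2 : {within `[s, t], continuous N}.
  by apply: derivable_within_continuous => r rI; have [] := Nd r rI.
have [c cI ->] := MVT_segment st F1 F2.
by rewrite mulr_le0_ge0 ?subr_ge0 // N0.
Qed.

(** The bound [C r^(al - 1)] on the radial derivative has primitive [C / al * r^al], so subtracting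
    the latter makes both [f] and [- f] nonincreasing in [r]. Hence every value of
    [f - C / al * r^al] on a ray lies below every value of [f + C / al * r^al], and the supremum of
    the former serves as the limit. *)
Lemma radial_limit : exists C eta : R, [/\ 0 <= C, 0 < eta &
  exists L : 'rV[R]_m -> R, forall r y, V y -> 0 < r < eta ->
    `|f (cone_point r y) - L y| <= C * r `^ al].
Proof.
have [C [eta [C0 eta0 H]]] := gradient_bound ord0.
pose e := Num.min eta 1; have e0 : 0 < e by rewrite lt_min eta0 ltr01.
exists (C / al), e; split=> //; first by rewrite divr_ge0 // ltW.
have rI r : 0 < r < e -> 0 < r < 1 /\ r < eta.
  by rewrite lt_min => /andP[-> /andP[-> ->]].
have fd (r : R) y : V y -> 0 < r < e ->
    is_derive r (1 : R) (fun t => f (cone_point t y)) (partial ord0 f (cone_point r y)).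
  move=> Vy /rI[r01 _]; apply: is_derive_radial.
  exact: Cinfty_derivable fD (cone_point_in r01 Vy).
have fb r y : V y -> 0 < r < e -> `|partial ord0 f (cone_point r y)| <= C * r `^ (al - 1).
  move=> Vy /rI[r01 re]; have := H _ (cone_point_in r01 Vy).
  by rewrite cone_point_radius cone_weight0 addr0; apply.
have pd (r : R) y s : V y -> 0 < r < e -> is_derive r (1 : R)
    (fun t => s * f (cone_point t y) - C / al * t `^ al)
    (s * partial ord0 f (cone_point r y) - C * r `^ (al - 1)).
  move=> Vy rI'; have /andP[r0 _] := rI'.
  have d1 := is_deriveZ s (fd r y Vy rI').
  have d2 := is_deriveZ (C / al) (is_derive1_powR al r0).
  apply: is_derive_eq (is_deriveB d1 d2) _.
  by rewrite /GRing.scale /=; congr (_ - _); field; rewrite gt_eqF.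
have mono r t y s : V y -> `|s| = 1 -> 0 < r -> r <= t -> t < e ->
    s * f (cone_point t y) - C / al * t `^ al <= s * f (cone_point r y) - C / al * r `^ al.
  move=> Vy s1 r0 rt te.
  have I q : q \in `[r, t] -> 0 < q < e.
    by rewrite in_itv /= => /andP[rq qt]; rewrite (lt_le_trans r0 rq) (le_lt_trans qt te).
  apply: (nonincreasing_line (N := fun t => s * f (cone_point t y) - C / al * t `^ al)
    rt (fun q qI => pd q y s Vy (I q qI))) => q qI.
  rewrite subr_le0 (le_trans (ler_norm _)) // normrM s1 mul1r.
  exact: fb (I q qI).
pose A y r := f (cone_point r y) - C / al * r `^ al.
have AB y r t : V y -> 0 < r < e -> 0 < t < e ->
    A y r <= f (cone_point t y) + C / al * t `^ al.
  move=> Vy /andP[r0 re] /andP[t0 te].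
  have p0 q : 0 <= C / al * q `^ al by rewrite mulr_ge0 ?powR_ge0 // divr_ge0 // ltW.
  have [rt|tr] := leP r t.
    have := mono r t y (-1) Vy _ r0 rt te; rewrite normrN normr1 => /(_ erefl).
    have := p0 r; rewrite /A; lra.
  have := mono t r y 1 Vy (normr1 _) t0 (ltW tr) re.
  have := p0 t; rewrite /A; lra.
exists (fun y => sup [set A y r | r in [set r | 0 < r < e]]) => r y Vy rI'.
set X := [set _ | _ in _].
have Xs : has_sup X.
  split; first by exists (A y r); exists r.
  by exists (f (cone_point r y) + C / al * r `^ al) => _ [t tI <-]; apply: AB.
rewrite ler_distl; apply/andP; split.
  have : sup X <= f (cone_point r y) + C / al * r `^ al.
    by apply: ge_sup; [case: Xs|move=> _ [t tI <-]; apply: AB].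
  lra.
have : A y r <= sup X by apply: ub_le_sup; [case: Xs|exists r].
by rewrite /A; lra.
Qed.

Hypothesis Vconvex : forall y z (t : R), V y -> V z -> 0 <= t <= 1 ->
  V (t *: (z - y) + y).

(** For all small [r], two limits differ by at most [K r^al]: two radial errors, plus the increment
    of [f] along the link segment from [y0] to [y] at radius [r], where link derivatives are
    [O(r^al)]. Convexity keeps the segment in [V]. *)
Lemma tip_limit : exists L : R, bd al (fun x => f x - L).
Proof.
have [[y0 Vy0]|V0] := pselect (exists y, V y); last first.
  exists 0, 0, 1; split=> // x [_ [_ Vx]] _; exfalso; apply: V0.
  by exists (link_coord x).
have [C [eta [C0 eta0 [L HL]]]] := radial_limit.
have [C1 [eta1 [C10 eta10 H1]]] := unif gradient_bound.
have LE y : V y -> L y = L y0.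
  move=> Vy; apply/eqP; rewrite -subr_eq0 -normr_le0.
  apply/ler_addgt0Pl => e e0; rewrite addr0.
  pose K := C + C + \sum_i `|(y - y0) ord0 i| * C1.
  have K0 : 0 <= K.
    by rewrite !addr_ge0 //; apply: sumr_ge0 => i _; apply: mulr_ge0.
  have [eta2 eta20 H2] := small_powR al0 K0 e0.
  pose r := Num.min (Num.min eta eta1) (Num.min eta2 1) / 2.
  have [rr r0 r01] : [/\ 0 < r, [/\ r < eta, r < eta1 & r < eta2] & 0 < r < 1].
    have m0 : 0 < Num.min (Num.min eta eta1) (Num.min eta2 1).
      by rewrite !lt_min eta0 eta10 eta20 ltr01.
    have rp : 0 < r by rewrite divr_gt0.
    have : r < Num.min (Num.min eta eta1) (Num.min eta2 1) by rewrite /r; lra.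
    by rewrite !lt_min rp => /andP[/andP[-> ->] /andP[-> ->]].
  have [re re1 re2] := r0.
  apply: le_trans (H2 r _); last by rewrite rr.
  have b1 : `|L y - f (cone_point r y)| <= C * r `^ al.
    by rewrite distrC HL // rr.
  have b2 : `|f (cone_point r y0) - L y0| <= C * r `^ al by rewrite HL // rr.
  have b3 : `|f (cone_point r y) - f (cone_point r y0)| <=
      (\sum_i `|(y - y0) ord0 i| * C1) * r `^ al.
    (* With radial component 0, this direction keeps the radius equal to [r]. *)
    pose u := cone_point 0 (y - y0).
    have uE t : t *: u + cone_point r y0 = cone_point r (t *: (y - y0) + y0).
      apply/rowP => a; rewrite mxE [X in X + _]mxE.
      case: (unliftP ord0 a) => [i|] ->.
        have Es z q : cone_point q z 0 (sh i) = z 0 i.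
          by rewrite -[LHS]link_coordE cone_point_link.
        by rewrite /u !Es [RHS]mxE [X in _ = X + _]mxE.
      have E0 z q : cone_point q z 0 ord0 = q := cone_point_radius q z.
      by rewrite /u !E0 mulr0 add0r.
    have Dt t : t \in `[0, 1] -> D (t *: u + cone_point r y0).
      rewrite in_itv /= uE => tI; apply: cone_point_in => //.
      exact: Vconvex.
    have [c cI] := mvt_segment (f := f) (x := cone_point r y0) (v := u)
      (fun t tI => diff_derivable (Cinfty_differentiable Do fD (Dt t tI))).
    have -> : u + cone_point r y0 = cone_point r y.
      by rewrite -[u]scale1r uE scale1r subrK.
    move=> ->; rewrite derive_partials; last exact: Cinfty_differentiable Do fD (Dt c cI).
    rewrite big_ord_recl [u ord0 ord0]cone_point_radius mul0r add0r.
    rewrite (le_trans (ler_norm_sum _ _ _)) // mulr_suml; apply: ler_sum => i _.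
    rewrite -link_coordE cone_point_link normrM -mulrA ler_wpM2l //.
    have := H1 (sh i) _ (Dt c cI); rewrite uE cone_point_radius => /(_ re1).
    by rewrite cone_weight_sh subrK.
  rewrite /K !mulrDl; have := ler_normD (L y - f (cone_point r y))
    (f (cone_point r y) - f (cone_point r y0) + (f (cone_point r y0) - L y0)).
  have := ler_normD (f (cone_point r y) - f (cone_point r y0)) (f (cone_point r y0) - L y0).
  have -> : L y - f (cone_point r y) + (f (cone_point r y) - f (cone_point r y0)
    + (f (cone_point r y0) - L y0)) = L y - L y0 by ring.
  lra.
exists (L y0), C, eta; split=> // x Dx xe.
have Vx : V (link_coord x) by case: Dx => _ [].
rewrite -(LE _ Vx) -[x in f x]cone_pointK HL // xe andbT.
exact: truncated_cone_radius Dx.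
Qed.

(** The constant satisfies [e (h + 2) = |s| h / 4]. The hypotheses give [|A| h <= 2 e] and
    [|s| / 2 <= |A| + e], hence [|s| h / 2 <= e (h + 2)], a contradiction. *)
Let difference_quotient_gap (h s s' A p q : R) : 0 < h -> 0 < `|s| ->
  let e := `|s| * h / (4%:R * (h + 2)) in
  `|A + s'| <= e -> `|s' - s| <= `|s| / 2 -> `|p| <= e -> `|q| <= e ->
  p - q = A * h -> False.
Proof.
move=> h0 s0 e As ss pe qe pq.
have eh : e * (h + 2) = `|s| * h / 4%:R by rewrite /e; field; lra.
have Ah : `|A| * h <= 2 * e.
  by rewrite -[X in _ * X](gtr0_norm h0) -normrM -pq (le_trans (ler_normB _ _)) //; lra.
have : `|s| <= `|A| + (e + `|s| / 2).
  have {1}-> : s = A + s' - A - (s' - s) by ring.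
  have h1 := ler_normB (A + s' - A) (s' - s).
  have h2 := ler_normB (A + s') A; move: h1 h2 As ss; lra.
move=> /(ler_wpM2r (ltW h0)); rewrite !mulrDl.
have : 0 < `|s| * h by apply: mulr_gt0.
move: eh; rewrite mulrDr; lra.
Qed.

(** The connection terms are [O(r^al)] because the weight of the contracted index cancels between
    Christoffel symbol and gradient; the metric term is [O(r^2)], and the Ricci tensor is [S] up to
    [O(r^al)]. *)
Let hess_plus_S i j :
  bd al (fun x => partial (sh i) (partial (sh j) f) x + S i j (link_coord x)).
Proof.
have t1 : bd al (fun x => \sum_c christoffel G c (sh i) (sh j) x * partial c f x).
  have [C [eta [C0 eta0 H]]] := unif (fun c => growthM gr
    (symbol_bd (christoffel_symbol gr c (sh i) (sh j) Gs 0%N)) (gradient_bound c)).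
  exists (\sum_(c < m.+1) C), eta; split=> //; first by apply: sumr_ge0.
  move=> x Dx xe; rewrite (le_trans (ler_norm_sum _ _ _)) // mulr_suml.
  apply: ler_sum => c _; apply: le_trans (H c x Dx xe) _.
  by rewrite !cone_weight_sh le_eqVlt; apply/orP; left; apply/eqP; congr (_ * _ `^ _); ring.
have t2 : bd al (fun x => La * G x (sh i) (sh j)).
  have := symbol_bd (weak _ (fun N => symbolZ gr La (Gs.1 (sh i) (sh j) N)) 0%N).
  by apply; rewrite !cone_weight_sh; move: al1; lra.
have t3 : bd al (fun x => - (ricci G (sh i) (sh j) x - ricci g0 (sh i) (sh j) x)).
  apply: symbol_bd (symbol_exponent _ (symbolN gr (Ricp (sh i) (sh j) 0%N))).
  by rewrite !cone_weight_sh; ring.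
apply: (growth_ext gr) (growthD gr (growthD gr t1 t2) t3) => x Dx.
by rewrite hess2 // Ric0ss //; ring.
Qed.

(* On segments in the direction [i], the increments of [d_j f] tend to zero
   with the radius, while their derivatives tend to [- S i j]. *)
Lemma link_ricci_zero i j y : V y -> S i j y = 0.
Proof.
move=> Vy; apply/eqP/negPn/negP => S0.
have k0 : 0 < `|S i j y| by rewrite normr_gt0.
have [h h0 Hh] : exists2 h : R, 0 < h & forall t : R, `|t| <= h ->
    V (t *: delta_mx 0 i + y) /\
    `|S i j (t *: delta_mx 0 i + y) - S i j y| <= `|S i j y| / 2.
  have k20 : 0 < `|S i j y| / 2 by rewrite divr_gt0.
  have n1 : nbhs y V by apply: open_nbhs_nbhs.
  have n2 : \forall z \near y, `|S i j y - S i j z| <= `|S i j y| / 2.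
    by have /cvgrPdist_le/(_ _ k20) := @Sc i j y Vy.
  have FI : setI_closed (nbhs y) by apply: filterI.
  have /nbhs_ballP[e /= e0 He] := FI _ _ n1 n2.
  exists (e / 2); first by rewrite divr_gt0.
  move=> t te; have [|Vz Sz] := He (t *: delta_mx 0 i + y).
    rewrite -ball_normE /= distrC addrK normrZ.
    apply: le_lt_trans (_ : `|t| * 1 < e); last by rewrite mulr1; lra.
    rewrite ler_wpM2l // norm_le_coord // => l; rewrite mxE eqxx /=.
    by case: eqP; rewrite ?normr1 ?normr0.
  by split=> //; rewrite distrC.
pose e := `|S i j y| * h / (4%:R * (h + 2)).
have e0 : 0 < e by rewrite divr_gt0 ?mulr_gt0 ?addr_gt0.
have [eta1 eta10 H1] := tip_bound_small al0 e0 (hess_plus_S i j).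
have b2 : bd al (partial (sh j) f).
  have := gradient_bound (sh j); rewrite cone_weight_sh.
  by have -> : al - 1 + 1 = al by ring.
have [eta2 eta20 H2] := tip_bound_small al0 e0 b2.
pose r := Num.min (Num.min eta1 eta2) 1 / 2.
have m0 : 0 < Num.min (Num.min eta1 eta2) 1 by rewrite !lt_min eta10 eta20 ltr01.
have rp : 0 < r by rewrite divr_gt0.
have : r < Num.min (Num.min eta1 eta2) 1 by rewrite /r; lra.
rewrite !lt_min => /andP[/andP[r1 r2] r3].
have Dt t : `|t| <= h -> D (t *: delta_mx 0 (sh i) + cone_point r y).
  by move=> /Hh[Vt _]; rewrite cone_point_lines; apply: cone_point_in; rewrite ?rp.
have hh : `|h| = h by rewrite gtr0_norm.
have pd t : `|t| <= `|h| -> derivable (partial (sh j) f)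
    (t *: delta_mx 0 (sh i) + cone_point r y) (delta_mx 0 (sh i)).
  rewrite hh => th; apply: Cinfty_derivable (Dt t th).
  exact: Cinfty_partial fD.
have [c ch Ec] := mvt_line pd.
rewrite hh in ch.
have rad t : radius (t *: delta_mx 0 (sh i) + cone_point r y) = r.
  by rewrite radius_line cone_point_radius.
have q1 := H1 _ (Dt c ch); rewrite rad link_coord_line cone_point_link in q1.
have hle : `|h| <= h by rewrite hh.
have q2 := H2 _ (Dt h hle); rewrite rad in q2.
have q3 := H2 (cone_point r y); rewrite cone_point_radius in q3.
have r01 : 0 < r < 1 by rewrite rp.
have [_ q4] := Hh c ch.
exact: difference_quotient_gap h0 k0 (q1 r1) q4 (q2 r2)
  (q3 (cone_point_in r01 Vy) r2) Ec.
Qed.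

Lemma ricci_decay a b : syms (al + w a + w b - 2) (ricci G a b).
Proof.
move=> N; apply: (symbol_ext gr) (Ricp a b N) => x Dx.
suff -> : ricci g0 a b x = 0 by rewrite subr0.
case: (unliftP ord0 a) => [i|] ->; last exact: Ric00.
case: (unliftP ord0 b) => [j|] ->; last exact: Ric0s0.
rewrite Ric0ss // link_ricci_zero //.
by case: Dx => _ [].
Qed.

(** The induction starts at the Hessian, not at the gradient: [La * G - Ric] is controlled with all
    its derivatives, whereas [gradient_bound] concerns values only. *)
Lemma nabla_potential_symbol (k : nat) (I : (k.+2 + 0).-tuple 'I_m.+1) :
  syms (al - k.+2%:R + tweight (w := w) I)
    (fun x => nabla_iter G k.+2 (tensor0 f) x I).
Proof.
elim: k I => [|k IH] I N.
  pose a := thead I; pose b := thead (behead_tuple I).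
  have IE : I = [tuple a; b] := tuple2E I.
  have s1 : symbol D bd w N (al - 2 + w a + w b) (fun x => La * G x a b - ricci G a b x).
    apply: (symbolB gr).
      by apply: (symbolZ gr); apply: weak (Gs.1 a b) N; move: (w a) (w b) al1 => ? ?; lra.
    by apply: symbol_exponent (ricci_decay a b N); ring.
  apply: symbol_exponent (symbol_ext gr _ s1) => [|x Dx].
    by rewrite tweight_cons tweight_cons tweight0 -/a -/b; ring.
  have <- : hessian G f a b x = nabla_iter G 2 (tensor0 f) x I.
    by rewrite /hessian -IE.
  by rewrite -(soliton a b Dx) addrAC subrr add0r.
have Cs c a b := christoffel_symbol gr c a b Gs N.
apply: symbol_exponent (nabla_symbol gr (b := al - k.+2%:R) Cs _ I) => [|J].
  by rewrite -[k.+3%:R]natr1; ring.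
exact: IH.
Qed.

(** The weights of the inverse metric cancel those of the components, which leaves [b + b] under the
    square root. *)
Lemma tip_bound_tensor_norm (k : nat) b (t : tensor k) :
  (forall I, bd (b + tweight (w := w) I) (fun x => t x I)) ->
  bd b (tensor_norm G t).
Proof.
move=> tb; apply: (tip_bound_sqrt (V := V)).
have S1 (T : finType) (F : T -> 'rV[R]_m.+1 -> R) c :
    (forall s, bd c (F s)) -> bd c (fun x => \sum_s F s x).
  move=> H; elim: (index_enum T) => [|s r IH].
    by apply: (growth_ext gr) (growth0 gr c) => x _; rewrite big_nil.
  by apply: (growth_ext gr) (growthD gr (H s) IH) => x _; rewrite big_cons.
apply: (S1 _ _ _) => I; apply: (S1 _ _ _) => J.
have P : bd (- tweight (w := w) I - tweight (w := w) J)
    (fun x => \prod_(a < k) invmx (G x) (tnth I a) (tnth J a)).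
  have := tip_bound_prod Vo (index_enum _) (fun a : 'I_k =>
    symbol_bd (Gs.2 (tnth I a) (tnth J a) 0%N)).
  by rewrite big_split /= !sumrN.
have := growthM gr (growthM gr P (tb I)) (tb J).
by congr (bd _ _); ring.
Qed.

Lemma nabla_potential_bound (k : nat) : bd (al - k.+1%:R)
  (tensor_norm G (nabla_iter G k.+1 (tensor0 f))).
Proof.
case: k => [|k]; apply: tip_bound_tensor_norm => I; last first.
  exact: symbol_bd (nabla_potential_symbol I 0%N).
have := gradient_bound (thead I); have -> : al - 1%:R + tweight (w := w) I = al - 1 + w (thead I).
  by rewrite tweight_cons tweight0 addr0.
move=> H; apply: (growth_ext gr) H => x _.
by rewrite -[RHS]/(nabla G (tensor0 f) x I) nabla_tensor0.
Qed.

End TipAnalysis.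

(** * The cone computations and the tip estimates combined on one patch *)

Section PatchConclusion.
Context {R : realType} {m : nat}.
Variables (U V B : set 'rV[R]_m).
Hypotheses (Uo : open U) (Vo : open V) (Bc : compact B).
Hypotheses (VB : V `<=` B) (BU : B `<=` U).
Hypothesis Vconvex : forall y z (t : R), V y -> V z -> 0 <= t <= 1 ->
  V (t *: (z - y) + y).
Variables (gh : 'rV[R]_m -> 'M[R]_m) (G : 'rV[R]_m.+1 -> 'M[R]_m.+1).
Hypothesis ghs : forall i j, Cinfty U (fun y => gh y i j).
Hypothesis ghT : forall y, U y -> (gh y)^T = gh y.
Hypothesis ghp : forall y, U y -> pos_def (gh y).
Hypothesis Gs : forall a b, Cinfty (truncated_cone V) (fun x => G x a b).
Hypothesis Gp : forall x, truncated_cone V x -> pos_def (G x).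
Variables (al La : R) (f : 'rV[R]_m.+1 -> R).
Hypotheses (al0 : 0 < al) (al1 : al < 1).
Hypothesis decay : forall k : nat, tip_bound V al (fun x => radius x ^+ k *
  tensor_norm (cone_metric gh)
    (nabla_iter (cone_metric gh) k (tensor2 (fun x => G x - cone_metric gh x))) x).
Hypothesis fs : Cinfty (truncated_cone U) f.
Hypothesis soliton : forall a b x, truncated_cone V x ->
  ricci G a b x + hessian G f a b x = La * G x a b.

Let gr := tip_growth Vo.
Let ghu y : U y -> gh y \in unitmx. Proof. by move=> /ghp /pos_def_unit. Qed.
Let Gu x : truncated_cone V x -> G x \in unitmx.
Proof. by move=> /Gp /pos_def_unit. Qed.
Let g0s := cone_metric_symbol Uo Vo Bc VB BU ghs ghu.
Let hs := perturbation_symbol Uo Vo Bc VB BU ghs ghu ghT ghp Gs decay.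
Let Gsy := perturbed_metric_symbol Uo Vo Bc VB BU ghs ghu ghT ghp Gs decay al0 Gu.
Let g0u := cone_metric_unit_on VB BU ghu.

Let DE x : truncated_cone V x -> cone_over U x.
Proof. by move=> [_ [x0 /VB/BU Ux]]. Qed.

Let Ch0 c a x : truncated_cone V x ->
  christoffel (cone_metric gh) c ord0 a x = (c == a)%:R * cone_weight a / radius x.
Proof.
move=> Dx; have Ux := truncated_cone_link VB BU Dx.
have r0 : radius x != 0 by rewrite gt_eqF // (truncated_cone_radius Dx).
have gu := ghu Ux.
case: (unliftP ord0 c) => [k|] ->; last first.
  rewrite (christoffel_cone0 r0 gu); last by left.
  have [<-|/negbTE] := eqVneq ord0 a; first by rewrite cone_weight0 mulr0 mul0r.
  by rewrite mul0r mul0r.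
case: (unliftP ord0 a) => [j|] ->.
  rewrite (christoffel_cones0s r0 gu (ghT Ux)) cone_weight_sh mulr1.
  by rewrite (inj_eq (@lift_inj _ ord0)).
by rewrite christoffel_cones00 cone_weight0 mulr0 mul0r.
Qed.

Theorem tip_asymptotics : exists L : R, tip_bound V al (fun x => f x - L) /\
  forall k : nat, tip_bound V (al - k.+1%:R)
    (tensor_norm G (nabla_iter G k.+1 (tensor0 f))).
Proof.
have Ricp := ricci_perturbation gr Gsy g0s hs Gu g0u.
have Chp := christoffel_perturbation gr Gsy g0s hs Gu g0u.
pose S i j y := ricci gh i j y - (m%:R - 1) * gh y i j.
have R00 a x : truncated_cone V x -> ricci (cone_metric gh) ord0 a x = 0.
  move=> /DE Ex; case: (unliftP ord0 a) => [i|] ->.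
    exact: ricci_cone0s Uo ghs ghu ghT _ _ Ex.
  exact: ricci_cone00 Uo ghu ghT _ Ex.
have Rs0 i x : truncated_cone V x ->
    ricci (cone_metric gh) (lift ord0 i) ord0 x = 0.
  by move=> /DE Ex; exact: ricci_cones0 Uo ghs ghu ghT _ _ Ex.
have Rss i j x : truncated_cone V x ->
    ricci (cone_metric gh) (lift ord0 i) (lift ord0 j) x = S i j (link_coord x).
  by move=> /DE Ex; exact: ricci_coness Uo ghs ghu ghT _ _ _ Ex.
have Sc i j y : V y -> {for y, continuous (S i j)}.
  move=> /VB/BU Uy.
  have C1 : Cinfty U (ricci gh i j).
    have M0 := Cinfty_metric (fun=> 0) Uo ghs ghu.
    exact: (iffRL (Cinfty_symbolP _ _ _ _) (ricci_symbol (trivial_growth Uo) i j M0)).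
  apply: continuousB; first exact: Cinfty_continuous C1 Uy.
  apply: continuousM; first exact: cst_continuous.
  exact: Cinfty_continuous (ghs i j) Uy.
have [L HL] := tip_limit Vo Bc VB BU al0 al1 fs Gsy Ricp Chp Ch0 R00 soliton Vconvex.
exists L; split; first exact HL.
exact (nabla_potential_bound Vo Bc VB BU al0 al1 fs Gsy Ricp Chp Ch0 R00 Rs0 Rss Sc
  soliton).
Qed.

End PatchConclusion.

(** * Charts and compactness *)

Lemma smooth_on_Cinfty (R : realType) (n : nat) (O A : set 'rV[R]_n) (u : 'rV[R]_n -> R) :
  open O -> O `<=` A -> smooth_on A u -> Cinfty O u.
Proof.
move=> Oo OA us; apply: Cinfty_local => // x /OA/us[U [h [Uo Ux hs hu]]].
by exists U, h; split=> // y Uy /OA; apply: hu.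
Qed.

Section Functions.
Context {R : realType} {n : nat}.
Implicit Types (G : 'rV[R]_n -> 'M[R]_n) (f : 'rV[R]_n -> R).

Lemma tensor_norm0 G f x : tensor_norm G (tensor0 f) x = `|f x|.
Proof.
rewrite /tensor_norm (big_pred1 [tuple]) => [|I]; last by apply/esym/eqP; rewrite (tuple0 I).
rewrite (big_pred1 [tuple]) => [|I]; last by apply/esym/eqP; rewrite (tuple0 I).
by rewrite big_ord0 mul1r -expr2 sqrtr_sqr.
Qed.

Lemma partial_addr_const i f (b : R) : partial i (fun y => f y + b) = partial i f.
Proof.
apply/funext => x; rewrite /partial /derive; set u := (X in X @ _); set v := (X in _ = lim (X @ _)).
suff -> : u = v by [].
by apply/funext => h; rewrite /u /v /=; congr (_ *: _); ring.
Qed.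

Lemma nabla_iterS_addr_const G f (b : R) k :
  nabla_iter G k.+1 (tensor0 (fun y => f y + b)) = nabla_iter G k.+1 (tensor0 f).
Proof.
elim: k => [|k IH]; last first.
  by transitivity (nabla G (nabla_iter G k.+1 (tensor0 f))); [rewrite -IH|].
apply/funext => x; apply/funext => I /=.
by rewrite /nabla !big_ord0 /tensor0 partial_addr_const.
Qed.

End Functions.

Section Charts.
Context {R : realType} {n : nat} {T : topologicalType}.
Variables (H : set 'rV[R]_n) (A : set (chart R n T)).
Hypothesis Ach : forall c, A c -> is_chart H c.
Hypothesis Acomp : forall c d, A c -> A d -> compatible c d.
Implicit Types (c d : chart R n T).

Lemma int_image_open c : A c -> open (int_image H c).
Proof.
move=> /Ach[_ [U Uo E] _ _ _]; rewrite /int_image E -setIA.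
apply: openI => //; rewrite setIidr; last exact: interior_subset.
exact: open_interior.
Qed.

Lemma cimageP c x : A c -> cimage c x -> cdom c (param c x) /\ coord c (param c x) = x.
Proof. by move=> /Ach[_ _ cK _ _] [p cp <-]; rewrite cK. Qed.

Lemma continuous_param c x : A c -> int_image H c x -> {for x, continuous (param c)}.
Proof.
move=> Ac cx; have [_ _ _ _ pc] := Ach Ac.
have : {within int_image H c, continuous (param c)}.
  by apply: continuous_subspaceW pc; apply: subIsetl.
rewrite continuous_open_subspace; last exact: int_image_open.
by apply; apply/mem_set.
Qed.

Lemma continuous_coord c p : A c -> cdom c p -> {for p, continuous (coord c)}.
Proof.
move=> Ac cp; have [co _ _ cc _] := Ach Ac; move: cc.
by rewrite continuous_open_subspace //; apply; apply/mem_set.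
Qed.

(** Restricting to points interior in both charts gives an open set, on which smoothness up to the
    boundary becomes [Cinfty] and the Jacobian is determined by the transition map alone. *)
Definition interior_overlap c d : set 'rV[R]_n :=
  [set x | [/\ int_image H c x, cdom d (param c x) & H° (transition c d x)]].

Lemma interior_overlap_open c d : A c -> A d -> open (interior_overlap c d).
Proof.
move=> Ac Ad; rewrite openE => x [cx dx Hx].
have [domo _ _ _ _] := Ach Ad.
have n1 : nbhs x (int_image H c).
  by apply: open_nbhs_nbhs; split=> //; exact: int_image_open.
have pc := continuous_param Ac cx.
have n2 : nbhs x (param c @^-1` cdom d) by apply: pc; apply: open_nbhs_nbhs.
have n3 : nbhs x (transition c d @^-1` H°).
  have tc : {for x, continuous (transition c d)}.
    by apply: continuous_comp => //; exact: continuous_coord.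
  by apply: tc; apply: open_nbhs_nbhs; split=> //; exact: open_interior.
by apply: filterS3 n1 n2 n3 => y; split.
Qed.

Lemma interior_overlap_sub c d : A c ->
  interior_overlap c d `<=` coord c @` (cdom c `&` cdom d) `&` H°.
Proof.
move=> Ac x [[cx Hx] dx _]; split=> //.
by have [c1 c2] := cimageP Ac cx; exists (param c x).
Qed.

Variables (g : chart R n T -> 'rV[R]_n -> 'M[R]_n).
Hypothesis gm : riemannian_metric H A g.

Lemma metric_pos_def c x : A c -> int_image H c x -> pos_def (g c x).
Proof. by move=> Ac cx v v0; have [_ _ gp _] := gm; apply: gp. Qed.

Lemma metric_Cinfty c i j : A c -> Cinfty (int_image H c) (fun x => g c x i j).
Proof.
move=> Ac; have [gs _ _ _] := gm.
by apply: smooth_on_Cinfty (gs c i j Ac); [exact: int_image_open|].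
Qed.

Lemma potential_Cinfty (f : T -> R) c : A c -> smooth_on_interior H A f ->
  Cinfty (int_image H c) (f \o param c).
Proof.
by move=> Ac fs; apply: smooth_on_Cinfty (fs c Ac); [exact: int_image_open|].
Qed.

Lemma tensor_norm_nabla_iter_chart (f : T -> R) c d (k : nat) p : A c -> A d ->
  smooth_on_interior H A f -> cdom c p -> cdom d p ->
  H° (coord c p) -> H° (coord d p) ->
  tensor_norm (g c) (nabla_iter (g c) k (tensor0 (f \o param c))) (coord c p) =
  tensor_norm (g d) (nabla_iter (g d) k (tensor0 (f \o param d))) (coord d p).
Proof.
move=> Ac Ad fs cp dp Hc Hd.
have [_ _ cK _ _] := Ach Ac; have [_ _ dK _ _] := Ach Ad.
have [_ gsym _ gE] := gm; have [ts _] := Acomp Ac Ad.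
have tE : transition c d (coord c p) = coord d p by rewrite /transition /= cK.
rewrite -tE; apply: (tensor_norm_nabla_iter_pullback (O := interior_overlap c d)
  (O' := int_image H d)).
- exact: interior_overlap_open.
- exact: int_image_open.
- move=> j; apply: smooth_on_Cinfty (ts j); first exact: interior_overlap_open.
  by move=> x /(interior_overlap_sub Ac)[].
- by move=> x [_ dx Hx]; split=> //; exists (param c x).
- by move=> i j; exact: metric_Cinfty.
- by move=> x [cx _ _]; apply: pos_def_unit; exact: metric_pos_def.
- by move=> x dx; exact: gsym.
- by move=> x /(interior_overlap_sub Ac)/(gE c d x Ac Ad).
- by move=> x dx; apply: pos_def_unit; exact: metric_pos_def.
- exact: potential_Cinfty.
- by move=> x [_ dx _] /=; rewrite /transition /= dK.
- by split; rewrite ?cK ?tE //; split=> //; exists p.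
Qed.

End Charts.

Lemma halfspace_interior (R : realType) (m : nat) (x : 'rV[R]_m.+1) :
  0 < radius x -> (@halfspace R m)° x.
Proof.
move=> x0; have : nbhs x [set y : 'rV[R]_m.+1 | 0 < radius y].
  apply: open_nbhs_nbhs; split=> //.
  apply: (@open_comp _ _ radius [set r : R | 0 < r]) => [y _|].
    exact: continuous_radius.
  exact: open_gt.
by apply: filterS => y /= /ltW.
Qed.

(** An open ball and the closed ball of the same radius, half that of a ball inside [U]; closed
    balls are compact in finite dimension. *)
Lemma convex_neighbourhood (R : realType) (n : nat) (U : set 'rV[R]_n) y0 :
  open U -> U y0 -> exists V B : set 'rV[R]_n,
    [/\ open V, V y0 & compact B] /\ [/\ V `<=` B, B `<=` U &
      forall y z (t : R), V y -> V z -> 0 <= t <= 1 -> V (t *: (z - y) + y)].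
Proof.
move=> Uo Uy.
have [e e0 eU] : exists2 e : R, 0 < e & ball y0 e `<=` U.
  by apply/nbhs_ballP; apply: open_nbhs_nbhs.
have e20 : 0 < e / 2 by rewrite divr_gt0.
have ballE d y : ball y0 d y = (`|y0 - y| < d) :> Prop.
  by rewrite -ball_normE.
exists (ball y0 (e / 2)), (closed_ball y0 (e / 2)); split; split.
- exact: ball_open.
- exact: ballxx.
- apply: bounded_closed_compact; last exact: closed_ball_closed.
  rewrite closed_ballE //; exists (`|y0| + e / 2); split; first exact: num_real.
  move=> M0 hM y; rewrite /closed_ball_ /= => yd.
  apply: le_trans (ltW hM); rewrite -lerBlDl.
  apply: le_trans (lerB_dist _ _) _; by rewrite distrC.
- exact: subset_closed_ball.
- move=> y; rewrite closed_ballE // /closed_ball_ /= => yd; apply: eU.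
  rewrite ballE; apply: le_lt_trans yd _.
  by rewrite ltr_pdivrMr // ltr_pMr // ltr1n.
- move=> y z t; rewrite !ballE => yd zd /andP[t0 t1].
  have -> : y0 - (t *: (z - y) + y) = t *: (y0 - z) + (1 - t) *: (y0 - y).
    by apply/rowP => i; rewrite !mxE; ring.
  apply: le_lt_trans (ler_normD _ _) _; rewrite !normrZ (ger0_norm t0).
  rewrite ger0_norm ?subr_ge0 //.
  have -> : e / 2 = t * (e / 2) + (1 - t) * (e / 2) by ring.
  have [t00|] := eqVneq t 0; first by rewrite t00 !mul0r !add0r subr0 !mul1r.
  move=> tn; apply: ltr_leD; first by rewrite ltr_pM2l // lt_neqAle eq_sym tn.
  by apply: ler_wpM2l; [rewrite subr_ge0|exact: ltW].
Qed.

(** * From patches to the collar and to the whole manifold *)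

Section Cone.
Context {R : realType} {m : nat} {M F : topologicalType}.
Variables (AM : set (chart R m.+1 M)) (AF : set (chart R m F)).
Variables (g : chart R m.+1 M -> 'rV[R]_m.+1 -> 'M[R]_m.+1).
Variables (ghat : chart R m F -> 'rV[R]_m -> 'M[R]_m).
Variables (K : collar R M F) (f : M -> R) (La : R).
Hypothesis hM : conical_manifold AM g AF ghat K.
Hypothesis hf : gradient_ricci_soliton AM g f La.
Implicit Types (a : chart R m F) (c d : chart R m.+1 M).
Local Notation H := (@halfspace R m).

Let AMch c : AM c -> is_chart H c.
Proof. by have [[[_ _ [ch _ _ _]] _] _ _ _ _] := hM; apply: ch. Qed.

Let AMcov p : exists2 c, AM c & cdom c p.
Proof. by have [[[_ _ [_ ch _ _]] _] _ _ _ _] := hM; apply: ch. Qed.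

Let AMcomp c d : AM c -> AM d -> compatible c d.
Proof. by have [[[_ _ [_ _ ch _]] _] _ _ _ _] := hM; apply: ch. Qed.

Let AFch a : AF a -> is_chart setT a.
Proof. by have [_ _ [[_ _ [ch _ _ _]] _ _ _] _ _] := hM; apply: ch. Qed.

Let AFcov q : exists2 a, AF a & cdom a q.
Proof. by have [_ _ [[_ _ [_ ch _ _]] _ _ _] _ _] := hM; apply: ch. Qed.

Let Fcompact : compact [set: F].
Proof. by have [_ _ [_ ? _ _] _ _] := hM. Qed.

Let Fconnected : connected [set: F].
Proof. by have [_ _ [_ _ ? _] _ _] := hM. Qed.

Let gm : riemannian_metric H AM g.
Proof. by have [] := hM. Qed.

Let ghm : riemannian_metric setT AF ghat.
Proof. by have [_ _ [_ _ _ ?] _ _] := hM. Qed.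

Let col : is_collar AM AF K.
Proof. by have [] := hM. Qed.

Let link_int_image a y : cimage a y -> int_image setT a y.
Proof. by move=> ay; split=> //; rewrite interiorT. Qed.

Let link_image_open a : AF a -> open (cimage a).
Proof.
move=> Aa; have E : cimage a = int_image setT a by rewrite /int_image interiorT setIT.
rewrite E; exact (int_image_open AFch Aa).
Qed.

(** [mboundary] asks for a single chart, so a point outside it, such as one of positive radius, is
    interior in every chart around it. *)
Lemma collar_interior c p : AM c -> cdom c p -> cset K p -> 0 < crad K p ->
  H° (coord c p).
Proof.
move=> Ac cp Kp r0; apply: contrapT => nH.
have [_ _ _ bd _] := col.
have /bd[_ r0'] : mboundary H AM p by exists c.
by rewrite r0' ltxx in r0.
Qed.

Let cone_image a : AF a -> truncated_cone (cimage a) `<=` int_image H (collar_chart K a).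
Proof.
move=> Aa x [x1 [x0 ax]]; split; last exact: halfspace_interior.
have [a1 a2] := cimageP AFch Aa ax.
have [_ _ H3 _ _] := col.
have [|K1 K2 K3] := H3 (radius x) (param a (link_coord x)).
  by rewrite (ltW x0).
exists (cmap K (radius x) (param a (link_coord x))).
  by split=> //=; rewrite K3.
rewrite /= K2 K3 a2; exact: cone_pointK.
Qed.

Let coneAM a : AF a -> AM (collar_chart K a).
Proof. by have [_ _ _ _] := col; apply. Qed.

Definition conical_decay (al : R) : Prop := forall k, exists C eta : R,
  [/\ 0 <= C, 0 < eta & forall a p, AF a -> cset K p -> 0 < crad K p < eta ->
    cdom a (cprj K p) ->
    crad K p ^+ k * tensor_norm (cone_metric (ghat a))
      (nabla_iter (cone_metric (ghat a)) k
        (tensor2 (fun x => g (collar_chart K a) x - cone_metric (ghat a) x)))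
      (coord (collar_chart K a) p) <= C * crad K p `^ al].

(** The minimum with [1/2] makes the rate [1 - al] of the radial equation positive. Lowering the
    exponent weakens the bound because radii are kept below 1. *)
Lemma conical_decay_exponent : exists2 al : R, 0 < al < 1 & conical_decay al.
Proof.
have [_ _ _ _ [alpha a0 ac]] := hM.
exists (Num.min alpha 2^-1).
  by rewrite lt_min a0 invr_gt0 ltr0n /= gt_min [X in _ || X]invf_lt1 ?ltr0n ?ltr1n ?orbT.
move=> k; have [C [eta e0 HC]] := ac k.
exists `|C|, (Num.min eta 1); split=> //; first by rewrite lt_min e0 ltr01.
move=> a p Aa Kp /andP[r0 re1] ap.
have /andP[re r1] : (crad K p < eta) && (crad K p < 1) by rewrite -lt_min.
have re' : 0 < crad K p < eta by rewrite r0.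
apply: le_trans (HC p Kp re' a Aa ap) _.
apply: le_trans (_ : `|C| * crad K p `^ alpha <= _).
  by rewrite ler_wpM2r ?powR_ge0 ?ler_norm.
rewrite ler_wpM2l //; apply: ger_powR; first by rewrite r0 ltW.
by rewrite ge_min lexx.
Qed.

Variable al : R.
Hypotheses (al01 : 0 < al < 1) (decay : conical_decay al).

(** The patch estimates hold in one collar chart; invariance of the norms carries them to every
    chart [c] at [p] with the same constants. The limit [L] may still depend on the patch. *)
Lemma collar_asymptotics_local (q0 : F) : exists (N : set F) (L : R), nbhs q0 N /\
  (exists C eta : R, [/\ 0 <= C, 0 < eta & forall p, cset K p -> N (cprj K p) ->
     0 < crad K p < eta -> `|f p - L| <= C * crad K p `^ al]) /\
  forall k, exists C eta : R, [/\ 0 <= C, 0 < eta &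
    forall p, cset K p -> N (cprj K p) -> 0 < crad K p < eta ->
      forall c, AM c -> cdom c p ->
      tensor_norm (g c) (nabla_iter (g c) k.+1 (tensor0 (f \o param c))) (coord c p)
      <= C * crad K p `^ (al - k.+1%:R)].
Proof.
have [a Aa aq] := AFcov q0.
pose U := cimage a; have Uo : open U := link_image_open Aa.
have Uy : U (coord a q0) by exists q0.
have [V [B [[Vo Vy Bc] [VB BU Vconvex]]]] := convex_neighbourhood Uo Uy.
have VU : V `<=` U by move=> y /VB/BU.
pose c := collar_chart K a.
have Ac : AM c by apply: coneAM.
have coneVU : truncated_cone V `<=` truncated_cone U.
  by move=> x [x1 [x0 Vx]]; split=> //; split=> //; apply: VU.
have coneV x : truncated_cone V x -> int_image H c x.
  by move=> /coneVU; apply: cone_image.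
have /andP[al0 al1] := al01.
have cK : forall p, cdom c p -> param c (coord c p) = p.
  by have [_ _ ? _ _] := AMch Ac.
have [ghsm ghsym _ _] := ghm; have [gsm gsym _ _] := gm; have [fsm sol] := hf.
have aU y : U y -> int_image setT a y by apply: link_int_image.
have ghs i j : Cinfty U (fun y => ghat a y i j).
  exact: smooth_on_Cinfty Uo aU (ghsm a i j Aa).
have ghT y : U y -> (ghat a y)^T = ghat a y by move=> /aU; apply: ghsym.
have ghp y : U y -> pos_def (ghat a y) by move=> /aU; apply: (metric_pos_def ghm).
have Gs i j : Cinfty (truncated_cone V) (fun x => g c x i j).
  exact: smooth_on_Cinfty (truncated_cone_open Vo) coneV (gsm c i j Ac).
have Gp x : truncated_cone V x -> pos_def (g c x).
  by move=> /coneV; apply: (metric_pos_def gm).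
have fs : Cinfty (truncated_cone U) (f \o param c).
  exact: smooth_on_Cinfty (truncated_cone_open Uo) (cone_image Aa) (fsm c Ac).
have soliton i j x : truncated_cone V x ->
    ricci (g c) i j x + hessian (g c) (f \o param c) i j x = La * g c x i j.
  by move=> /coneV; apply: sol.
have dec k : tip_bound V al (fun x => radius x ^+ k *
    tensor_norm (cone_metric (ghat a)) (nabla_iter (cone_metric (ghat a)) k
      (tensor2 (fun x => g c x - cone_metric (ghat a) x))) x).
  have [C [eta [C0 e0 HC]]] := decay k; exists C, eta; split=> // x Vx xe.
  have x0 := truncated_cone_radius Vx.
  have [[p [Kp ap] px] _] := coneV x Vx.
  have Ep : crad K p = radius x by rewrite -px /= cone_point_radius.
  rewrite ger0_norm; last by rewrite mulr_ge0 ?sqrtr_ge0 // exprn_ge0 // ltW.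
  by rewrite -Ep -px; apply: HC => //; rewrite Ep x0.
have [L [HL HN]] := tip_asymptotics Uo Vo Bc VB BU Vconvex ghs ghT ghp Gs Gp
  al0 al1 dec fs soliton.
pose N := cdom a `&` coord a @^-1` V.
have nN : nbhs q0 N.
  have [ao _ _ _ _] := AFch Aa.
  apply: filterI; first exact: open_nbhs_nbhs.
  by apply: (continuous_coord AFch Aa aq); apply: open_nbhs_nbhs.
have inV p : cset K p -> N (cprj K p) -> 0 < crad K p ->
    truncated_cone V (coord c p).
  move=> Kp [ap Vp] r0; have [_ H2 _ _ _] := col.
  by have [/andP[_ r1] _] := H2 p Kp; apply: cone_point_in; rewrite ?r0.
exists N, L; split=> //; split.
  have [C [eta [C0 e0 HC]]] := HL; exists C, eta; split=> // p Kp Np /andP[r0 re].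
  have := HC _ (inV p Kp Np r0); rewrite /= cone_point_radius => /(_ re).
  by rewrite -[cmap K _ _]/(param c (coord c p)) cK //; split=> //; case: Np.
move=> k; have [C [eta [C0 e0 HC]]] := HN k; exists C, eta.
split=> // p Kp Np /andP[r0 re] d Ad dp.
have Vp := inV p Kp Np r0.
have cp : cdom c p by split=> //; case: Np.
have Hc := collar_interior Ac cp Kp r0; have Hd := collar_interior Ad dp Kp r0.
rewrite (tensor_norm_nabla_iter_chart AMch AMcomp gm k.+1 Ad Ac fsm dp cp Hd Hc).
apply: le_trans (ler_norm _) _.
by have := HC _ Vp; rewrite cone_point_radius => /(_ re).
Qed.

(** Compactness of the link, in its near-covering form for the filter of [e] tending to 0 from the
    right, yields one radius for all the local neighbourhoods. *)
Lemma near_tip_local (P : M -> Prop) :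
  (forall q0 : F, exists (N : set F) (eta : R), [/\ nbhs q0 N, 0 < eta &
    forall p, cset K p -> N (cprj K p) -> 0 < crad K p < eta -> P p]) ->
  near_tip K P.
Proof.
move=> loc.
have /compact_near_coveringP cov := Fcompact.
have /filter_ex[e [e0 He]] : \forall e \near (0 : R)^'+, 0 < e /\
    [set: F] `<=` (fun q => forall p, cset K p -> cprj K p = q ->
      0 < crad K p < e -> P p).
  apply: filterI; first exact: nbhs_right_gt.
  apply: (cov R (0 : R)^'+ (fun e q => forall p, cset K p -> cprj K p = q ->
      0 < crad K p < e -> P p)) => q0 _.
  have [N [eta [nN e0 HN]]] := loc q0.
  exists (N, [set e | e < eta]); first by split=> //; exact: nbhs_right_lt.
  move=> [q e] [/= Nq ee] p Kp pq /andP[r0 re]; apply: HN; rewrite ?pq // r0.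
  exact: lt_trans ee.
exists e => // p Kp re; exact: (He (cprj K p)).
Qed.

(** The limit along a ray does not refer to a patch, so its uniqueness identifies the constants of
    overlapping patches. *)
Let is_limit (q : F) (L : R) : Prop := f (cmap K r q) @[r --> (0 : R)^'+] --> L.

Let is_limit_unique q L L' : is_limit q L -> is_limit q L' -> L = L'.
Proof. by move=> H1 H2; apply: cvg_unique H1 H2; exact: norm_hausdorff. Qed.

Let is_limit_locally (q0 : F) : exists (N : set F) (L : R), nbhs q0 N /\
  (forall q, N q -> is_limit q L) /\
  exists C eta : R, [/\ 0 <= C, 0 < eta & forall p, cset K p -> N (cprj K p) ->
     0 < crad K p < eta -> `|f p - L| <= C * crad K p `^ al].
Proof.
have [N [L [nN [HL _]]]] := collar_asymptotics_local q0.
exists N, L; split=> //; split=> // q Nq; apply/cvgrPdist_le => eps eps0.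
have [C [eta [C0 e0 HC]]] := HL; have /andP[al0 _] := al01.
have [d d0 D] := small_powR al0 C0 eps0.
near=> r; have r0 : 0 < r by [].
have rd : r < d by near: r; exact: nbhs_right_lt.
have re : r < eta by near: r; exact: nbhs_right_lt.
have r1 : r < 1 by near: r; exact: nbhs_right_lt.
have [_ _ H3 _ _] := col; have [|K1 K2 K3] := H3 r q; first by rewrite ltW.
have := HC (cmap K r q) K1; rewrite K3 K2 r0 re distrC => /(_ Nq isT) /le_trans; apply.
by apply: D; rewrite r0.
Unshelve. all: by end_near.
Qed.

Let is_limit_global : exists L, forall q, is_limit q L.
Proof.
have [[q0]|nF] := pselect (exists q : F, True); last first.
  by exists 0 => q; case: nF; exists q.
move=> _; have [N0 [L [/nbhs_singleton Nq [HL _]]]] := is_limit_locally q0.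
(* The limit is locally constant, so any condition on it defines an open set. Taking the condition
   to be equality with [L], then its negation, gives a clopen set in the connected link. *)
have op (Q : R -> Prop) : open [set q | exists2 L', is_limit q L' & Q L'].
  rewrite openE => q [L' qL' QL'].
  have [N [L1 [nN [H1 _]]]] := is_limit_locally q.
  have E := is_limit_unique qL' (H1 q (nbhs_singleton nN)).
  by apply: filterS nN => q' Nq'; exists L'; [rewrite E; apply: H1|].
exists L => q.
suff AE : [set q | exists2 L', is_limit q L' & L' = L] = setT :> set F.
  by have : [set: F] q by []; rewrite -AE => -[L' qL <-].
have E : [set q | exists2 L', is_limit q L' & L' = L] =
    ~` [set q | exists2 L', is_limit q L' & L' <> L] :> set F.
  apply/seteqP; split=> x /=.
    move=> [L1 H1 <-] [L2 H2]; apply; exact: is_limit_unique H2 H1.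
  move=> H1; have [N [L1 [nN [H2 _]]]] := is_limit_locally x.
  exists L1; first by apply: H2; exact: nbhs_singleton.
  apply: contrapT => ne; apply: H1; exists L1 => //.
  by apply: H2; exact: nbhs_singleton.
apply: Fconnected.
- by exists q0; exists L => //; apply: HL.
- exists [set q | exists2 L', is_limit q L' & L' = L]; last by rewrite setTI.
  exact: op.
- exists [set q | exists2 L', is_limit q L' & L' = L]; last by rewrite setTI.
  by rewrite E; apply: open_closedC; exact: op.
Qed.

Lemma collar_limit : exists L, forall q0 : F, exists (N : set F) (C eta : R),
  [/\ nbhs q0 N, 0 <= C, 0 < eta & forall p, cset K p -> N (cprj K p) ->
     0 < crad K p < eta -> `|f p - L| <= C * crad K p `^ al].
Proof.
have [L HL] := is_limit_global; exists L => q0.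
have [N [L1 [nN [H1 [C [eta [C0 e0 HC]]]]]]] := is_limit_locally q0.
exists N, C, eta; split=> //.
by rewrite (is_limit_unique (HL q0) (H1 q0 (nbhs_singleton nN))).
Qed.

(** The spare factor [r^(b - d)] turns big O into little o. The bounded quantity is a set [u p] so
    that it can range over all charts at [p]. *)
Lemma near_tip_powR (u : M -> set R) (b d : R) : d < b ->
  (forall q0 : F, exists (N : set F) (C eta : R), [/\ nbhs q0 N, 0 <= C, 0 < eta &
    forall p, cset K p -> N (cprj K p) -> 0 < crad K p < eta ->
      forall v, u p v -> v <= C * crad K p `^ b]) ->
  forall eps : R, 0 < eps -> near_tip K (fun p => forall v, u p v -> v <= eps * crad K p `^ d).
Proof.
move=> db H1 eps eps0; apply: near_tip_local => q0.
have [N [C [eta [nN C0 e0 HN]]]] := H1 q0.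
have bd0 : 0 < b - d by rewrite subr_gt0.
have [e1 e10 E1] := small_powR bd0 C0 eps0.
exists N, (Num.min eta e1); split=> //; first by rewrite lt_min e0.
move=> p Kp Np /andP[r0]; rewrite lt_min => /andP[re r1] v uv.
have := HN p Kp Np; rewrite r0 re => /(_ isT v uv) /le_trans; apply.
have -> : b = (b - d) + d by ring.
rewrite powRD; last by rewrite (gt_eqF r0) implybT.
by rewrite mulrA ler_wpM2r ?powR_ge0 //; apply: E1; rewrite r0.
Qed.

(** Compactness of [M] is used in near-covering form for [B] tending to infinity. The values of [f]
    on the boundary are arbitrary, so a boundary point is covered through the decay on interior
    points near it, any other point through continuity. *)
Lemma interior_bounded (L : R) : near_tip K (fun p => `|f p - L| <= 1) ->
  exists B : R, forall p, minterior H AM p -> `|f p - L| <= B.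
Proof.
move=> [eta e0 He]; have [_ H2 _ bd _] := col; have [fsm _] := hf.
have [[_ Mcompact] _ _ _ _] := hM; have /compact_near_coveringP cov := Mcompact.
have /filter_ex[B HB] : \forall B \near +oo, [set: M] `<=`
    (fun p => minterior H AM p -> `|f p - L| <= B); last by exists B => p; apply: HB.
apply: (cov R +oo (fun B p => minterior H AM p -> `|f p - L| <= B)) => p0 _.
have [b0|i0] := pselect (mboundary H AM p0).
  have [Kp0 r0] := (bd p0).1 b0; have [a Aa ap0] := AFcov (cprj K p0).
  have cp0 : cdom (collar_chart K a) p0 by [].
  have cc := continuous_coord AMch (coneAM Aa) cp0.
  have [co _ _ _ _] := AMch (coneAM Aa).
  have n1 : nbhs p0 (cdom (collar_chart K a)) by apply: open_nbhs_nbhs.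
  have n2 : nbhs p0 (coord (collar_chart K a) @^-1` [set x | radius x < eta]).
    apply: cc; apply: open_nbhs_nbhs; split.
      apply: (@open_comp _ _ radius [set r : R | r < eta]) => [y _|].
        exact: continuous_radius.
      exact: open_lt.
    by rewrite /= cone_point_radius r0.
  exists (cdom (collar_chart K a) `&` (coord (collar_chart K a) @^-1`
    [set x | radius x < eta]), [set B | 1 <= B]).
    by split; [exact: filterI|exact: nbhs_pinfty_ge].
  move=> [p B] [/= [[Kp ap]]]; rewrite cone_point_radius => pe B1 ip.
  (* The radius of [p] is positive, since radius 0 would put [p] on the boundary. *)
  apply: le_trans B1; apply: (He p Kp); rewrite pe andbT lt_neqAle.
  have [/andP[-> _] _] := H2 p Kp; rewrite andbT; apply/eqP => r0'.
  by apply: ip; apply/bd.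
have [c Ac cp0] := AMcov p0.
have [co _ cK _ _] := AMch Ac.
have Hc : int_image H c (coord c p0).
  by split; [exists p0|apply: contrapT => nH; apply: i0; exists c].
have fc := Cinfty_continuous (potential_Cinfty AMch Ac fsm) Hc.
have n1 : nbhs p0 (cdom c) by apply: open_nbhs_nbhs.
have n2 : nbhs p0 [set p | `|f p0 - f (param c (coord c p))| < 1].
  have : {for p0, continuous ((f \o param c) \o coord c)}.
    exact: continuous_comp (continuous_coord AMch Ac cp0) fc.
  by move=> /cvgrPdist_lt/(_ 1 ltr01) /=; rewrite cK.
exists (cdom c `&` [set p | `|f p0 - f (param c (coord c p))| < 1],
    [set B | `|f p0 - L| + 1 <= B]).
  by split; [exact: filterI|exact: nbhs_pinfty_ge].
move=> [p B] [/= [cp]]; rewrite cK // => fp B1 _; apply: le_trans B1.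
have -> : f p - L = (f p0 - L) - (f p0 - f p) by ring.
by apply: le_trans (ler_normB _ _) _; rewrite lerD2l ltW.
Qed.

Theorem potential_asymptotics : exists b : R, let f' := fun p => f p + b in
  [/\ exists2 delta0 : R, 0 < delta0 &
        forall i : nat, nabla_littleo AM g K f' i (delta0 - i%:R),
      forall eps : R, 0 < eps -> near_tip K (fun p => `|f' p| <= eps) &
      exists B : R, forall p, minterior H AM p -> `|f' p| <= B].
Proof.
have [L HL] := collar_limit; have /andP[al0 al1] := al01.
have small (d : R) : d < al -> forall eps, 0 < eps ->
    near_tip K (fun p => `|f p - L| <= eps * crad K p `^ d).
  move=> dal eps eps0; have [|eta e0 He] := near_tip_powR (u := fun p => [set `|f p - L|])
      dal _ eps0; last by exists eta => // p Kp rp; exact: He.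
  move=> q0; have [N [C [eta [nN C0 e0 HN]]]] := HL q0; exists N, C, eta.
  by split=> // p Kp Np rp _ ->; exact: HN.
have small0 eps : 0 < eps -> near_tip K (fun p => `|f p - L| <= eps).
  move=> /(small 0 al0)[eta e0 He]; exists eta => // p Kp rp.
  by have := He p Kp rp; rewrite powRr0 mulr1.
exists (- L); split => //; last by apply: interior_bounded; exact: small0.
have ala : al / 2 < al by rewrite ltr_pdivrMr // ltr_pMr // ltr1n.
exists (al / 2); first by rewrite divr_gt0.
case=> [|k] eps eps0.
  have [eta e0 He] := small _ ala eps eps0; exists eta => // p Kp rp c Ac cp.
  have [_ _ cK _ _] := AMch Ac.
  rewrite subr0 tensor_norm0 /= cK //; exact: He.
have db : al / 2 - k.+1%:R < al - k.+1%:R by rewrite ltrD2r.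
have [q0|eta e0 He] := near_tip_powR (u := fun p => [set v | exists c, [/\ AM c, cdom c p &
  v = tensor_norm (g c) (nabla_iter (g c) k.+1 (tensor0 (f \o param c))) (coord c p)]])
  db _ eps0.
  have [N [_ [nN [_ /(_ k)[C [eta [C0 e0 HN]]]]]]] := collar_asymptotics_local q0.
  exists N, C, eta; split=> // p Kp Np rp _ [c [Ac cp ->]]; exact: HN.
exists eta => // p Kp rp c Ac cp; apply: He => //; exists c; split=> //.
have E := nabla_iterS_addr_const (g c) (f \o param c) (- L) k.
exact (congr1 (fun t => tensor_norm (g c) t (coord c p)) E).
Qed.

End Cone.

(* The dimension n of M is m + 1. *)
Theorem proposition9p3 (R : realType) (m : nat) (M F : topologicalType)
    (AM : set (chart R m.+1 M)) (AF : set (chart R m F))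
    (g : chart R m.+1 M -> 'rV[R]_m.+1 -> 'M[R]_m.+1)
    (ghat : chart R m F -> 'rV[R]_m -> 'M[R]_m)
    (K : collar R M F) (f : M -> R) (Lambda : R)
    (hM : conical_manifold AM g AF ghat K)
    (hf : gradient_ricci_soliton AM g f Lambda)
    (hscal : forall a y, AF a -> cimage a y ->
       scalar_curvature (ghat a) y = (m.+1%:R - 1) * (m.+1%:R - 2)) :
  exists b : R, let f' := fun p => f p + b in
    [/\ exists2 delta0 : R, 0 < delta0 &
          forall i : nat, nabla_littleo AM g K f' i (delta0 - i%:R),
        forall eps : R, 0 < eps -> near_tip K (fun p => `|f' p| <= eps) &
        exists B : R, forall p, minterior (@halfspace R m) AM p ->
          `|f' p| <= B].
Proof.
have [al al01 decay] := conical_decay_exponent hM.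
exact (potential_asymptotics hM hf al01 decay).
Qed.
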